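(* Let $W$ be a nonnegative random variable with $\mathbb{E}W^2=1$ and let $s\ge 1$ or $s=1/2$. Let $W^*$ have the $s$-TDSB distribution of $W$ and be defined on the same probability space as $W$. If $s\ge 1$, then $$d_{\mathrm W}(\mathscr{L}(W),K_s)\le 8s\Bigl(s+\frac14+\sqrt{\frac{\pi}{2}}\Bigr)\mathbb{E}|W-W^*|,$$ and, for any $\beta\ge 0$, $$d_{\mathrm K}(\mathscr{L}(W),K_s)\le 53 s\beta+34 s^{3/2}\,\mathbb{P}[|W-W^*|>\beta].$$ If $s=1/2$, then $$d_{\mathrm W}(\mathscr{L}(W),K_{1/2})\le 2\,\mathbb{E}|W-W^*|,$$ and, for any $\beta\ge0$, $$d_{\mathrm K}(\mathscr{L}(W),K_{1/2})\le 26\beta+8\,\mathbb{P}[|W-W^*|>\beta].$$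
   Context: For $s\ge 1/2$, $K_s$ denotes the probability distribution (and its distribution function) on $(0,\infty)$ with density $$\kappa_s(x)=\Gamma(s)\sqrt{\frac{2}{s\pi}}\exp\Bigl(\frac{-x^2}{2s}\Bigr)U\Bigl(s-1,\frac12,\frac{x^2}{2s}\Bigr),\quad x>0,$$ where $U(a,b,z)$ is the confluent hypergeometric function of the second kind (Kummer $U$ function): the solution of $z\,U''+(b-z)U'-aU=0$ (derivatives in $z$) with $U(a,b,z)\sim z^{-a}$ as $z\to\infty$. For a nonnegative random variable $W$ with finite nonzero second moment, $W''$ has the double size bias distribution of $W$ if $\mathbb{E}\{W^2f(W)\}=\mathbb{E}W^2\,\mathbb{E}f(W'')$ for all $f$ with $\mathbb{E}|W^2f(W)|<\infty$. For fixed $s\ge1/2$ let $U_1,U_2$ be independent uniform random variables on $[0,1]$ and $Y$ a Bernoulli random variable with parameter $(2s)^{-1}$ independent of $U_1,U_2$, and set $V=Y\max(U_1,U_2)+(1-Y)\min(U_1,U_2)$. A random variable $W^*$ has the $s$-transformed double size biased ($s$-TDSB) distribution of $W$ if $\mathscr{L}(W^* )=\mathscr{L}(VW'')$, where $W''$ has the double size bias distribution of $W$ and is independent of $V$. $\mathscr{L}(X)$ is the law of $X$. For probability distribution functions $P,Q$: $d_{\mathrm K}(P,Q)=\sup_x|P(x)-Q(x)|$ and $d_{\mathrm W}(P,Q)=\sup_{h:\|h'\|=1}\left|\int h\,dP-\int h\,dQ\right|$ (the supremum over Lipschitz functions $h$ with $\|h'\|=1$, $\|\cdot\|$ the (essential)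 supremum norm). *)

(* Defs.v *)
From HB Require Import structures.
From mathcomp Require Import all_boot all_order all_algebra.
From mathcomp Require Import all_classical all_reals all_analysis.

Set Implicit Arguments.
Unset Strict Implicit.
Unset Printing Implicit Defensive.

Import Order.TTheory GRing.Theory Num.Theory.
Import numFieldNormedType.Exports.

Local Open Scope classical_set_scope.
Local Open Scope ring_scope.

Section special_functions.
Context {R : realType}.

Definition Gamma (s : R) : R :=
  \int[lebesgue_measure]_(t in `]0, +oo[) (t `^ (s - 1) * expR (- t)).

Definition is_kummerU (a b : R) (u : R -> R) : Prop :=
  (forall z : R, 0 < z ->
    [/\ derivable u z 1, derivable (derive1 u) z 1 &
        z * derive1 (derive1 u) z + (b - z) * derive1 u z - a * u z = 0]) /\
  u z / z `^ (- a) @[z --> +oo] --> (1 : R).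

(* The conditions determine u on ]0, +oo[, the only place where the function
   is ever evaluated; its values elsewhere are arbitrary. *)
Definition kummerU (a b : R) : R -> R :=
  xget (fun=> 0) [set u : R -> R | is_kummerU a b u].

End special_functions.

Section K_distribution.
Context {R : realType}.

Definition kappa (s x : R) : R :=
  Gamma s * Num.sqrt (2 / (s * pi)) * expR (- x ^+ 2 / (2 * s)) *
  kummerU (s - 1) 2^-1 (x ^+ 2 / (2 * s)).

(* The law with density kappa s on ]0, +oo[; that it is a probability measure is a
   fact about kappa and is not built into the definition. *)
Definition K_ (s : R) : set (measurableTypeR R) -> \bar R :=
  fun A => (\int[lebesgue_measure]_(x in A `&` `]0%R, +oo[) (kappa s x)%:E)%E.

End K_distribution.

Section laws.
Context {R : realType}.

Definition same_law {d} {T : measurableType d} (mu nu : set T -> \bar R) :=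
  forall A, measurable A -> mu A = nu A.

Definition independent2 {d d1 d2} {T : measurableType d}
    {T1 : measurableType d1} {T2 : measurableType d2}
    (P : probability T R) (X : T -> T1) (Y : T -> T2) :=
  forall A B, measurable A -> measurable B ->
    P (X @^-1` A `&` Y @^-1` B) = (P (X @^-1` A) * P (Y @^-1` B))%E.

Definition independent3 {d d1 d2 d3} {T : measurableType d}
    {T1 : measurableType d1} {T2 : measurableType d2} {T3 : measurableType d3}
    (P : probability T R) (X : T -> T1) (Y : T -> T2) (Z : T -> T3) :=
  forall A B C, measurable A -> measurable B -> measurable C ->
    P (X @^-1` A `&` Y @^-1` B `&` Z @^-1` C) =
      (P (X @^-1` A) * P (Y @^-1` B) * P (Z @^-1` C))%E.

(* W'' need not live on the probability space of W. *)
Definition double_size_bias {d d'} {T : measurableType d}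
    {T' : measurableType d'} (P : probability T R) (P' : probability T' R)
    (W : {RV P >-> R}) (W'' : {RV P' >-> R}) :=
  forall f : R -> R, measurable_fun [set: R] f ->
    P.-integrable [set: T] (fun w => (W w ^+ 2 * f (W w))%:E) ->
    ('E_P[fun w => (W w ^+ 2 * f (W w))%R] =
      'E_P[fun w => (W w ^+ 2)%R] * 'E_P'[fun w => f (W'' w)])%E.

Definition V_of {T : Type} (Y : T -> bool) (U1 U2 : T -> R) (w : T) : R :=
  (Y w)%:R * Num.max (U1 w) (U2 w) + (1 - (Y w)%:R) * Num.min (U1 w) (U2 w).

Definition TDSB (s : R) {d} {T : measurableType d} {d0} {T0 : measurableType d0}
    (P : probability T R) (P0 : probability T0 R)
    (W : {RV P >-> R}) (Wstar : {RV P0 >-> R}) : Prop :=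
  exists (d' : measure_display) (T' : measurableType d')
         (P' : probability T' R)
         (U1 U2 : {RV P' >-> R}) (Y : {RV P' >-> bool}) (W'' : {RV P' >-> R}),
    same_law (distribution P' U1) (uniform_prob (@ltr01 R)) /\
    same_law (distribution P' U2) (uniform_prob (@ltr01 R)) /\
    same_law (distribution P' Y) (bernoulli_prob (2 * s)^-1) /\
    independent3 P' U1 U2 Y /\
    double_size_bias W W'' /\
    independent2 P' (V_of Y U1 U2) W'' /\
    same_law (distribution P0 Wstar)
      (pushforward P' (fun w => V_of Y U1 U2 w * W'' w)).

End laws.

Section distances.
Context {R : realType}.
Implicit Types P Q : set (measurableTypeR R) -> \bar R.
Local Open Scope ereal_scope.

Definition dK P Q : \bar R :=
  ereal_sup [set `| P `]-oo, x]%classic - Q `]-oo, x]%classic | | x in [set: R]].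

(* A Lipschitz function is differentiable almost everywhere, so the arbitrary
   values of derive1 h elsewhere do not affect its essential supremum norm. *)
Definition dW P Q : \bar R :=
  ereal_sup [set `| \int[P]_x (h x)%:E - \int[Q]_x (h x)%:E |
            | h in [set h : R -> R | lipschitz h /\
                'N[lebesgue_measure]_+oo [EFin \o derive1 h] = 1]].

End distances.

(* Main.v *)
(* For bounded continuous M the s-TDSB identity reads
     E M(Wstar) = s^-1 E int_0^W (W + n (W - t)) M(t) dt,   n = 2 s - 2,
   because V has density (1 + n (1 - v)) / s on [0, 1]. Hence, if M solves the Volterra equation
     M(w) - s^-1 int_0^w (w + n (w - t)) M(t) dt = h(w) - int h dK_s,
   then E h(W) - int h dK_s = E M(W) - E M(Wstar), and it remains to bound the increments of M.
   For s >= 1 write kappa_s = V phi with phi(x) = exp (- x^2 / (2 s)). Kummer's equation integrates to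
   s phi V' = - n K_s(x, oo), and M = s f'' for the explicit solution f of a second-order Stein
   equation; f, f' and M are bounded by comparison with explicit functions vanishing at infinity. For
   s = 1/2 the Volterra equation is of first order. The Wasserstein bound uses the Lipschitz constant of
   M. The Kolmogorov bound takes piecewise linear h, and the increments of h are controlled by the
   concentration inequality P(Wstar in I) <= 2 |I|, another consequence of the s-TDSB identity. *)
Require Import Defs.
From HB Require Import structures.
From mathcomp Require Import all_boot all_order all_algebra.
From mathcomp Require Import all_classical all_reals all_analysis.
From mathcomp Require Import measurable_realfun ess_sup_inf.
From mathcomp Require Import ring lra.
Set Implicit Arguments.
Unset Strict Implicit.
Unset Printing Implicit Defensive.
Import Order.TTheory GRing.Theory Num.Theory.
Import numFieldNormedType.Exports.
Local Open Scope classical_set_scope.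
Local Open Scope ring_scope.

(** * Calculus on the line *)

(** For [s >= 1] the factor [V] solves the homogeneous Stein equation [s f'' - x f' - n f = 0], so
    the explicit solution comes from reduction of order. Integrating from 0 makes [f] and [f']
    vanish there, and this is exactly what turns [s f''] into a solution of the Volterra equation.
    Centring the test function supplies the decay at infinity from which all bounds start: a
    majorant plus or minus the quantity to be bounded is monotone and tends to something
    nonnegative. The test function is merely continuous or Lipschitz and is never differentiated;
    the Lipschitz estimate freezes its value at the base point instead. Two definitions resist
    direct use. [kummerU] is a choice among solutions, so a positive solution must be exhibited and
    shown unique before [kappa] can be handled. The class in [dW] is described by an almost
    everywhere derivative, and has to be converted into a pointwise Lipschitz bound with constant 1.
    The estimates give [24 s - 9] and [8 s + 6], [12] for [s >= 1], then [2] and [8], [2] for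
    [s = 1/2]; these are finally compared with the stated constants. *)

Section derivative_rules.
Context {R : realType}.
Implicit Types (f g : R -> R) (x a b c : R).

(* Unlike [is_derive], not a type class: the rules below leave the derivative as an
   existential variable, which instance resolution must not try to guess. *)
Definition has_deriv f x a : Prop := is_derive x (1 : R) f a.

Definition cont_at f x : Prop := {for x, continuous f}.

Lemma has_deriv_cst c x : has_deriv (fun=> c) x 0.
Proof. exact: is_derive_cst. Qed.

Lemma has_deriv_id x : has_deriv (fun y => y) x 1.
Proof. exact: is_derive_id. Qed.

Lemma has_derivD f g x a b : has_deriv f x a -> has_deriv g x b ->
  has_deriv (fun y => f y + g y) x (a + b).
Proof. exact: is_deriveD. Qed.

Lemma has_derivN f x a : has_deriv f x a -> has_deriv (fun y => - f y) x (- a).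
Proof. exact: is_deriveN. Qed.

Lemma has_derivM f g x a b : has_deriv f x a -> has_deriv g x b ->
  has_deriv (fun y => f y * g y) x (a * g x + f x * b).
Proof.
move=> fa gb; rewrite addrC [a * _]mulrC; exact: (is_deriveM fa gb).
Qed.

Lemma has_derivX f n x a : has_deriv f x a ->
  has_deriv (fun y => f y ^+ n) x (n%:R * f x ^+ n.-1 * a).
Proof.
move=> fa; rewrite (_ : (fun y => f y ^+ n) = f ^+ n); first exact: (is_deriveX n fa).
by apply/funext => y; elim: n => [//|n IH]; rewrite !exprS IH.
Qed.

Lemma has_derivV f x a : f x != 0 -> has_deriv f x a ->
  has_deriv (fun y => (f y)^-1) x (- (a / f x ^+ 2)).
Proof. by move=> f0 fa; rewrite mulrC -mulNr; exact: (is_deriveV f0 fa). Qed.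

Lemma has_deriv_expR f x a : has_deriv f x a ->
  has_deriv (fun y => expR (f y)) x (expR (f x) * a).
Proof. by move=> fa; apply: (is_derive1_comp (f := expR)). Qed.

Lemma has_deriv_eq f x a b : has_deriv f x a -> a = b -> has_deriv f x b.
Proof. by move=> ? <-. Qed.

Lemma has_deriv_near_eq f g x a : (\near x, f x = g x) -> has_deriv f x a -> has_deriv g x a.
Proof. by move=> fg; exact: near_eq_is_derive. Qed.

Lemma has_derivP f x a : derivable f x 1 -> derive1 f x = a -> has_deriv f x a.
Proof. by move=> df <-; split => //; rewrite -derive1E. Qed.

Lemma has_deriv_derivable f x a : has_deriv f x a -> derivable f x 1.
Proof. by case. Qed.

Lemma has_deriv_derive1 f x a : has_deriv f x a -> derive1 f x = a.
Proof. by case=> _; rewrite -derive1E. Qed.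

Lemma has_deriv_cont f x a : has_deriv f x a -> cont_at f x.
Proof. by case=> df _; apply: differentiable_continuous; exact/derivable1_diffP. Qed.

Lemma cont_at_cst c x : cont_at (fun=> c) x.
Proof. exact: cvg_cst. Qed.

Lemma cont_at_id x : cont_at (fun y => y) x.
Proof. exact: cvg_id. Qed.

Lemma cont_atD f g x : cont_at f x -> cont_at g x -> cont_at (fun y => f y + g y) x.
Proof. exact: cvgD. Qed.

Lemma cont_atN f x : cont_at f x -> cont_at (fun y => - f y) x.
Proof. exact: cvgN. Qed.

Lemma cont_atM f g x : cont_at f x -> cont_at g x -> cont_at (fun y => f y * g y) x.
Proof. exact: cvgM. Qed.

Lemma cont_atX f n x : cont_at f x -> cont_at (fun y => f y ^+ n) x.
Proof. by move=> cf; exact: (cvg_comp _ _ cf (@exprn_continuous R n (f x))). Qed.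

Lemma cont_atV f x : f x != 0 -> cont_at f x -> cont_at (fun y => (f y)^-1) x.
Proof. by move=> f0 cf; exact: cvgV. Qed.

Lemma cont_at_expR f x : cont_at f x -> cont_at (fun y => expR (f y)) x.
Proof. by move=> cf; exact: (cvg_comp _ _ cf (@continuous_expR R (f x))). Qed.

Lemma cont_at_norm f x : cont_at f x -> cont_at (fun y => `|f y|) x.
Proof. exact: cvg_norm. Qed.

End derivative_rules.

(** Differentiation follows the syntax of the function and synthesises the derivative;
    [has_deriv_eq] then leaves one algebraic identity. Derivatives of opaque functions are found in
    the context, which is why proofs introduce them by [have] first. *)
Ltac deriv_step :=
  lazymatch goal with
  | |- @has_deriv ?R (fun _ => ?c) _ _ => refine (@has_deriv_cst R c _)
  | |- @has_deriv ?R (fun y => y) _ _ => refine (@has_deriv_id R _)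
  | |- @has_deriv ?R (fun y => GRing.add (@?f y) (@?g y)) _ _ => refine (@has_derivD R f g _ _ _ _ _)
  | |- @has_deriv ?R (fun y => GRing.opp (@?f y)) _ _ => refine (@has_derivN R f _ _ _)
  | |- @has_deriv ?R (fun y => GRing.mul (@?f y) (@?g y)) _ _ => refine (@has_derivM R f g _ _ _ _ _)
  | |- @has_deriv ?R (fun y => GRing.exp (@?f y) ?n) _ _ => refine (@has_derivX R f n _ _ _)
  | |- @has_deriv ?R (fun y => GRing.inv (@?f y)) _ _ => refine (@has_derivV R f _ _ _ _)
  | |- @has_deriv ?R (fun y => expR (@?f y)) _ _ => refine (@has_deriv_expR R f _ _ _)
  | |- has_deriv _ _ _ => solve [eauto with nocore]
  end.
Ltac deriv := eapply has_deriv_eq; [repeat deriv_step|].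
Ltac cont_step :=
  lazymatch goal with
  | |- @cont_at ?R (fun _ => ?c) _ => refine (@cont_at_cst R c _)
  | |- @cont_at ?R (fun y => y) _ => refine (@cont_at_id R _)
  | |- @cont_at ?R (fun y => GRing.add (@?f y) (@?g y)) _ => simple apply (@cont_atD R f g)
  | |- @cont_at ?R (fun y => GRing.opp (@?f y)) _ => simple apply (@cont_atN R f)
  | |- @cont_at ?R (fun y => GRing.mul (@?f y) (@?g y)) _ => simple apply (@cont_atM R f g)
  | |- @cont_at ?R (fun y => GRing.exp (@?f y) ?n) _ => simple apply (@cont_atX R f n)
  | |- @cont_at ?R (fun y => GRing.inv (@?f y)) _ => simple apply (@cont_atV R f)
  | |- @cont_at ?R (fun y => expR (@?f y)) _ => simple apply (@cont_at_expR R f)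
  | |- @cont_at ?R (fun y => Num.norm (@?f y)) _ => simple apply (@cont_at_norm R f)
  | |- cont_at _ _ => solve [eauto with nocore]
  end.
Ltac cont := repeat cont_step.

Section calculus.
Context {R : realType}.
Implicit Types (f g df : R -> R) (a b x : R).

(** Differentiability is asked only to the right of [a]: primitives started at 0 and the density
    factor are differentiated on the positive half-line and are merely continuous at 0. *)
Lemma MVT_right f df a b : a < b -> cont_at f a ->
  (forall x, a < x -> has_deriv f x (df x)) ->
  exists2 c, a < c < b & f b - f a = df c * (b - a).
Proof.
move=> ab cfa dfx; have [| |c + ->] := @MVT R f df a b ab.
- by move=> x; rewrite in_itv/= => /andP[ax _]; exact: dfx.
- apply/continuous_within_itvP => //; split.
  + by move=> x; rewrite in_itv/= => /andP[ax _]; exact: has_deriv_cont (dfx _ ax).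
  + exact: cvg_at_right_filter.
  + by apply: cvg_at_left_filter; exact: has_deriv_cont (dfx _ ab).
- by rewrite in_itv/= => cab; exists c.
Qed.

Lemma nondecreasing_derive_ge0 f df a b : a <= b -> cont_at f a ->
  (forall x, a < x -> has_deriv f x (df x)) ->
  (forall x, a < x -> 0 <= df x) -> f a <= f b.
Proof.
rewrite le_eqVlt => /predU1P[->//|ab] cf dfx df0.
have [c /andP[ac _] E] := MVT_right ab cf dfx.
by rewrite -subr_ge0 E mulr_ge0 ?df0// subr_ge0 ltW.
Qed.

Lemma nonincreasing_derive_le0 f df a b : a <= b -> cont_at f a ->
  (forall x, a < x -> has_deriv f x (df x)) ->
  (forall x, a < x -> df x <= 0) -> f b <= f a.
Proof.
rewrite le_eqVlt => /predU1P[->//|ab] cf dfx df0.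
have [c /andP[ac _] E] := MVT_right ab cf dfx.
by rewrite -subr_le0 E mulr_le0_ge0 ?df0// subr_ge0 ltW.
Qed.

(** The comparison principle behind every tail bound: a decreasing function that stays above
    something vanishing at infinity cannot start negative. The minorant [r] spares the computation
    of the limit of [f]. *)
Lemma ge0_decreasing_limit f df r a : cont_at f a ->
  (forall x, a < x -> has_deriv f x (df x)) ->
  (forall x, a < x -> df x <= 0) ->
  (forall x, a < x -> r x <= f x) -> r x @[x --> +oo] --> (0 : R) -> 0 <= f a.
Proof.
move=> cf dfx df0 rf r0; apply: (cvgr_to_le r0); near=> x.
have ax : a < x by near: x; apply: nbhs_pinfty_gt; rewrite num_real.
by apply: (le_trans (rf _ ax)); exact: nonincreasing_derive_le0 dfx df0; exact: ltW.
Unshelve. all: by end_near. Qed.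

Lemma lipschitz_derive_le f df C a b : 0 <= a -> 0 <= b -> cont_at f 0 ->
  (forall x, 0 < x -> has_deriv f x (df x)) ->
  (forall x, 0 < x -> `|df x| <= C) -> `|f b - f a| <= C * `|b - a|.
Proof.
move=> a0 b0 cf0 dfx dfC.
have cf x : 0 <= x -> cont_at f x.
  by rewrite le_eqVlt => /predU1P[<-//|x0]; exact: has_deriv_cont (dfx _ x0).
wlog ab : a b a0 b0 / a < b.
  move=> H; have [|ab|->] := ltgtP a b; first exact: H.
    by rewrite distrC (distrC b); exact: H.
  by rewrite !subrr normr0 mulr0.
have dfa x : a < x -> has_deriv f x (df x).
  by move=> ax; apply: dfx; exact: le_lt_trans ax.
have [c /andP[ac cb] ->] := MVT_right ab (cf _ a0) dfa.
by rewrite normrM ler_wpM2r// dfC// (le_lt_trans a0).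
Qed.

End calculus.

Section primitive.
Context {R : realType}.
Implicit Types (f g : R -> R) (a b x : R).
Notation mu := (@lebesgue_measure R).

(** For negative [x] the interval is empty and the value is 0, so primitives of continuous functions
    are continuous on the whole line, and so is what is built from them. *)
Definition primitive f x : R := \int[mu]_(t in `[0, x]) f t.

Lemma continuous_integrable_itv f a b : continuous f -> mu.-integrable `[a, b] (EFin \o f).
Proof.
move=> cf; apply: continuous_compact_integrable; first exact: segment_compact.
exact: continuous_subspaceT.
Qed.

Lemma primitive_le0 f x : x <= 0 -> primitive f x = 0.
Proof.
rewrite le_eqVlt => /predU1P[->|x0]; first by rewrite /primitive set_itv1 Rintegral_set1.
by rewrite /primitive set_itv_ge ?Rintegral_set0// bnd_simp -ltNge.
Qed.

Lemma has_deriv_primitive f x : continuous f -> 0 < x -> has_deriv (primitive f) x (f x).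
Proof.
move=> cf x0; have xu : x < x + 1 by rewrite ltrDl.
have [dF F'] := continuous_FTC1_closed xu (continuous_integrable_itv _ _ cf) x0 (cf x).
exact: has_derivP.
Qed.

Lemma continuous_primitive f : continuous f -> continuous (primitive f).
Proof.
move=> cf x; have [x0|x0|<-] := ltgtP 0 x.
- exact: has_deriv_cont (has_deriv_primitive cf x0).
- apply: (has_deriv_cont (a := 0)); apply: (has_deriv_near_eq (f := fun=> 0)).
    near=> y; rewrite primitive_le0// ltW//.
    by near: y; exact: lt_nbhsl.
  exact: has_deriv_cst.
- rewrite /continuous_at primitive_le0//.
  apply: (@parameterized_integral_cvg_left R 0 1); first exact: ltr01.
  exact: continuous_integrable_itv.
Unshelve. all: by end_near. Qed.

Lemma FTC_integral f g a b : a <= b -> (forall x, a <= x -> cont_at f x) -> cont_at g a ->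
  (forall x, a < x -> has_deriv g x (f x)) ->
  \int[mu]_(t in `[a, b]) f t = g b - g a.
Proof.
rewrite le_eqVlt => /predU1P[->|ab] cf cg dg.
  by rewrite set_itv1 Rintegral_set1 subrr.
rewrite /Rintegral (@continuous_FTC2 R f g a b ab)//.
- apply: continuous_in_subspaceT => x; rewrite inE/= in_itv/= => /andP[ax _].
  exact: cf.
- split.
  + by move=> x; rewrite in_itv/= => /andP[ax _]; exact: has_deriv_derivable (dg _ ax).
  + exact: cvg_at_right_filter.
  + by apply: cvg_at_left_filter; exact: has_deriv_cont (dg _ ab).
- by move=> x; rewrite in_itv/= => /andP[ax _]; exact: has_deriv_derive1 (dg _ ax).
Qed.

End primitive.

Section gauss_weight.
Context {R : realType}.
Variable s : R.
Hypothesis s0 : 0 < s.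

Definition gauss_weight x : R := expR (- x ^+ 2 / (2 * s)).

Local Notation phi := gauss_weight.

Lemma gauss_weight_gt0 x : 0 < phi x. Proof. exact: expR_gt0. Qed.

Lemma has_deriv_gauss_weight x : has_deriv phi x (- (x / s) * phi x).
Proof.
rewrite /gauss_weight; deriv; by rewrite /=; field; rewrite gt_eqF.
Qed.

Lemma continuous_gauss_weight : continuous phi.
Proof. by move=> x; exact: has_deriv_cont (has_deriv_gauss_weight x). Qed.

Lemma gauss_weight_le_inv x : 0 < x -> phi x <= 2 * s / x ^+ 2.
Proof.
move=> x0; rewrite /gauss_weight mulNr expRN -lef_pV2 ?posrE ?invr_gt0 ?expR_gt0//; last first.
  by rewrite divr_gt0 ?exprn_gt0 ?mulr_gt0.
rewrite invrK invf_div; apply: le_trans (expR_ge1Dx _).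
by rewrite ler_wpDl.
Qed.

End gauss_weight.

Section limits.
Context {R : realType}.
Notation mu := (@lebesgue_measure R).

Lemma cvg0_le_inv (f : R -> R) C :
  (forall x, 1 <= x -> `|f x| <= C / x) -> f x @[x --> +oo] --> (0 : R).
Proof.
move=> fC; apply/cvgrPdist_le => /= e e0; near=> x.
have x1 : 1 <= x by near: x; apply: nbhs_pinfty_ge; rewrite num_real.
have x0 : 0 < x by exact: lt_le_trans x1.
rewrite sub0r normrN; apply: (le_trans (fC _ x1)).
rewrite ler_pdivrMr//; have : C / e <= x.
  by near: x; apply: nbhs_pinfty_ge; rewrite num_real.
by rewrite ler_pdivrMr// mulrC.
Unshelve. all: by end_near. Qed.

Lemma cvg_gauss_weight_lin (s a b : R) : 0 < s ->
  gauss_weight s x * (a * x + b) @[x --> +oo] --> (0 : R).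
Proof.
move=> s0; apply: (@cvg0_le_inv _ (2 * s * (`|a| + `|b|))) => x x1.
have x0 : 0 < x by exact: lt_le_trans x1.
rewrite normrM ger0_norm; last exact/ltW/gauss_weight_gt0.
have -> : 2 * s * (`|a| + `|b|) / x = (2 * s / x ^+ 2) * ((`|a| + `|b|) * x).
  by field; rewrite gt_eqF.
apply: ler_pM => //; first exact/ltW/gauss_weight_gt0.
  exact: gauss_weight_le_inv.
rewrite (le_trans (ler_normD _ _))// normrM (gtr0_norm x0) mulrDl lerD2l.
by rewrite ler_peMr.
Qed.

(** Dominated convergence for the truncations of [f] to [[0, u n]], along an arbitrary sequence [u]
    tending to infinity. *)
Lemma cvg_primitive (f : R -> R) : mu.-integrable `[0, +oo[ (EFin \o f) ->
  primitive f x @[x --> +oo] --> \int[mu]_(x in `[0, +oo[) f x.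
Proof.
move=> intf; apply/cvg_pinftyP => u uy.
have /measurable_EFinP mf := measurable_int _ intf.
pose g n x := (f \_ `[0, u n]) x.
have -> : (fun n => primitive f (u n)) = (fun n => \int[mu]_(x in `[0, +oo[) g n x).
  apply/funext => n; rewrite /primitive /g -Rintegral_mkcondr setIC.
  congr (Rintegral _ _ _); apply/seteqP; split => x /=; rewrite !in_itv/= ?andbT.
    by move=> /andP[-> ->].
  by move=> [/andP[-> ->]].
apply: fine_cvg; rewrite /Rintegral fineK ?integrable_fin_num//.
apply: (@dominated_cvg _ _ _ mu _ _ (fun n x => (g n x)%:E) _ (fun x => `|f x|%:E)) => //=.
- move=> n; apply/measurable_EFinP; apply/measurable_restrict => //.
  by apply: (measurable_funS _ _ mf) => //; exact: subIsetl.
- move=> x; rewrite in_itv/= andbT => x0.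
  apply: cvg_near_cst; near=> n; rewrite /g patchE mem_set//= in_itv/= x0/=.
  by near: n; move/cvgryPge : uy; apply.
- by move/integrable_abse : intf.
- move=> n x _; rewrite lee_fin /g patchE; case: ifP => // _.
  by rewrite normr0.
Unshelve. all: by end_near. Qed.
End limits.

(** * Improper integrals over the open half-line *)

Section improper_FTC.
Context {R : realType}.
Notation mu := (@lebesgue_measure R).
Implicit Types f F : R -> R.

Lemma cvg_comp_harmonic F (l : R) : F x @[x --> 0^'+] --> l ->
  F (n.+1%:R^-1) @[n --> \oo] --> l.
Proof.
move/cvg_at_rightP; apply; split; first by move=> n; rewrite invr_gt0 ltr0n.
exact: cvg_harmonic.
Qed.

Lemma cvg_comp_natS F (l : R) : F x @[x --> +oo] --> l ->
  F (n.+1%:R) @[n --> \oo] --> l.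
Proof.
move/cvg_pinftyP; apply; apply/cvgryPge => A; near=> n.
apply: (@le_trans _ _ n%:R); last by rewrite ler_nat.
by near: n; exact: nbhs_infty_ger.
Unshelve. all: by end_near. Qed.

(** Exhaustion by [[1 / (n + 1), +oo[] and monotone convergence; the integrand may be singular at 0,
    as [t ^ (a - 1)] is for [a < 1]. *)
Lemma ge0_FTC_open f F (L l : R) :
  (forall x, 0 < x -> 0 <= f x) -> (forall x, 0 < x -> cont_at f x) ->
  (forall x, 0 < x -> has_deriv F x (f x)) ->
  F x @[x --> +oo] --> L -> F x @[x --> 0^'+] --> l ->
  (\int[mu]_(x in `]0%R, +oo[) (f x)%:E = (L - l)%:E)%E.
Proof.
move=> f0 cf dF FL Fl.
pose E n := `[(n.+1%:R^-1 : R), +oo[%classic.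
have E0 n x : E n x -> 0 < x.
  by rewrite /E/= in_itv/= andbT; apply: lt_le_trans; rewrite invr_gt0 ltr0n.
have -> : `]0, +oo[%classic = \bigcup_n E n.
  by rewrite itvoyEbigcup; apply: eq_bigcupr => n _; rewrite add0r.
have mf : measurable_fun (`]0, +oo[%classic : set R) f.
  by apply: open_continuous_measurable_fun => // x; rewrite inE/= in_itv/= andbT => /cf.
have H : (\int[mu]_(x in E i) (f x)%:E)%E @[i --> \oo] -->
    (\int[mu]_(x in \bigcup_i E i) (f x)%:E)%E.
  apply: ge0_nondecreasing_set_cvg_integral.
  - move=> m n mn; rewrite subsetEset => x; rewrite /E/= !in_itv/= !andbT.
    by apply: le_trans; rewrite lef_pV2 ?posrE ?ltr0n// ler_nat.
  - by move=> n; exact: measurable_itv.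
  - move=> n; apply/measurable_EFinP; apply: (measurable_funS _ _ mf) => //.
    by move=> x /E0; rewrite /= in_itv/= andbT.
  - by move=> n x /E0 x0; rewrite lee_fin f0.
have EE n : (\int[mu]_(x in E n) (f x)%:E = (L - F (n.+1%:R^-1))%:E)%E.
  rewrite (@ge0_continuous_FTC2y R f F _ L)//.
  - by move=> x xn; apply: f0; apply: lt_le_trans xn; rewrite invr_gt0 ltr0n.
  - apply: continuous_in_subspaceT => x; rewrite inE => /E0; exact: cf.
  - by move=> x xn; apply: (has_deriv_derivable (dF _ _)); apply: lt_trans xn; rewrite invr_gt0 ltr0n.
  - apply: cvg_at_right_filter; apply: (has_deriv_cont (dF _ _)).
    by rewrite invr_gt0 ltr0n.
  - move=> x; rewrite in_itv/= andbT => xn.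
    by apply: (has_deriv_derive1 (dF _ _)); apply: lt_trans xn; rewrite invr_gt0 ltr0n.
rewrite (funext EE) in H; apply: (cvg_unique _ H) => //.
apply: cvg_EFin; first exact: nearW.
by apply: cvgB; [exact: cvg_cst|exact: cvg_comp_harmonic].
Qed.

(** The signed counterpart: both ends are truncated, and integrability supplies the dominating
    function. *)
Lemma FTC_open f F (L l : R) : mu.-integrable `]0, +oo[ (EFin \o f) ->
  (forall x, 0 < x -> cont_at f x) ->
  (forall x, 0 < x -> has_deriv F x (f x)) ->
  F x @[x --> +oo] --> L -> F x @[x --> 0^'+] --> l ->
  \int[mu]_(x in `]0, +oo[) f x = L - l.
Proof.
move=> intf cf dF FL Fl.
have /measurable_EFinP mf := measurable_int _ intf.
pose E n := `[(n.+1%:R^-1 : R), n.+1%:R]%classic.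
have E0 n x : E n x -> 0 < x.
  by rewrite /E/= in_itv/= => /andP[+ _]; apply: lt_le_trans; rewrite invr_gt0 ltr0n.
pose g n x := (f \_ (E n)) x.
have H : \int[mu]_(x in `]0, +oo[) g n x @[n --> \oo] --> \int[mu]_(x in `]0, +oo[) f x.
  apply: fine_cvg; rewrite /Rintegral fineK ?integrable_fin_num//.
  apply: (@dominated_cvg _ _ _ mu _ _ (fun n x => (g n x)%:E) _ (fun x => `|f x|%:E)) => //=.
  - move=> n; apply/measurable_EFinP; apply/measurable_restrict => //.
      exact: measurable_itv.
    by apply: (measurable_funS _ _ mf) => //; exact: subIsetl.
  - move=> x; rewrite in_itv/= andbT => x0.
    apply: cvg_near_cst; near=> n; suff Enx : E n x by rewrite /g patchE mem_set.
    rewrite /E/= in_itv/=; apply/andP; split.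
      rewrite -[leRHS]invrK lef_pV2 ?posrE ?ltr0n ?invr_gt0// (@le_trans _ _ n%:R) ?ler_nat//.
      by near: n; exact: nbhs_infty_ger.
    rewrite (@le_trans _ _ n%:R) ?ler_nat//.
    by near: n; exact: nbhs_infty_ger.
  - by move/integrable_abse : intf.
  - by move=> n x _; rewrite lee_fin /g patchE; case: ifP => // _; rewrite normr0.
have EE n : \int[mu]_(x in `]0, +oo[) g n x = F (n.+1%:R) - F (n.+1%:R^-1).
  rewrite /g -Rintegral_mkcondr (_ : _ `&` _ = E n); last first.
    by apply/seteqP; split => [x []//|x Ex]; split => //=; rewrite in_itv/= andbT; exact: E0 Ex.
  have n0 : 0 < n.+1%:R^-1 :> R by rewrite invr_gt0 ltr0n.
  apply: FTC_integral.
  - by rewrite (@le_trans _ _ 1) ?invf_le1 ?ltr0n ?ler1n.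
  - by move=> x nx; apply: cf; exact: lt_le_trans nx.
  - exact: has_deriv_cont (dF _ _).
  - by move=> x nx; apply: dF; exact: lt_trans nx.
rewrite (funext EE) in H; apply: (cvg_unique _ H) => //.
by apply: cvgB; [exact: cvg_comp_natS|exact: cvg_comp_harmonic].
Unshelve. all: by end_near. Qed.

Lemma integrable_open_le f g : (forall x, 0 < x -> cont_at f x) ->
  mu.-integrable `]0, +oo[ (EFin \o g) -> (forall x, 0 < x -> `|f x| <= g x) ->
  mu.-integrable `]0, +oo[ (EFin \o f).
Proof.
move=> cf intg fg; apply: (le_integrable _ _ _ intg) => //.
  apply/measurable_EFinP.
  by apply: open_continuous_measurable_fun => // x; rewrite inE/= in_itv/= andbT => /cf.
move=> x; rewrite /= in_itv/= andbT => x0; rewrite lee_fin.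
by rewrite (le_trans (fg _ x0))// ler_norm.
Qed.

Lemma ge0_FTC_open_integrable f F (L l : R) :
  (forall x, 0 < x -> 0 <= f x) -> (forall x, 0 < x -> cont_at f x) ->
  (forall x, 0 < x -> has_deriv F x (f x)) ->
  F x @[x --> +oo] --> L -> F x @[x --> 0^'+] --> l ->
  mu.-integrable `]0, +oo[ (EFin \o f).
Proof.
move=> f0 cf dF FL Fl; apply/integrableP; split.
  apply/measurable_EFinP.
  by apply: open_continuous_measurable_fun => // x; rewrite inE/= in_itv/= andbT => /cf.
under eq_integral => x.
  rewrite inE/= in_itv/= andbT => x0; rewrite ger0_norm ?f0//; over.
by rewrite (ge0_FTC_open f0 cf dF FL Fl) ltry.
Qed.

End improper_FTC.

Section open_half_line.
Context {R : realType}.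
Notation mu := (@lebesgue_measure R).
Implicit Types f F : R -> R.

Lemma has_deriv_powR f (x p a : R) : 0 < f x -> has_deriv f x a ->
  has_deriv (fun y => f y `^ p) x (p * f x `^ (p - 1) * a).
Proof.
move=> fx0 fa; apply: (is_derive1_comp (f := fun y => y `^ p)) => //.
exact: is_derive1_powR.
Qed.

Lemma cont_at_powR f (x p : R) : 0 < f x -> cont_at f x -> cont_at (fun y => f y `^ p) x.
Proof.
move=> fx0 cf; have dp := @has_deriv_powR id (f x) p 1 fx0 (has_deriv_id (f x)).
exact: (cvg_comp _ _ cf (has_deriv_cont dp)).
Qed.

(** Being nondecreasing and bounded, [F] has limits at both ends, whatever their values. *)
Lemma ge0_open_integrable_bounded f F (M : R) :
  (forall x, 0 < x -> 0 <= f x) -> (forall x, 0 < x -> cont_at f x) ->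
  (forall x, 0 < x -> has_deriv F x (f x)) -> (forall x, 0 < x -> `|F x| <= M) ->
  mu.-integrable `]0, +oo[ (EFin \o f).
Proof.
move=> f0 cf dF FM.
have nd x y : 0 < x -> x <= y -> F x <= F y.
  move=> x0 xy; apply: (@nondecreasing_derive_ge0 R F f) => //.
  - exact: has_deriv_cont (dF _ _).
  - by move=> z xz; apply: dF; exact: lt_trans xz.
  - by move=> z xz; apply: f0; exact: lt_trans xz.
have [L FL] : exists L : R, F x @[x --> +oo] --> L.
  (* The maximum with 1 turns [F] into a function monotone on the whole line, to which monotone
     convergence of functions applies. *)
  exists (sup (range (fun x => F (Num.max x 1)))).
  have : (fun x => F (Num.max x 1)) x @[x --> +oo] --> sup (range (fun x => F (Num.max x 1))).
    apply: nondecreasing_cvgr.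
      move=> x y xy; apply: nd; first by rewrite lt_max ltr01 orbT.
      by rewrite ge_max !le_max xy lexx !orbT.
    exists M => _ [x _ <-]; apply: le_trans (ler_norm _) (FM _ _).
    by rewrite lt_max ltr01 orbT.
  apply: cvg_trans; apply: near_eq_cvg; near=> x.
  by rewrite max_l//; near: x; apply: nbhs_pinfty_ge; rewrite num_real.
have [l Fl] : exists l : R, F x @[x --> 0^'+] --> l.
  exists (inf (F @` `]0, +oo[)).
  apply: (@nondecreasing_at_right_cvgr _ F 0 +oo%O) => //.
    by move=> x y; rewrite !in_itv/= !andbT => x0 _; exact: nd.
  exists (- M) => _ [x/= + <-]; rewrite in_itv/= andbT => x0.
  by have := FM _ x0; rewrite ler_norml => /andP[].
exact: ge0_FTC_open_integrable FL Fl.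
Unshelve. all: by end_near. Qed.

(** The integral is at least the minimum of [f] over [[1, 2]], an interval of length 1. *)
Lemma Rintegral_open_gt0 f : mu.-integrable `]0, +oo[ (EFin \o f) ->
  (forall x, 0 < x -> 0 < f x) -> (forall x, 0 < x -> cont_at f x) ->
  0 < \int[mu]_(x in `]0, +oo[) f x.
Proof.
move=> intf f0 cf.
have [||c c12 fc] := @EVT_min R f 1 2; first by rewrite ler1n.
  apply: continuous_in_subspaceT => x; rewrite inE/= in_itv/= => /andP[x1 _].
  by apply: cf; exact: lt_le_trans x1.
have c0 : 0 < c by move: c12; rewrite in_itv/= => /andP[+ _]; exact: lt_le_trans.
apply: (@lt_le_trans _ _ (f c)); first exact: f0.
have S12 : `[1, 2]%classic `<=` (`]0, +oo[%classic : set R).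
  by move=> x /=; rewrite !in_itv/= andbT => /andP[+ _]; exact: lt_le_trans.
have i12 : mu.-integrable `[1, 2] (EFin \o f) by exact: integrableS intf.
have -> : f c = \int[mu]_(x in `[1, 2]) (f c).
  rewrite Rintegral_cst//= lebesgue_measure_itv/= lte_fin ltr1n/=.
  by rewrite (_ : 2 - 1 = 1) ?mulr1//; lra.
apply: (@le_trans _ _ (\int[mu]_(x in `[1, 2]) f x)).
  apply: le_Rintegral => //.
  by apply: continuous_integrable_itv => x; exact: cvg_cst.
rewrite -lee_fin /Rintegral !fineK ?integrable_fin_num//.
apply: ge0_subset_integral => //.
  exact: measurable_int intf.
by move=> x; rewrite /= in_itv/= andbT => x0; rewrite lee_fin ltW// f0.
Qed.

Lemma gt0_powRD (x p q : R) : 0 < x -> x `^ (p + q) = x `^ p * x `^ q.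
Proof. by move=> x0; rewrite powRD// (gt_eqF x0) implybT. Qed.

Lemma powRS (x p : R) : 0 < x -> x `^ p = x * x `^ (p - 1).
Proof.
by move=> x0; rewrite -[X in X * _]powRr1 ?(ltW x0)// -gt0_powRD// addrC subrK.
Qed.

Lemma cvg_pinfty_eq f g (l : R) : (forall x, 0 < x -> f x = g x) ->
  f x @[x --> +oo] --> l -> g x @[x --> +oo] --> l.
Proof.
move=> fg; apply: cvg_trans; apply: near_eq_cvg; near=> x.
by rewrite fg//; near: x; apply: nbhs_pinfty_gt; rewrite num_real.
Unshelve. all: by end_near. Qed.

Lemma const_has_deriv0 f (x y : R) : 0 < x -> 0 < y ->
  (forall z, 0 < z -> has_deriv f z 0) -> f x = f y.
Proof.
move=> + + df; wlog xy : x y / x <= y.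
  by move=> H x0 y0; have [/H|/ltW/H] := leP x y; [exact|move=> ->].
move=> x0 y0; apply/eqP; rewrite eq_le; apply/andP; split.
  apply: (@nondecreasing_derive_ge0 _ f (fun=> 0)) => //.
    exact: has_deriv_cont (df _ _).
  by move=> z xz; apply: df; exact: lt_trans xz.
apply: (@nonincreasing_derive_le0 _ f (fun=> 0)) => //.
  exact: has_deriv_cont (df _ _).
by move=> z xz; apply: df; exact: lt_trans xz.
Qed.

End open_half_line.

(** The same tactic with real powers added; their rule leaves positivity of the base as a side
    goal. *)
Ltac deriv_step ::=
  lazymatch goal with
  | |- @has_deriv ?R (fun _ => ?c) _ _ => refine (@has_deriv_cst R c _)
  | |- @has_deriv ?R (fun y => y) _ _ => refine (@has_deriv_id R _)
  | |- @has_deriv ?R (fun y => GRing.add (@?f y) (@?g y)) _ _ => refine (@has_derivD R f g _ _ _ _ _)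
  | |- @has_deriv ?R (fun y => GRing.opp (@?f y)) _ _ => refine (@has_derivN R f _ _ _)
  | |- @has_deriv ?R (fun y => GRing.mul (@?f y) (@?g y)) _ _ => refine (@has_derivM R f g _ _ _ _ _)
  | |- @has_deriv ?R (fun y => GRing.exp (@?f y) ?n) _ _ => refine (@has_derivX R f n _ _ _)
  | |- @has_deriv ?R (fun y => GRing.inv (@?f y)) _ _ => refine (@has_derivV R f _ _ _ _)
  | |- @has_deriv ?R (fun y => expR (@?f y)) _ _ => refine (@has_deriv_expR R f _ _ _)
  | |- @has_deriv ?R (fun y => powR (@?f y) ?p) _ _ => refine (@has_deriv_powR R f _ p _ _ _)
  | |- has_deriv _ _ _ => solve [eauto with nocore]
  end.
Ltac cont_step ::=
  lazymatch goal with
  | |- @cont_at ?R (fun _ => ?c) _ => refine (@cont_at_cst R c _)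
  | |- @cont_at ?R (fun y => y) _ => refine (@cont_at_id R _)
  | |- @cont_at ?R (fun y => GRing.add (@?f y) (@?g y)) _ => simple apply (@cont_atD R f g)
  | |- @cont_at ?R (fun y => GRing.opp (@?f y)) _ => simple apply (@cont_atN R f)
  | |- @cont_at ?R (fun y => GRing.mul (@?f y) (@?g y)) _ => simple apply (@cont_atM R f g)
  | |- @cont_at ?R (fun y => GRing.exp (@?f y) ?n) _ => simple apply (@cont_atX R f n)
  | |- @cont_at ?R (fun y => GRing.inv (@?f y)) _ => simple apply (@cont_atV R f)
  | |- @cont_at ?R (fun y => expR (@?f y)) _ => simple apply (@cont_at_expR R f)
  | |- @cont_at ?R (fun y => Num.norm (@?f y)) _ => simple apply (@cont_at_norm R f)
  | |- @cont_at ?R (fun y => powR (@?f y) ?p) _ => simple apply (@cont_at_powR R f _ p)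
  | |- cont_at _ _ => solve [eauto with nocore]
  end.

(** * Kummer's function as a Laplace integral *)

Section laplace.
Context {R : realType}.
Notation mu := (@lebesgue_measure R).
Variable a : R.
Hypothesis a0 : 0 < a.

(** The weight in the classical representation of [Gamma(a) U(a, 1/2, z)] as the integral over
    [t > 0] of [t ^ (a - 1) (1 + t) ^ (- a - 1/2) exp (- z t)]. *)
Definition kummer_weight (t : R) := t `^ (a - 1) * (1 + t) `^ (- a - 2^-1).
Local Notation w := kummer_weight.

Lemma kummer_weight_gt0 t : 0 < t -> 0 < w t.
Proof. by move=> t0; rewrite mulr_gt0// powR_gt0// addr_gt0. Qed.

Lemma cont_kummer_weight t : 0 < t -> cont_at w t.
Proof. by move=> t0; rewrite /kummer_weight; cont => //; rewrite addr_gt0. Qed.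

(** The weight behaves like [t ^ (a - 1)] at 0 and like [t ^ (- 3/2)] at infinity. One bounded
    function has a derivative comparable with it at both ends: [t ^ a (1 + t) ^ (- a)] takes care of
    0, and [2 - (1 + t) ^ (- 1/2)] of infinity. *)
Let dB t : 0 < t -> has_deriv (fun t => t `^ a * (1 + t) `^ (- a) * (2 - (1 + t) `^ (- 2^-1))) t
  (t `^ (a - 1) * (1 + t) `^ (- a - 1) * (a * (2 - (1 + t) `^ (- 2^-1)) + t * (1 + t) `^ (- 2^-1) / 2)).
Proof.
move=> t0; have t1 : 0 < 1 + t by rewrite addr_gt0.
deriv => //=; rewrite (powRS a t0) (powRS (- a) t1) (powRS (- 2^-1) t1).
by field.
Qed.

Lemma integrable_kummer_weight : mu.-integrable `]0, +oo[ (EFin \o w).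
Proof.
(* The derivative above dominates [m] times the weight: with [q = (1 + t) ^ (- 1/2) <= 1], both
   [m q <= a (2 - q)] and [m t q <= t q / 2] hold. *)
pose m := Num.min a 2^-1.
have m0 : 0 < m by rewrite lt_min a0 invr_gt0 ltr0n.
have q1 (t : R) : 0 < t -> 0 < (1 + t) `^ (- 2^-1) <= 1.
  move=> t0; rewrite powR_gt0 ?addr_gt0//= powRN invf_le1 ?powR_gt0 ?addr_gt0//.
  by rewrite -{1}(powRr0 (1 + t)) ler_powR// ?invr_ge0 ?lerDl ?ltW.
have X0 (t : R) : 0 < t -> 0 <= t `^ (a - 1) * (1 + t) `^ (- a - 1).
  by move=> t0; rewrite mulr_ge0 ?powR_ge0.
pose D t := t `^ (a - 1) * (1 + t) `^ (- a - 1) * (a * (2 - (1 + t) `^ (- 2^-1)) + t * (1 + t) `^ (- 2^-1) / 2).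
have iD : mu.-integrable `]0, +oo[ (EFin \o D).
  apply: (ge0_open_integrable_bounded (M := 2) _ _ dB).
  - move=> t t0; have /andP[q0 ql] := q1 _ t0; rewrite mulr_ge0 ?X0//.
    apply: addr_ge0; first by apply: mulr_ge0; [exact: ltW|lra].
    by rewrite !mulr_ge0 ?invr_ge0// ?ltW.
  - by move=> t t0; have t1 : 0 < 1 + t by [rewrite addr_gt0]; rewrite /D; cont.
  - move=> t t0; have /andP[q0 ql] := q1 _ t0.
    have p0 : 0 <= t `^ a * (1 + t) `^ (- a) <= 1.
      rewrite mulr_ge0 ?powR_ge0//= powRN ler_pdivrMr ?powR_gt0 ?addr_gt0// mul1r.
      by rewrite ge0_ler_powR ?nnegrE ?ler_wpDl ?addr_ge0// ltW.
    have /andP[p1 p2] := p0.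
    rewrite ger0_norm; last by apply: mulr_ge0 => //; lra.
    by rewrite -[leRHS]mul1r; apply: ler_pM => //; lra.
apply: (integrable_open_le (g := fun t => m^-1 * D t)).
- exact: cont_kummer_weight.
- exact: (integrableZl _ (m^-1) iD).
move=> t t0; have /andP[q0 ql] := q1 _ t0; have t1 : 0 < 1 + t by rewrite addr_gt0.
rewrite gtr0_norm ?kummer_weight_gt0// mulrC ler_pdivlMr// /w /D.
have -> : (1 + t) `^ (- a - 2^-1) = (1 + t) `^ (- a - 1) * ((1 + t) * (1 + t) `^ (- 2^-1)).
  have -> : - 2^-1 = 2^-1 - 1 :> R by lra.
  by rewrite -powRS// -gt0_powRD//; congr (_ `^ _); lra.
rewrite mulrA -[leLHS]mulrA; apply: ler_wpM2l; first exact: X0.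
rewrite mulrC.
have ma : m <= a by rewrite ge_min lexx.
have mh : m <= 2^-1 by rewrite ge_min lexx orbT.
set q := _ `^ _ in q0 ql *.
have : m * q <= a * (2 - q) by apply: ler_pM => //; [exact: ltW|exact: ltW|lra].
have : m * (t * q) <= 2^-1 * (t * q) by rewrite ler_wpM2r// mulr_ge0// ltW.
lra.
Qed.

(** A class of amplitudes stable under multiplication by [t], which is what each derivative of the
    Laplace integral produces. *)
Definition poly_growth (psi : R -> R) :=
  (forall t, 0 < t -> cont_at psi t) /\
  exists C n, 0 <= C /\ forall t, 0 < t -> `|psi t| <= C * (1 + t) ^+ n.

Lemma poly_growthM psi : poly_growth psi -> poly_growth (fun t => t * psi t).
Proof.
move=> [cpsi [C [n [C0 npsi]]]]; split; first by move=> t t0; have ct := cpsi t t0; cont.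
exists C, n.+1; split => // t t0; rewrite normrM exprS mulrCA; apply: ler_pM => //; last exact: npsi.
by rewrite gtr0_norm// ler_wpDl.
Qed.

Lemma poly_growthD psi1 psi2 c1 c2 : poly_growth psi1 -> poly_growth psi2 ->
  poly_growth (fun t => c1 * psi1 t + c2 * psi2 t).
Proof.
move=> [cpsi1 [C1 [n1 [C10 npsi1]]]] [cpsi2 [C2 [n2 [C20 npsi2]]]]; split.
  by move=> t t0; have ct1 := cpsi1 t t0; have ct2 := cpsi2 t t0; cont.
exists (`|c1| * C1 + `|c2| * C2), (n1 + n2)%N; split; first by rewrite addr_ge0 ?mulr_ge0.
move=> t t0; have t1 : 1 <= 1 + t by rewrite lerDl ltW.
rewrite (le_trans (ler_normD _ _))// !normrM mulrDl; apply: lerD; rewrite -mulrA ler_wpM2l//.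
  apply: (le_trans (npsi1 _ t0)); rewrite ler_wpM2l// exprD ler_peMr ?exprn_ege1//.
  by rewrite exprn_ge0// (le_trans ler01).
apply: (le_trans (npsi2 _ t0)); rewrite ler_wpM2l// exprD ler_peMl ?exprn_ege1//.
by rewrite exprn_ge0// (le_trans ler01).
Qed.

Lemma poly_growth1 : poly_growth (fun=> 1).
Proof.
split; first by move=> t _; cont.
by exists 1, 0%N; split => // t _; rewrite expr0 normr1 mulr1.
Qed.

Lemma poly_growth_powR p : poly_growth (fun t => (1 + t) `^ p).
Proof.
split; first by move=> t t0; cont; rewrite addr_gt0.
exists 1, (Num.bound `|p|); split => // t t0.
rewrite mul1r ger0_norm ?powR_ge0// -powR_mulrn; last by rewrite addr_ge0// ltW.
apply: ler_powR; first by rewrite lerDl ltW.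
apply: (le_trans (ler_norm p)); apply: ltW.
by have := archi_boundP (normr_ge0 p); rewrite /Num.bound.
Qed.

Definition exp_bound n (z : R) := n.+1`!%:R * expR z / z ^+ n.+1.

(** From [expR y >= y ^ (n + 1) / (n + 1)!] at [y = (1 + t) z]; the bound does not depend on [t]. *)
Lemma exp_boundP n z t : 0 < z -> 0 < t -> (1 + t) ^+ n.+1 * expR (- z * t) <= exp_bound n z.
Proof.
move=> z0 t0; rewrite /exp_bound ler_pdivlMr ?exprn_gt0// mulrAC -exprMn.
rewrite mulNr expRN ler_pdivrMr ?expR_gt0// -mulrA -expRD.
have := @expR_ge1Dxn R ((1 + t) * z) n.
have -> : (1 + t) * z = z + z * t by ring.
move=> H; rewrite -ler_pdivrMl ?ltr0n ?fact_gt0// mulrC.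
apply: le_trans (H _); first by rewrite lerDr.
by rewrite addr_ge0 ?mulr_ge0// ltW.
Qed.

Definition laplace (psi : R -> R) (z : R) :=
  \int[mu]_(t in `]0, +oo[) (w t * psi t * expR (- z * t)).

Lemma laplace_dominated psi C n z (t : R) : 0 < z -> 0 < t -> 0 <= C ->
  `|psi t| <= C * (1 + t) ^+ n ->
  `|w t * psi t * expR (- z * t)| <= C * exp_bound n z * w t.
Proof.
move=> z0 t0 C0 npsi; rewrite 2!normrM (gtr0_norm (kummer_weight_gt0 t0)) (gtr0_norm (expR_gt0 _)).
rewrite -mulrA mulrC; apply: ler_wpM2r; first exact/ltW/kummer_weight_gt0.
apply: (@le_trans _ _ (C * ((1 + t) ^+ n.+1 * expR (- z * t)))).
  rewrite mulrA; apply: ler_wpM2r; first exact: expR_ge0.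
  apply: (le_trans npsi); apply: ler_wpM2l => //.
  rewrite exprS; apply: ler_peMl; last by rewrite lerDl ltW.
  by rewrite exprn_ge0// addr_ge0// ltW.
by apply: ler_wpM2l => //; exact: exp_boundP.
Qed.

Lemma cont_laplace_integrand psi z (t : R) : poly_growth psi -> 0 < t ->
  cont_at (fun t => w t * psi t * expR (- z * t)) t.
Proof.
move=> [cpsi _] t0; have ct := cpsi t t0; have cw := cont_kummer_weight t0.
by cont.
Qed.

Lemma integrable_laplace psi z : 0 < z -> poly_growth psi ->
  mu.-integrable `]0, +oo[ (EFin \o (fun t => w t * psi t * expR (- z * t))).
Proof.
move=> z0 gpsi; have [_ [C [n [C0 npsi]]]] := gpsi.
apply: (integrable_open_le (g := fun t => C * exp_bound n z * w t)).
- by move=> t t0; exact: cont_laplace_integrand.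
- exact: (integrableZl _ (C * exp_bound n z) integrable_kummer_weight).
- by move=> t t0; apply: laplace_dominated => //; exact: npsi.
Qed.

Lemma has_deriv_laplace psi z : 0 < z -> poly_growth psi ->
  has_deriv (laplace psi) z (- laplace (fun t => t * psi t) z).
Proof.
move=> z0 gpsi; have gM := poly_growthM gpsi; have [_ [C [n [C0 npsi]]]] := gM.
pose f (z t : R) := w t * psi t * expR (- z * t).
have df (x t : R) : has_deriv (f ^~ t) x (- (w t * (t * psi t) * expR (- x * t))).
  by rewrite /f; deriv; rewrite /=; ring.
(* On this neighbourhood of [z] every integrand is dominated by the one with parameter [z / 2]. *)
pose I := `](z / 2), (2 * z)[%classic.
have zI : I z by rewrite /I/= in_itv/=; apply/andP; split; lra.
have I0 (x : R) : I x -> 0 < x by rewrite /I/= in_itv/= => /andP[+ _]; lra.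
have intf (x : R) : I x -> mu.-integrable `]0, +oo[ (EFin \o f x).
  by move=> /I0 x0; exact: integrable_laplace.
pose G (t : R) := `|C * exp_bound n (z / 2) * w t|.
have intG : mu.-integrable `]0, +oo[ (EFin \o G).
  have iz : mu.-integrable `]0, +oo[ (EFin \o (fun t => C * exp_bound n (z / 2) * w t)).
    exact: (integrableZl _ (C * exp_bound n (z / 2)) integrable_kummer_weight).
  exact: (integrable_abse iz).
have G_ub (x t : R) : I x -> `]0, +oo[%classic t -> `|partial1of2 f x t| <= G t.
  move=> Ix; rewrite /= in_itv/= andbT => t0.
  rewrite /partial1of2 (has_deriv_derive1 (df x t)) normrN.
  apply: le_trans (ler_norm _).
  have z20 : 0 < z / 2 by rewrite divr_gt0.
  apply: le_trans (laplace_dominated (psi := fun t => t * psi t) z20 t0 C0 (npsi _ t0)).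
  rewrite [leLHS]normrM [leRHS]normrM; apply: ler_wpM2l => //.
  rewrite !gtr0_norm ?expR_gt0// ler_expR !mulNr lerN2; apply: ler_wpM2r; apply: ltW => //.
  by move: Ix; rewrite /I/= in_itv/= => /andP[].
have derf1 (x t : R) : I x -> `]0, +oo[%classic t -> derivable (f ^~ t) x 1.
  by move=> _ _; exact: has_deriv_derivable (df x t).
have G0 t : 0 <= G t by exact: normr_ge0.
have mI : measurable (`]0, +oo[%classic : set (measurableTypeR R)) by exact: measurable_itv.
apply: has_derivP.
  exact: (derivable_under_integral mI zI intf derf1 G0 intG G_ub).
rewrite (differentiation_under_integral mI zI intf derf1 G0 intG G_ub).
rewrite /laplace -[RHS]mulN1r -RintegralZl//; last exact: integrable_laplace.
by apply: eq_Rintegral => t _; rewrite /partial1of2 (has_deriv_derive1 (df z t)) mulN1r.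
Qed.

Lemma laplaceD psi1 psi2 z : 0 < z -> poly_growth psi1 -> poly_growth psi2 ->
  forall c1 c2, laplace (fun t => c1 * psi1 t + c2 * psi2 t) z = c1 * laplace psi1 z + c2 * laplace psi2 z.
Proof.
move=> z0 g1 g2 c1 c2; have i1 := integrable_laplace z0 g1; have i2 := integrable_laplace z0 g2.
rewrite /laplace -!RintegralZl// -RintegralD//; last 2 first.
- exact: (integrableZl _ c1 i1).
- exact: (integrableZl _ c2 i2).
by apply: eq_Rintegral => t _; ring.
Qed.

Lemma le_laplace psi1 psi2 z : 0 < z -> poly_growth psi1 -> poly_growth psi2 ->
  (forall t, 0 < t -> psi1 t <= psi2 t) -> laplace psi1 z <= laplace psi2 z.
Proof.
move=> z0 g1 g2 le12; apply: le_Rintegral => //; try exact: integrable_laplace.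
move=> t; rewrite /= in_itv/= andbT => t0.
by rewrite ler_wpM2r ?expR_ge0// ler_wpM2l ?le12// ltW// kummer_weight_gt0.
Qed.

Lemma laplace_gt0 psi z : 0 < z -> poly_growth psi -> (forall t, 0 < t -> 0 < psi t) ->
  0 < laplace psi z.
Proof.
move=> z0 gpsi psi0; apply: Rintegral_open_gt0; first exact: integrable_laplace.
- move=> t t0; apply: mulr_gt0; last exact: expR_gt0.
  by apply: mulr_gt0; [exact: kummer_weight_gt0|exact: psi0].
- by move=> t t0; exact: cont_laplace_integrand.
Qed.

(** The boundary terms of the integrations by parts below; the one at 0 vanishes because [a > 0]. *)
Lemma cvg_boundary psi z : 0 < z -> poly_growth psi ->
  (t `^ a * psi t * expR (- z * t) @[t --> +oo] --> (0 : R)) /\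
  (t `^ a * psi t * expR (- z * t) @[t --> 0^'+] --> (0 : R)).
Proof.
move=> z0 [_ [C [n [C0 npsi]]]]; have [_ [D [m [D0 mpow]]]] := poly_growth_powR a.
have ta (t : R) : 0 < t -> t `^ a <= D * (1 + t) ^+ m.
  move=> t0; apply: le_trans (mpow _ t0); apply: le_trans (ler_norm _).
  by rewrite ge0_ler_powR ?nnegrE ?(ltW a0) ?addr_ge0 ?(ltW t0)// lerDr.
split.
- apply: (@cvg0_le_inv _ _ (D * C * exp_bound (m + n) z)) => t t1.
  have t0 : 0 < t by exact: lt_le_trans t1.
  rewrite !normrM (ger0_norm (powR_ge0 _ _)) (gtr0_norm (expR_gt0 _)) ler_pdivlMr//.
  have H : t `^ a * `|psi t| <= (D * (1 + t) ^+ m) * (C * (1 + t) ^+ n).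
    by apply: ler_pM; rewrite ?powR_ge0 ?ta ?npsi.
  apply: (@le_trans _ _ (D * C * ((1 + t) ^+ (m + n).+1 * expR (- z * t)))); last first.
    by apply: ler_wpM2l; [exact: mulr_ge0|exact: exp_boundP].
  rewrite mulrAC mulrA; apply: ler_wpM2r; first exact: expR_ge0.
  rewrite exprSr exprD (_ : D * C * _ = (D * (1 + t) ^+ m) * (C * (1 + t) ^+ n) * (1 + t)); last by ring.
  apply: ler_pM => //; last by rewrite lerDr.
  - by rewrite mulr_ge0 ?powR_ge0.
  - exact: ltW.
- apply/cvgrPdist_le => /= e e0; near=> t.
  have t0 : 0 < t by near: t; exact: nbhs_right_gt.
  have t1 : t <= 1 by near: t; exact: nbhs_right_le.
  rewrite sub0r normrN !normrM (ger0_norm (powR_ge0 _ _)) (gtr0_norm (expR_gt0 _)).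
  apply: (@le_trans _ _ (t `^ a * ((C + 1) * 2 ^+ n))).
    rewrite -mulrA ler_wpM2l ?powR_ge0// -[leRHS]mulr1; apply: ler_pM => //.
    + apply: (le_trans (npsi _ t0)); apply: ler_pM => //; last by apply: lerXn2r; rewrite ?nnegrE; lra.
        by rewrite exprn_ge0// addr_ge0// ltW.
      by rewrite lerDl.
    + by rewrite expR_le1 mulNr oppr_le0 mulr_ge0 ?ltW.
  rewrite -ler_pdivlMr ?mulr_gt0 ?exprn_gt0 ?ltr_wpDl//; apply: ltW; near: t.
  have C20 : 0 < (C + 1) * 2 ^+ n by rewrite mulr_gt0 ?exprn_gt0 ?ltr_wpDl.
  have := @powR_cvg0 R a a0; move/cvgrPdist_lt => /(_ _ (divr_gt0 e0 C20)); apply: filterS => t.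
  by rewrite sub0r normrN ger0_norm ?powR_ge0.
Unshelve. all: by end_near. Qed.

End laplace.

Section kummer_integral.
Context {R : realType}.
Notation mu := (@lebesgue_measure R).
Variable a : R.
Hypothesis a0 : 0 < a.
Local Notation w := (kummer_weight a).
Local Notation laplace := (laplace a).

Local Notation pow_compl := (fun t : R => (1 + t) `^ (a + 2^-1)).

Lemma kummer_weight_pow (t : R) : 0 < t -> w t * (1 + t) `^ (a + 2^-1) = t `^ (a - 1).
Proof.
move=> t0; have t1 : 0 < 1 + t by rewrite addr_gt0.
rewrite /kummer_weight -mulrA -gt0_powRD// (_ : - a - 2^-1 + (a + 2^-1) = 0) ?powRr0 ?mulr1//.
by lra.
Qed.

(** The amplitude [(1 + t) ^ (a + 1/2)] cancels the second factor of the weight, so Euler's integral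
    becomes a Laplace integral and inherits its calculus. *)
Lemma Gamma_laplace : Gamma a = laplace pow_compl 1.
Proof.
apply: eq_Rintegral => t; rewrite inE/= in_itv/= andbT => t0.
by rewrite kummer_weight_pow// mulN1r.
Qed.

Lemma GammaS_laplace : Gamma (a + 1) = laplace (fun t => t * (1 + t) `^ (a + 2^-1)) 1.
Proof.
apply: eq_Rintegral => t; rewrite inE/= in_itv/= andbT => t0.
by rewrite mulrCA kummer_weight_pow// mulN1r -powRS// addrK.
Qed.

(** Integration by parts: up to sign, the difference of the two sides is the integral of the
    derivative of [t ^ a expR (- z t)]. At [z = 1] this is the functional equation of [Gamma]. *)
Lemma laplace_pow_rec z : 0 < z ->
  z * laplace (fun t => t * (1 + t) `^ (a + 2^-1)) z = a * laplace pow_compl z.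
Proof.
move=> z0; have gp := poly_growth_powR (a + 2^-1); have gp' := poly_growthM gp.
apply/eqP; rewrite -subr_eq0 -opprB oppr_eq0 -mulNr -laplaceD//; apply/eqP.
have [Fy F0] := cvg_boundary a0 z0 (@poly_growth1 R).
have gD := poly_growthD a (- z) gp gp'.
rewrite /laplace (FTC_open (F := fun t => t `^ a * 1 * expR (- z * t)) (L := 0) (l := 0)) ?subrr//.
- exact: integrable_laplace.
- by move=> t t0; exact: cont_laplace_integrand.
- move=> t t0; have t1 : 0 < 1 + t by rewrite addr_gt0.
  deriv => //=.
  rewrite (_ : w t * (_ + _) = (a + - z * t) * (w t * (1 + t) `^ (a + 2^-1))); last by ring.
  by rewrite kummer_weight_pow// (powRS a t0); ring.
Qed.

Lemma GammaS : Gamma (a + 1) = a * Gamma a.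
Proof.
by rewrite Gamma_laplace GammaS_laplace -(mul1r (laplace _ _)) laplace_pow_rec// ltr01.
Qed.

Lemma Gamma_gt0 : 0 < Gamma a.
Proof.
rewrite Gamma_laplace; apply: laplace_gt0 => //; first exact: poly_growth_powR.
by move=> t t0; rewrite powR_gt0// addr_gt0.
Qed.

(** By the recurrence, [z ^ a] times the left-hand side has zero derivative, and its value at 1 is
    [Gamma a]. *)
Lemma laplace_pow z : 0 < z -> laplace pow_compl z = Gamma a * z `^ (- a).
Proof.
move=> z0; have gp := poly_growth_powR (a + 2^-1).
have E : z `^ a * laplace pow_compl z = Gamma a.
  rewrite Gamma_laplace -[RHS]mul1r (_ : 1 * laplace _ 1 = 1 `^ a * laplace pow_compl 1); last by rewrite powR1.
  apply: (@const_has_deriv0 R (fun z => z `^ a * laplace pow_compl z) z 1) => // x x0.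
  have dL := has_deriv_laplace a0 x0 gp.
  deriv => //=; rewrite (powRS a x0).
  have := laplace_pow_rec x0; set A := laplace _ _; set B := laplace _ _ => AB.
  transitivity (x `^ (a - 1) * (a * B - x * A)); first by ring.
  by rewrite AB subrr mulr0.
by rewrite -E mulrAC -gt0_powRD// subrr powRr0 mul1r.
Qed.

Definition kummer_int (z : R) := laplace (fun=> 1) z / Gamma a.

Lemma kummer_int_gt0 z : 0 < z -> 0 < kummer_int z.
Proof.
move=> z0; rewrite divr_gt0 ?Gamma_gt0//; apply: laplace_gt0 => //.
exact: poly_growth1.
Qed.

Lemma has_deriv_kummer_int z : 0 < z ->
  has_deriv kummer_int z (- laplace (fun t => t * 1) z / Gamma a).
Proof.
move=> z0; have dL := has_deriv_laplace a0 z0 (@poly_growth1 R).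
by rewrite /kummer_int; deriv; rewrite ?gt_eqF ?Gamma_gt0//= mulr0 addr0.
Qed.

Lemma has_deriv2_kummer_int z : 0 < z ->
  has_deriv (derive1 kummer_int) z (laplace (fun t => t * (t * 1)) z / Gamma a).
Proof.
move=> z0; apply: (has_deriv_near_eq (f := fun z => - laplace (fun t => t * 1) z / Gamma a)).
  near=> x; rewrite (has_deriv_derive1 (has_deriv_kummer_int _))//.
  by near: x; exact: lt_nbhsr.
have dL := has_deriv_laplace a0 z0 (poly_growthM (@poly_growth1 R)).
by deriv; rewrite ?gt_eqF ?Gamma_gt0//= mulr0 addr0 opprK.
Unshelve. all: by end_near. Qed.

(** The combined integrand is, up to sign, the derivative of
    [t ^ a (1 + t) ^ (1/2 - a) expR (- z t)], whose boundary values vanish. *)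
Lemma kummer_int_ode z : 0 < z ->
  z * laplace (fun t => t * (t * 1)) z - (2^-1 - z) * laplace (fun t => t * 1) z
    - a * laplace (fun=> 1) z = 0.
Proof.
move=> z0; have g0 := @poly_growth1 R; have g1 := poly_growthM g0; have g2 := poly_growthM g1.
have g3 := poly_growthD (2^-1 - z) (- z) g1 g2; have g4 := poly_growthD a 1 g0 g3.
apply/eqP; rewrite -oppr_eq0; apply/eqP.
transitivity (laplace (fun t => a * 1 + 1 * ((2^-1 - z) * (t * 1) + - z * (t * (t * 1)))) z).
  by rewrite (laplaceD a0 z0 g0 g3) (laplaceD a0 z0 g1 g2); ring.
have [Fy F0] := cvg_boundary a0 z0 (poly_growth_powR (2^-1 - a)).
rewrite /laplace (FTC_open (F := fun t => t `^ a * (1 + t) `^ (2^-1 - a) * expR (- z * t))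
  (L := 0) (l := 0)) ?subrr//.
- exact: integrable_laplace.
- by move=> t t0; exact: cont_laplace_integrand.
- move=> t t0; have t1 : 0 < 1 + t by rewrite addr_gt0.
  deriv => //=; rewrite (powRS a t0) (powRS (2^-1 - a) t1) /kummer_weight.
  rewrite (_ : 2^-1 - a - 1 = - a - 2^-1); last by lra.
  by field.
Qed.

Lemma powRN_ge (t c : R) : 0 < t -> 0 <= c -> 1 - c * t <= (1 + t) `^ (- c).
Proof.
move=> t0 c0; have t1 : 0 < 1 + t by rewrite addr_gt0.
rewrite -[X in _ <= X `^ _](lnK t1) -expRM; apply: le_trans (expR_ge1Dx _).
rewrite lerD2l mulrN lerN2 mulrC; apply: ler_wpM2l => //.
by rewrite -ler_expR lnK// expR_ge1Dx.
Qed.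

(** With [c = a + 1/2], the inequalities [(1 + t) ^ c - c t (1 + t) ^ c <= 1 <= (1 + t) ^ c] compare
    the amplitude 1 with amplitudes whose Laplace integrals are explicit. This yields the
    normalisation of [U] at infinity. *)
Lemma kummer_int_bounds z : 0 < z ->
  1 - (a + 2^-1) * a / z <= kummer_int z / z `^ (- a) <= 1.
Proof.
move=> z0; have gp := poly_growth_powR (a + 2^-1); have g0 := @poly_growth1 R.
have gp' := poly_growthM gp; have G0 := Gamma_gt0; have p0 : 0 < z `^ (- a) by exact: powR_gt0.
have E := laplace_pow z0; have E1 := laplace_pow_rec z0.
have -> : kummer_int z / z `^ (- a) = laplace (fun=> 1) z / laplace pow_compl z.
  by rewrite E /kummer_int; field; rewrite !gt_eqF.
have L0 : 0 < laplace pow_compl z by rewrite E mulr_gt0.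
rewrite ler_pdivrMr// mul1r ler_pdivlMr//; apply/andP; split; last first.
  apply: le_laplace => // t t0; rewrite -[leLHS](powRr0 (1 + t)) ler_powR//.
    by rewrite lerDl ltW.
  by rewrite addr_ge0// ltW.
have -> : (1 - (a + 2^-1) * a / z) * laplace pow_compl z =
    laplace (fun t => 1 * (1 + t) `^ (a + 2^-1) + - (a + 2^-1) * (t * (1 + t) `^ (a + 2^-1))) z.
  rewrite (laplaceD a0 z0 gp gp'); have -> : laplace (fun t => t * (1 + t) `^ (a + 2^-1)) z = a * laplace pow_compl z / z.
    by rewrite -E1; field; rewrite gt_eqF.
  by field; rewrite gt_eqF.
apply: le_laplace => //; first exact: poly_growthD.
move=> t t0; have t1 : 0 < 1 + t by rewrite addr_gt0.
have := powRN_ge t0 (addr_ge0 (ltW a0) (ltac:(by rewrite invr_ge0) : 0 <= 2^-1 :> R)).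
rewrite -(ler_pM2r (powR_gt0 (a + 2^-1) t1)) -gt0_powRD// addNr powRr0.
by apply: le_trans; rewrite le_eqVlt; apply/orP; left; apply/eqP; ring.
Qed.

Lemma is_kummerU_int : is_kummerU a 2^-1 kummer_int.
Proof.
split.
  move=> z z0; have d1 := has_deriv_kummer_int z0; have d2 := has_deriv2_kummer_int z0.
  split; [exact: has_deriv_derivable d1|exact: has_deriv_derivable d2|].
  rewrite (has_deriv_derive1 d1) (has_deriv_derive1 d2) /kummer_int.
  transitivity ((z * laplace (fun t => t * (t * 1)) z - (2^-1 - z) * laplace (fun t => t * 1) z
    - a * laplace (fun=> 1) z) / Gamma a); first by ring.
  by rewrite kummer_int_ode// mul0r.
have -> : (1 : R) = 1 - 0 by rewrite subr0.
suff H : 1 - kummer_int z / z `^ (- a) @[z --> +oo] --> (0 : R).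
  rewrite (_ : (fun z => kummer_int z / z `^ (- a)) = (fun z => 1 - (1 - kummer_int z / z `^ (- a)))).
    exact: cvgB (cvg_cst _) H.
  by apply/funext => z; rewrite subKr.
apply: (@cvg0_le_inv _ _ ((a + 2^-1) * a)) => z z1.
have z0 : 0 < z by exact: lt_le_trans z1.
have /andP[l u] := kummer_int_bounds z0.
by rewrite ger0_norm ?subr_ge0//; lra.
Qed.

End kummer_integral.

Section kummer_uniqueness.
Context {R : realType}.

(* The quotient [q] of two solutions satisfies [q' = C z^(-b) e^z / u0^2] (Wronskian), which is
   incompatible with the convergence of [q] unless [C = 0]. *)
Lemma is_kummerU_unique (a : R) u0 u : - 2^-1 <= a -> (forall z, 0 < z -> 0 < u0 z) ->
  is_kummerU a 2^-1 u0 -> is_kummerU a 2^-1 u -> forall z, 0 < z -> u z = u0 z.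
Proof.
move=> a_ge u0_gt0 [ode0 lim0] [ode lim].
have D v : (forall z : R, 0 < z -> [/\ derivable v z 1, derivable (derive1 v) z 1 &
    z * derive1 (derive1 v) z + (2^-1 - z) * derive1 v z - a * v z = 0]) ->
    forall z, 0 < z -> has_deriv v z (derive1 v z) /\
      has_deriv (derive1 v) z ((a * v z - (2^-1 - z) * derive1 v z) / z).
  move=> H z z0; have [d1 d2 E] := H z z0; split; first exact: has_derivP.
  apply: has_derivP => //; apply/eqP; rewrite eq_sym -subr_eq0 -[X in _ - X](mulfK (lt0r_neq0 z0)).
  rewrite -mulrBl mulf_eq0; apply/orP; left; rewrite -oppr_eq0 -[X in _ == X]E; apply/eqP; ring.
have D0 := D _ ode0; have D1 := D _ ode.
(* The Wronskian times its integrating factor, hence constant by Abel's identity. *)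
pose Wr z := (u0 z * derive1 u z - derive1 u0 z * u z) * (z `^ 2^-1 * expR (- z)).
have dWr z : 0 < z -> has_deriv Wr z 0.
  move=> z0; have [e1 e2] := D0 _ z0; have [e3 e4] := D1 _ z0.
  rewrite /Wr; deriv => //=; rewrite (powRS 2^-1 z0).
  by field; rewrite gt_eqF.
pose C := Wr 1.
pose q z := u z / u0 z; pose g z := (z `^ 2^-1)^-1 * expR z / u0 z ^+ 2.
have dq z : 0 < z -> has_deriv q z (C * g z).
  move=> z0; have [e1 e2] := D0 _ z0; have [e3 e4] := D1 _ z0.
  have -> : C = Wr z by exact: const_has_deriv0.
  rewrite /q /g /Wr expRN; deriv; rewrite ?gt_eqF ?u0_gt0//=.
  by field; rewrite !gt_eqF ?u0_gt0 ?powR_gt0 ?expR_gt0.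
have cvq : q z @[z --> +oo] --> (1 : R).
  have H : (u z / z `^ (- a)) / (u0 z / z `^ (- a)) @[z --> +oo] --> (1 / 1 : R).
    exact: (cvgM lim (cvgV (@oner_neq0 R) lim0)).
  rewrite divr1 in H; apply: cvg_pinfty_eq H => z z0.
  by rewrite /q/=; field; rewrite !gt_eqF ?u0_gt0 ?powR_gt0.
have C0 : C = 0.
  have [M [_ HM]] : \forall z \near +oo, u0 z / z `^ (- a) <= 2.
    by apply: (cvgr_le _ lim0); rewrite ltr1n.
  (* Since [- a <= 1/2], eventually [u0 z <= 2 z ^ (1/2)]; with [expR z >= z ^ 3 / 6], the claim
     reduces to [4 z ^ 2 <= z ^ 3 / 6], that is to [z >= 24]. *)
  have g1 z : Num.max M 24 < z -> 1 <= g z.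
    rewrite gt_max => /andP[Mz z24]; have z1 : 1 <= z by lra.
    have z0 : 0 < z by lra.
    have uz : u0 z <= 2 * z `^ 2^-1.
      have := HM _ Mz; rewrite ler_pdivrMr ?powR_gt0// => /le_trans; apply.
      by rewrite ler_wpM2l// ler_powR//; lra.
    have zz : z `^ 2^-1 * z `^ 2^-1 = z by rewrite -gt0_powRD// (_ : 2^-1 + 2^-1 = 1 :> R); [rewrite powRr1// ltW|lra].
    have zl : z `^ 2^-1 <= z by rewrite -[leRHS]powRr1 ?(ltW z0)//; apply: ler_powR => //; lra.
    have u2 : u0 z ^+ 2 <= 4 * z.
      have u00 := ltW (u0_gt0 _ z0); rewrite expr2 -[X in 4 * X]zz.
      have := ler_pM u00 u00 uz uz; congr (_ <= _); ring.
    have e3 : z ^+ 3 / 6 <= expR z.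
      by apply: le_trans (expR_ge1Dxn 2 (ltW z0)); rewrite lerDr ler01.
    rewrite /g ler_pdivlMr ?exprn_gt0 ?u0_gt0// mul1r ler_pdivlMl ?powR_gt0//.
    apply: le_trans e3; apply: (@le_trans _ _ (z * (4 * z))).
      by apply: ler_pM => //; rewrite ?powR_ge0// exprn_ge0// ltW// u0_gt0.
    rewrite (_ : z ^+ 3 / 6 = z * (z * z / 6)); last by ring.
    rewrite ler_pM2l//; nra.
  apply/eqP; rewrite -normr_le0; apply/ler_addgt0Pl => e e0; rewrite addr0.
  have e20 : 0 < e / 2 by rewrite divr_gt0.
  move/cvgrPdist_le : cvq => /(_ _ e20)[K [_ HK]].
  pose z := Num.max (Num.max M 24) K + 1.
  have zM : Num.max M 24 < z by rewrite ltr_pwDr// le_max lexx.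
  have zK : K < z by rewrite ltr_pwDr// le_max lexx orbT.
  have z0 : 0 < z by apply: lt_trans zM; rewrite lt_max ltr0n orbT.
  have zz1 : z < z + 1 by rewrite ltrDl.
  have dqz x : z < x -> has_deriv q x (C * g x) by move=> zx; apply: dq; exact: lt_trans zx.
  have [c /andP[zc _] E] := MVT_right zz1 (has_deriv_cont (dq _ z0)) dqz.
  have gc : 1 <= g c by apply: g1; exact: lt_trans zc.
  have zK1 : K < z + 1 by rewrite (lt_trans zK)// ltrDl.
  have := HK _ zK; have := HK _ zK1 => /= H1 H2.
  (* By the mean value theorem the increment of [q] over [[z, z + 1]] is at least [|C|] in absolute
     value, while convergence of [q] makes it arbitrarily small. *)
  have Cq : `|C| <= `|q (z + 1) - q z|.
    rewrite E (_ : z + 1 - z = 1) ?mulr1; last by rewrite addrAC subrr add0r.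
    rewrite [leRHS]normrM -[leLHS]mulr1; apply: ler_wpM2l => //.
    by apply: (le_trans gc); exact: ler_norm.
  rewrite (le_trans Cq)// (_ : q (z + 1) - q z = (1 - q z) - (1 - q (z + 1))); last by ring.
  by apply: (le_trans (ler_normB _ _)); rewrite (splitr e) lerD.
move=> z z0; have dq0 x : 0 < x -> has_deriv q x 0.
  by move=> x0; have := dq _ x0; rewrite C0 mul0r.
have qz : q z = 1.
  apply: (cvg_unique _ _ cvq) => //; apply: cvg_near_cst; near=> x.
  by apply: const_has_deriv0 => //; near: x; apply: nbhs_pinfty_gt; rewrite num_real.
by move: qz; rewrite /q => /(canRL (mulfVK (lt0r_neq0 (u0_gt0 _ z0)))); rewrite mul1r.
Unshelve. all: by end_near. Qed.

End kummer_uniqueness.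

Section composition.
Context {R : realType}.

Lemma has_deriv_comp (g f : R -> R) (x a b : R) : has_deriv g (f x) a -> has_deriv f x b ->
  has_deriv (fun y => g (f y)) x (a * b).
Proof. by move=> ga fb; apply: (is_derive1_comp (f := g)). Qed.

Lemma cont_at_comp (g f : R -> R) (x : R) : cont_at f x -> cont_at g (f x) ->
  cont_at (fun y => g (f y)) x.
Proof. by move=> cf cg; exact: (cvg_comp _ _ cf cg). Qed.

Lemma cont_primitive (f : R -> R) (x : R) : continuous f -> cont_at (primitive f) x.
Proof. by move=> cf; exact: continuous_primitive. Qed.

End composition.

(** * The target density *)

Section gaussian_integrals.
Context {R : realType}.
Notation mu := (@lebesgue_measure R).

Lemma cvg_primitive_gauss : primitive (@gauss_fun R) x @[x --> +oo] --> (Num.sqrt pi / 2 : R).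
Proof.
rewrite (_ : Num.sqrt pi / 2 = \int[mu]_(x in `[0, +oo[) gauss_fun x); last first.
  by rewrite /Rintegral integral0y_gauss.
apply: cvg_primitive; apply: integrableS integrableT_gauss => //.
Qed.

Lemma gauss_prim_scaled (c : R) : 0 < c ->
  (\int[mu]_(x in `]0%R, +oo[) (expR (- (c * x) ^+ 2))%:E = (Num.sqrt pi / 2 / c)%:E)%E.
Proof.
move=> c0; have -> : (Num.sqrt pi / 2 / c = Num.sqrt pi / 2 / c - 0)%R by rewrite subr0.
apply: (@ge0_FTC_open R _ (fun x => primitive gauss_fun (c * x) / c)).
- by move=> x x0; exact: expR_ge0.
- by move=> x x0; cont.
- move=> x x0; have cx0 : 0 < c * x by rewrite mulr_gt0.
  have dp : has_deriv (fun x => primitive gauss_fun (c * x)) x (gauss_fun (c * x) * c).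
    have dm : has_deriv (fun x : R => c * x) x c by deriv; rewrite mul0r add0r mulr1.
    exact: has_deriv_comp (has_deriv_primitive (@continuous_gauss_fun R) cx0) dm.
  by deriv => //=; rewrite /gauss_fun; field; rewrite gt_eqF.
- apply: cvgM; last exact: cvg_cst.
  apply: (cvg_comp _ _ _ cvg_primitive_gauss).
  by apply: gt0_cvgMry => //; exact: cvg_id.
- have cp : cont_at (fun x => primitive (@gauss_fun R) (c * x) / c) 0.
    have cm : cont_at (fun x : R => c * x) 0 by cont.
    have cq : cont_at (fun x => primitive (@gauss_fun R) (c * x)) 0.
      exact: (cont_at_comp cm (cont_primitive (@continuous_gauss_fun R))).
    by cont.
  have := cvg_at_right_filter cp; rewrite mulr0 primitive_le0// mul0r; exact.
Qed.

Lemma cvg_primitive_open (f : R -> R) (l : R) : continuous f -> (forall x, 0 <= f x) ->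
  (\int[mu]_(x in `]0%R, +oo[) (f x)%:E = l%:E)%E -> primitive f x @[x --> +oo] --> l.
Proof.
move=> cf f0 fl; have mf : measurable_fun [set: R] (EFin \o f).
  by apply/measurable_EFinP; exact: continuous_measurable_fun.
have fl' : (\int[mu]_(x in `[0%R, +oo[) (f x)%:E = l%:E)%E.
  rewrite -integral_itv_obnd_cbnd//; exact: measurable_funTS.
rewrite (_ : l = \int[mu]_(x in `[0, +oo[) f x); last by rewrite /Rintegral fl'.
apply: cvg_primitive; apply/integrableP; split; first exact: measurable_funTS.
under eq_integral do rewrite /= ger0_norm//.
by rewrite fl' ltry.
Qed.

(** The substitution [t = x ^ 2] in the Gaussian integral, carried out on the antiderivative. *)
Lemma Gamma_half : Gamma (2^-1 : R) = Num.sqrt pi.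
Proof.
rewrite /Gamma /Rintegral.
rewrite (@ge0_FTC_open R _ (fun t => 2 * primitive gauss_fun (t `^ 2^-1)) (2 * (Num.sqrt pi / 2)) 0).
- by rewrite subr0 /=; field.
- by move=> x x0; rewrite mulr_ge0 ?powR_ge0// expR_ge0.
- by move=> x x0; cont.
- move=> x x0; have px0 : 0 < x `^ 2^-1 by exact: powR_gt0.
  have dp : has_deriv (fun x => primitive gauss_fun (x `^ 2^-1)) x (gauss_fun (x `^ 2^-1) * (2^-1 * x `^ (2^-1 - 1) * 1)).
    apply: has_deriv_comp; first exact: has_deriv_primitive (@continuous_gauss_fun R) px0.
    by deriv.
  deriv => //=; rewrite /gauss_fun expr2 -gt0_powRD//.
  rewrite (_ : 2^-1 + 2^-1 = 1 :> R); last by lra.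
  by rewrite powRr1 ?ltW//; field.
- apply: cvgM; first exact: cvg_cst.
  apply: (cvg_comp _ _ _ cvg_primitive_gauss).
  apply/cvgryPge => A; near=> x.
  have A0 : 0 <= Num.max A 0 by rewrite le_max lexx orbT.
  apply: (@le_trans _ _ (Num.max A 0)); first by rewrite le_max lexx.
  have -> : Num.max A 0 = (Num.max A 0 `^ 2) `^ 2^-1 by rewrite -powRrM divff// powRr1.
  apply: ge0_ler_powR; [by rewrite invr_ge0|by rewrite nnegrE powR_ge0| |].
    by rewrite nnegrE; near: x; apply: nbhs_pinfty_ge; rewrite num_real.
  by near: x; apply: nbhs_pinfty_ge; rewrite num_real.
- rewrite -[X in _ --> X](mulr0 2); apply: cvgM; first exact: cvg_cst.
  have h0 : 0 < 2^-1 :> R by rewrite invr_gt0.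
  have cp := cont_primitive (x := 0) (@continuous_gauss_fun R).
  have H : primitive (@gauss_fun R) (x `^ 2^-1) @[x --> 0^'+] --> primitive (@gauss_fun R) 0.
    exact: (cvg_comp _ _ (powR_cvg0 h0) cp).
  by rewrite [X in _ --> X]primitive_le0 in H.
Unshelve. all: by end_near. Qed.

Lemma Gamma1 : Gamma (1 : R) = 1.
Proof.
rewrite /Gamma /Rintegral.
rewrite (@ge0_FTC_open R _ (fun t => - expR (- t)) 0 (- 1)).
- by rewrite sub0r opprK.
- by move=> x x0; rewrite mulr_ge0 ?powR_ge0// expR_ge0.
- by move=> x x0; cont.
- by move=> x x0; deriv => //=; rewrite subrr powRr0; ring.
- rewrite -[X in _ --> X]oppr0; apply: cvgN; exact: cvgr_expR.
- have cp : cont_at (fun x : R => - expR (- x)) 0 by cont.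
  by have := cvg_at_right_filter cp; rewrite oppr0 expR0; exact.
Qed.

End gaussian_integrals.

Section kummerU_values.
Context {R : realType}.

(** A positive solution in hand serves twice: it shows that the choice in [kummerU] is made from a
    nonempty set, and uniqueness then identifies the chosen function with it. *)
Lemma kummerU_eq (a : R) u0 : - 2^-1 <= a -> (forall z, 0 < z -> 0 < u0 z) ->
  is_kummerU a 2^-1 u0 -> forall z, 0 < z -> kummerU a 2^-1 z = u0 z.
Proof.
move=> a_ge u00 K0; apply: (is_kummerU_unique a_ge u00 K0).
exact: (xgetI (fun=> 0) K0).
Qed.

Lemma kummerU0 (z : R) : 0 < z -> kummerU 0 2^-1 z = 1.
Proof.
move=> z0; apply: (@kummerU_eq 0 (fun=> 1)) => //.
split.
  move=> x x0; have d1 : derive1 (fun=> 1 : R) = (fun=> 0 : R).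
    by apply/funext => y; rewrite (has_deriv_derive1 (has_deriv_cst _ _)).
  rewrite d1; split; [exact: has_deriv_derivable (has_deriv_cst _ _)..|].
  by rewrite (has_deriv_derive1 (has_deriv_cst _ _)) !mulr0 !mul0r addr0 subr0.
apply: (cvg_pinfty_eq (f := fun=> 1)); last exact: cvg_cst.
by move=> x x0; rewrite oppr0 powRr0 divr1.
Qed.

(** The parameter of [s = 1/2], at the edge [a = - 1/2] of the uniqueness lemma, where the Laplace
    integral diverges at 0. *)
Lemma kummerU_Nhalf (z : R) : 0 < z -> kummerU (- 2^-1) 2^-1 z = z `^ 2^-1.
Proof.
move=> z0; apply: (@kummerU_eq (- 2^-1) (fun x => x `^ 2^-1)) => //.
  by move=> x x0; exact: powR_gt0.
split.
  move=> x x0; have d1 y : 0 < y -> has_deriv (fun x : R => x `^ 2^-1) y (2^-1 * y `^ (2^-1 - 1)).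
    by move=> y0; deriv => //=; rewrite mulr1.
  have d2 : has_deriv (derive1 (fun x : R => x `^ 2^-1)) x (2^-1 * ((2^-1 - 1) * x `^ (2^-1 - 1 - 1))).
    apply: (has_deriv_near_eq (f := fun y => 2^-1 * y `^ (2^-1 - 1))).
      near=> y; rewrite (has_deriv_derive1 (d1 _ _))//.
      by near: y; exact: lt_nbhsr.
    by deriv => //=; ring.
  split; [exact: has_deriv_derivable (d1 _ x0)|exact: has_deriv_derivable d2|].
  rewrite (has_deriv_derive1 d2) (has_deriv_derive1 (d1 _ x0)) (powRS 2^-1 x0) (powRS (2^-1 - 1) x0).
  by field.
apply: (cvg_pinfty_eq (f := fun=> 1)); last exact: cvg_cst.
by move=> x x0; rewrite opprK divff// gt_eqF// powR_gt0.
Unshelve. all: by end_near. Qed.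

End kummerU_values.

(* The last clause is the equation s V'' - x V' - 2 (s - 1) V = 0 integrated once, the constant being
   fixed by the behaviour at infinity. *)
Definition density_factor {R : realType} (s : R) (V : R -> R) :=
  [/\ continuous V, forall x, 0 < V x,
      forall x, 0 < x -> kappa s x = V x * gauss_weight s x,
      (\int[lebesgue_measure]_(x in `]0%R, +oo[) (V x * gauss_weight s x)%:E = 1)%E &
      forall x, 0 < x -> has_deriv V x
        (- ((2 * s - 2) / s) * (1 - primitive (fun t => V t * gauss_weight s t) x) / gauss_weight s x)].

Section density.
Context {R : realType}.
Notation mu := (@lebesgue_measure R).
Variable s : R.

Lemma gauss_weight_sqr (lam x : R) : 0 < s -> 0 < lam ->
  expR (- x ^+ 2 / (2 * s) * lam) = expR (- (Num.sqrt (lam / (2 * s)) * x) ^+ 2).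
Proof.
move=> s0 l0; congr expR; rewrite exprMn sqr_sqrtr; last by rewrite divr_ge0 ?mulr_ge0 ?ltW.
by field; rewrite gt_eqF.
Qed.

(** Used at [lam = 1], and at [lam = 1 + t], where the Gaussian weight has absorbed the exponential
    of the Laplace integral. *)
Lemma integral_gauss_weight (lam : R) : 0 < s -> 0 < lam ->
  (\int[mu]_(x in `]0%R, +oo[) (expR (- x ^+ 2 / (2 * s) * lam))%:E =
   (Num.sqrt (pi * s / 2) / Num.sqrt lam)%:E)%E.
Proof.
move=> s0 l0; under eq_integral do rewrite gauss_weight_sqr//.
rewrite gauss_prim_scaled; last by rewrite sqrtr_gt0 divr_gt0 ?mulr_gt0.
congr EFin; rewrite sqrtrM ?ltW// sqrtrV ?mulr_ge0 ?ltW//.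
rewrite (_ : pi * s / 2 = pi * (2 * s) / 2 ^+ 2); last by field.
have -> : Num.sqrt (pi * (2 * s) / 2 ^+ 2) = Num.sqrt pi * Num.sqrt (2 * s) / 2.
  apply: (@pexpIrn _ 2) => //; rewrite ?nnegrE ?mulr_ge0 ?sqrtr_ge0 ?invr_ge0//.
  by rewrite !exprMn !sqr_sqrtr ?divr_ge0 ?mulr_ge0 ?pi_ge0 ?exprn_ge0 ?(ltW s0)// exprVn.
by field; rewrite !gt_eqF ?sqrtr_gt0 ?mulr_gt0.
Qed.

Lemma density_factor1 : s = 1 -> density_factor s (fun=> Num.sqrt (2 / pi)).
Proof.
move=> s1; have c0 : 0 < Num.sqrt (2 / pi) :> R by rewrite sqrtr_gt0 divr_gt0 ?pi_gt0.
split => //.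
- by move=> x; exact: cvg_cst.
- move=> x x0; rewrite /kappa s1 Gamma1 subrr kummerU0 ?divr_gt0 ?exprn_gt0 ?mulr_gt0//.
  by rewrite mul1r mulr1 mul1r.
- under eq_integral do rewrite EFinM /gauss_weight -[X in expR X]mulr1.
  rewrite ge0_integralZl//=.
    have s0 : 0 < s by rewrite s1.
    have E : Num.sqrt (2 / pi) * (Num.sqrt (pi * s / 2) / Num.sqrt 1) = 1 :> R.
      have p0 : 0 <= 2 / pi :> R by rewrite divr_ge0 ?pi_ge0.
      rewrite sqrtr1 divr1 -(sqrtrM _ p0) s1 (_ : 2 / pi * (pi * 1 / 2) = 1) ?sqrtr1//.
      by rewrite mulr1 mulrA divfK ?divff// gt_eqF// pi_gt0.
    by rewrite (integral_gauss_weight s0 ltr01) -EFinM E.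
  apply/measurable_EFinP; apply: measurable_funTS; apply: continuous_measurable_fun => x.
  by apply: (_ : cont_at _ x); cont.
- by move=> x x0; deriv; rewrite s1 mulr1 subrr !mul0r oppr0 !mul0r.
Qed.

Hypothesis s1 : 1 < s.
Let a := s - 1.
Let a0 : 0 < a. Proof. by rewrite subr_gt0. Qed.
Let s0 : 0 < s. Proof. exact: lt_trans s1. Qed.
Local Notation w := (kummer_weight a).
Local Notation L := (laplace a).

Let cst1 := Gamma s * Num.sqrt (2 / (s * pi)) / Gamma a.

Let cst1_gt0 : 0 < cst1.
Proof.
by rewrite divr_gt0 ?Gamma_gt0// mulr_gt0 ?Gamma_gt0// sqrtr_gt0 divr_gt0// mulr_gt0// pi_gt0.
Qed.

(** [kappa] without its Gaussian factor. As a function of [x ^ 2] it is defined on the whole line;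
    at [x = 0] the Laplace integral still converges since the weight is integrable. *)
Let V (x : R) := cst1 * L (fun=> 1) (x ^+ 2 / (2 * s)).

Let integrand_le (z t : R) : 0 <= z -> 0 < t -> `|w t * 1 * expR (- z * t)| <= w t.
Proof.
move=> z0 t0; rewrite mulr1 normrM (gtr0_norm (kummer_weight_gt0 a t0)) (gtr0_norm (expR_gt0 _)).
apply: ler_piMr; first exact/ltW/kummer_weight_gt0.
by rewrite expR_le1 mulNr oppr_le0 mulr_ge0// ltW.
Qed.

Let integrable0 (z : R) : 0 <= z ->
  mu.-integrable `]0, +oo[ (EFin \o (fun t => w t * 1 * expR (- z * t))).
Proof.
move=> z0; apply: (integrable_open_le _ (integrable_kummer_weight a0)).
  by move=> t t0; apply: cont_laplace_integrand => //; exact: poly_growth1.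
by move=> t t0; exact: integrand_le.
Qed.

Let V_gt0 x : 0 < V x.
Proof.
rewrite mulr_gt0//; apply: Rintegral_open_gt0.
- by apply: integrable0; rewrite divr_ge0 ?sqr_ge0// mulr_ge0// ltW.
- by move=> t t0; rewrite mulr1 mulr_gt0 ?expR_gt0// kummer_weight_gt0.
- by move=> t t0; apply: cont_laplace_integrand => //; exact: poly_growth1.
Qed.

(** Differentiability of the Laplace integral covers positive parameters; continuity at parameter 0
    comes from domination by the weight itself. *)
Let V_cont : continuous V.
Proof.
move=> x; apply: cvgM; first exact: cvg_cst.
pose f (x t : R) := w t * 1 * expR (- (x ^+ 2 / (2 * s)) * t).
have mI : measurable (`]0, +oo[%classic : set (measurableTypeR R)) by exact: measurable_itv.
have intf (y : R) : `](x - 1), (x + 1)[%classic y -> mu.-integrable `]0, +oo[ (EFin \o f y).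
  by move=> _; apply: integrable0; rewrite divr_ge0 ?sqr_ge0// mulr_ge0// ltW.
have := @continuity_under_integral R _ _ mu f _ mI (x - 1) (x + 1) intf.
have cf : {ae mu, forall t, `]0, +oo[%classic t -> {in (`](x - 1), (x + 1)[%classic : set R), continuous (f ^~ t)}}.
  apply: aeW => t _ y _; apply: (_ : cont_at _ y); rewrite /f; cont.
move=> /(_ cf w (integrable_kummer_weight a0)).
have g_ub (y : R) : `](x - 1), (x + 1)[%classic y -> {ae mu, forall t, `]0, +oo[%classic t -> `|f y t| <= w t}.
  move=> _; apply: aeW => t; rewrite /= in_itv/= andbT => t0; apply: integrand_le => //.
  by rewrite divr_ge0 ?sqr_ge0// mulr_ge0// ltW.
move=> /(_ g_ub x); apply; rewrite inE/= in_itv/= ltrDl ltr01 andbT.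
by rewrite ltrBlDr ltrDl.
Qed.

Let V_kappa x : 0 < x -> kappa s x = V x * gauss_weight s x.
Proof.
move=> x0; rewrite /kappa (@kummerU_eq _ (s - 1) (kummer_int a)).
- by rewrite /V /cst1 /kummer_int /gauss_weight; ring.
- by apply: (@le_trans _ _ 0); [rewrite oppr_le0 invr_ge0|exact: ltW].
- exact: kummer_int_gt0.
- exact: is_kummerU_int.
- by rewrite divr_gt0 ?exprn_gt0// mulr_gt0.
Qed.

(** The factor [(1 + t) ^ (- 1/2)] is what integrating out the Gaussian in [x] leaves under the
    Laplace integral. *)
Let integral_weight :
  (\int[mu]_(t in `]0%R, +oo[) (w t * (1 + t) `^ (- 2^-1))%:E = (a^-1)%:E)%E.
Proof.
have t1 (t : R) : 0 < t -> 0 < 1 + t by move=> ?; rewrite addr_gt0.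
rewrite (@ge0_FTC_open R _ (fun t => t `^ a * (1 + t) `^ (- a) / a) a^-1 0) ?subr0//.
- by move=> t t0; rewrite mulr_ge0 ?powR_ge0// ltW// kummer_weight_gt0.
- by move=> t t0; have ct := cont_kummer_weight t0 (a := a); cont; exact: t1.
- move=> t t0; deriv => //=; first exact: t1.
  have E : w t * (1 + t) `^ (- 2^-1) = t `^ (a - 1) * (1 + t) `^ (- a - 1).
    by rewrite /kummer_weight -mulrA -gt0_powRD ?t1//; congr (_ * _ `^ _); lra.
  by rewrite E (powRS a t0) (powRS (- a) (t1 _ t0)); field; rewrite gt_eqF.
- rewrite -[X in _ --> X]mul1r; apply: cvgM; last exact: cvg_cst.
  have H : (1 - (1 + t)^-1) `^ a @[t --> +oo] --> (1 : R).
    have c1 : cont_at (fun y : R => y `^ a) 1 by cont.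
    have {}c1 : y `^ a @[y --> (1 : R)] --> (1 : R) by rewrite -[X in _ --> X](congr1 (@^~ a) (powR1 R)); exact: c1.
    apply: (cvg_comp _ _ _ c1); rewrite -[X in _ `=>` nbhs X]subr0; apply: cvgB; first exact: cvg_cst.
    apply: (@cvg0_le_inv _ _ 1) => t ge1; have t0 : 0 < t by exact: lt_le_trans ge1.
    by rewrite gtr0_norm ?invr_gt0 ?t1// div1r lef_pV2 ?posrE ?t1// lerDr.
  apply: cvg_pinfty_eq H => t t0; rewrite powRN.
  have p1 := powR_gt0 a (t1 _ t0).
  apply: (canRL (mulfK (lt0r_neq0 p1))); rewrite -powRM; [|by rewrite subr_ge0 invf_le1 ?t1// lerDl ltW|by rewrite ltW// t1].
  by congr (_ `^ _); field; rewrite gt_eqF ?t1.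
- have c1 : cont_at (fun t : R => (1 + t) `^ (- a)) 0 by cont; rewrite addr0.
  have := cvgM (cvgM (powR_cvg0 a0) (cvg_at_right_filter c1)) (cvg_cst (a^-1)).
  by rewrite !mul0r; apply.
Qed.

Let D : set (measurableTypeR R) := `]0, +oo[%classic.

(** By Tonelli, integrating in [x] first reduces the mass to [integral_weight]; the constants then
    cancel through [Gamma s = a Gamma a]. *)
Let integral_V : (\int[mu]_(x in `]0%R, +oo[) (V x * gauss_weight s x)%:E = 1)%E.
Proof.
have mD : measurable D by exact: measurable_itv.
pose G (x t : R) := cst1 * (w t * expR (- x ^+ 2 / (2 * s) * (1 + t))).
have DP (t : R) : D t -> 0 < t by rewrite /D/= in_itv/= andbT.
have G0 x t : D t -> 0 <= G x t.
  by move=> /DP t0; rewrite mulr_ge0 ?(ltW cst1_gt0)// mulr_ge0 ?expR_ge0// ltW// kummer_weight_gt0.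
have VG x : (V x * gauss_weight s x)%:E = (\int[mu]_(t in D) (G x t)%:E)%E.
  have z0 : 0 <= x ^+ 2 / (2 * s) by rewrite divr_ge0 ?sqr_ge0// mulr_ge0// ltW.
  have k0 : 0 <= cst1 * gauss_weight s x by rewrite mulr_ge0// ltW// gauss_weight_gt0.
  rewrite /V mulrAC EFinM /laplace /Rintegral fineK; last first.
    by apply: integrable_fin_num => //; exact: integrable0.
  rewrite -ge0_integralZl//=; last 2 first.
  - exact: measurable_int (integrable0 z0).
  - move=> t /DP t0; rewrite lee_fin.
    by rewrite mulr1 mulr_ge0 ?expR_ge0// ltW// kummer_weight_gt0.
  apply: eq_integral => t _; rewrite -EFinM /G /gauss_weight mulr1.
  have -> : - x ^+ 2 / (2 * s) * (1 + t) = - x ^+ 2 / (2 * s) + - (x ^+ 2 / (2 * s)) * t by ring.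
  by rewrite expRD; congr EFin; ring.
(* Extension by zero to the plane, where the product measure lives. *)
pose F (p : R * R) := (G p.1 p.2 * \1_D p.1 * \1_D p.2)%:E.
have mF : measurable_fun [set: R * R] F.
  apply/measurable_EFinP; apply: measurable_funM; last first.
    by apply: measurableT_comp => //; exact: measurable_indic.
  apply: measurable_funM; last first.
    by apply: measurableT_comp => //; exact: measurable_indic.
  apply: measurable_funM => //; apply: measurable_funM.
    apply: measurable_funM.
      by apply: (measurableT_comp (measurable_powR _)); exact: measurable_snd.
    apply: (measurableT_comp (measurable_powR _)).
    by apply: measurable_funD.
  apply: measurableT_comp => //; apply: measurable_funM; last exact: measurable_funD.
  apply: measurable_funM => //; apply: measurableT_comp => //.
  by apply: measurable_funX.
have mG x : measurable_fun setT (G x).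
  apply: measurable_funM => //; apply: measurable_funM.
    by apply: measurable_funM => //; apply: (measurableT_comp (measurable_powR _)); exact: measurable_funD.
  by apply: measurableT_comp => //; apply: measurable_funM => //; exact: measurable_funD.
have F0 p : (0 <= F p)%E.
  rewrite lee_fin -mulrA; have [Dp|nDp] := pselect (D p.2).
    by rewrite mulr_ge0 ?G0// mulr_ge0.
  by rewrite !indicE (memNset nDp) mulr0 mulr0.
have EG (f : R -> \bar R) : (\int[mu]_(x in D) f x = \int[mu]_x (f x * (\1_D x)%:E))%E.
  rewrite integral_mkcond; apply: eq_integral => x _; rewrite patchE indicE.
  by case: ifP => _; rewrite ?mule1 ?mule0.
transitivity (\int[mu]_x \int[mu]_t F (x, t))%E.
  rewrite EG; apply: eq_integral => x _; rewrite VG EG.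
  rewrite muleC -ge0_integralZl//; last 2 first.
  - apply: emeasurable_funM; apply/measurable_EFinP; [exact: mG|exact: measurable_indic].
  - by move=> t _; have [Dt|nDt] := pselect (D t); [by rewrite mule_ge0 ?lee_fin ?G0|by rewrite indicE (memNset nDt) mule0].
  apply: eq_integral => t _; rewrite -!EFinM /F/=; congr EFin; ring.
rewrite fubini_tonelli//.
transitivity (\int[mu]_(t in D) ((cst1 * Num.sqrt (pi * s / 2))%:E * (w t * (1 + t) `^ (- 2^-1))%:E))%E.
  rewrite [RHS]EG; apply: eq_integral => t _.
  have [Dt|nDt] := pselect (D t); last first.
    rewrite [in RHS]indicE (memNset nDt) mulr0n mule0 integral0_eq// => x _.
    by rewrite /F/= [\1_D t]indicE (memNset nDt) mulr0.
  have t0 := DP _ Dt.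
  have k0 : 0 <= cst1 * w t by rewrite mulr_ge0 ?(ltW cst1_gt0)// ltW// kummer_weight_gt0.
  have t1 : 0 < 1 + t by rewrite addr_gt0.
  transitivity (\int[mu]_x ((cst1 * w t)%:E * ((expR (- x ^+ 2 / (2 * s) * (1 + t)))%:E * (\1_D x)%:E)))%E.
    by apply: eq_integral => x _; rewrite /F/= /G [\1_D t]indicE (mem_set Dt) -!EFinM mulr1 !mulrA.
  rewrite ge0_integralZl; last 4 first.
  - exact: measurableT.
  - apply: emeasurable_funM; apply/measurable_EFinP; last exact: measurable_indic.
    apply: measurableT_comp => //; apply: measurable_funM => //; apply: measurable_funM => //.
    by apply: measurableT_comp => //; exact: measurable_funX.
  - by move=> x _; rewrite mule_ge0 ?lee_fin ?expR_ge0.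
  - by rewrite lee_fin.
  rewrite -EG integral_gauss_weight// [in RHS]indicE (mem_set Dt) mule1 powRN powR12_sqrt ?ltW//.
  by rewrite -!EFinM; congr EFin; ring.
rewrite ge0_integralZl//; last 3 first.
- apply/measurable_EFinP; apply: measurable_funTS; apply: measurable_funM; last first.
    by apply: (measurableT_comp (measurable_powR _)); exact: measurable_funD.
  by apply: measurable_funM => //; apply: (measurableT_comp (measurable_powR _)); exact: measurable_funD.
- by move=> t /DP t0; rewrite lee_fin mulr_ge0 ?powR_ge0// ltW// kummer_weight_gt0.
- by rewrite lee_fin mulr_ge0 ?sqrtr_ge0// ltW.
have Gs : Gamma s = a * Gamma a by rewrite -GammaS// subrK.
have E : Num.sqrt (2 / (s * pi)) * Num.sqrt (pi * s / 2) = 1 :> R.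
  rewrite -sqrtrM; last by rewrite divr_ge0// mulr_ge0 ?pi_ge0// ltW.
  have -> : 2 / (s * pi) * (pi * s / 2) = 1; last exact: sqrtr1.
  have pn : pi != 0 :> R by rewrite gt_eqF// pi_gt0.
  by move: (pi : R) pn => p pn; field; rewrite pn gt_eqF.
rewrite integral_weight -EFinM; congr EFin.
rewrite /cst1 Gs (_ : _ * _ * _ / _ * _ / a = (a * Gamma a) / (a * Gamma a) * (Num.sqrt (2 / (s * pi)) * Num.sqrt (pi * s / 2))); last first.
  rewrite [(a * Gamma a)^-1]invfM; move: (Gamma a) (Num.sqrt _) (Num.sqrt _) => g r r'; generalize a => b; ring.
by rewrite E mulr1 divff// gt_eqF// mulr_gt0// Gamma_gt0.
Qed.

Let z_ x := x ^+ 2 / (2 * s).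
Let z_gt0 x : 0 < x -> 0 < z_ x.
Proof. by move=> x0; rewrite divr_gt0 ?exprn_gt0// mulr_gt0. Qed.

Let V1 x := - cst1 * L (fun t => t * 1) (z_ x) * x / s.

Let has_deriv_z x : has_deriv z_ x (x / s).
Proof. by rewrite /z_; deriv => //=; field; rewrite gt_eqF. Qed.

Let V_deriv x : 0 < x -> has_deriv V x (V1 x).
Proof.
move=> x0; have dL : has_deriv (fun x => L (fun=> 1) (z_ x)) x (- L (fun t => t * 1) (z_ x) * (x / s)).
  apply: has_deriv_comp; last exact: has_deriv_z.
  by apply: has_deriv_laplace => //; [exact: z_gt0|exact: poly_growth1].
rewrite /V; deriv => //=; rewrite /V1; ring.
Qed.

Let Vphi_cont : continuous (fun x => V x * gauss_weight s x).
Proof. by move=> x; apply: cvgM; [exact: V_cont|exact: continuous_gauss_weight]. Qed.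

(** A first integral of Kummer's equation in the variable [x]: the equation makes it constant, and
    its limit at infinity makes that constant 0. *)
Let flux x := s * gauss_weight s x * V1 x + (2 * s - 2) * (1 - primitive (fun t => V t * gauss_weight s t) x).

Let flux_deriv x : 0 < x -> has_deriv flux x 0.
Proof.
move=> x0; have dL : has_deriv (fun x => L (fun t => t * 1) (z_ x)) x (- L (fun t => t * (t * 1)) (z_ x) * (x / s)).
  apply: has_deriv_comp; last exact: has_deriv_z.
  by apply: has_deriv_laplace => //; [exact: z_gt0|apply: poly_growthM; exact: poly_growth1].
have dp := has_deriv_primitive Vphi_cont x0.
have dg := has_deriv_gauss_weight s0 x.
have sn : s != 0 by rewrite gt_eqF.
rewrite /flux /V1; deriv => //=.
have := kummer_int_ode a0 (z_gt0 x0).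
rewrite /V -/(z_ x); set L2 := L _ _; set L1 := L _ _; set L0 := L _ _ => E.
set p := primitive _ _; transitivity (2 * cst1 * gauss_weight s x * (z_ x * L2 - (2^-1 - z_ x) * L1 - a * L0)).
  by clearbody p L0 L1 L2 cst1; rewrite /z_ /a; field.
by rewrite E mulr0.
Qed.

Let cvg_flux : flux x @[x --> +oo] --> (0 : R).
Proof.
rewrite -[X in _ `=>` nbhs X](addr0 0); apply: cvgD.
  pose B := cst1 * L (fun t => t * 1) (z_ 1).
  have pg : poly_growth (fun t => t * 1 : R) by apply: poly_growthM; exact: poly_growth1.
  apply: (@cvg0_le_inv _ _ (B * (2 * s))) => x x1; have x0 : 0 < x by exact: lt_le_trans x1.
  have L0x y : 0 < y -> 0 < L (fun t => t * 1) (z_ y).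
    by move=> y0; apply: laplace_gt0 => //; [exact: z_gt0|move=> t t0; rewrite mulr1].
  (* The Laplace integral decreases in its parameter, so beyond [x = 1] the decay is that of the
     Gaussian factor. *)
  have LB : L (fun t => t * 1) (z_ x) <= L (fun t => t * 1) (z_ 1).
    apply: (@nonincreasing_derive_le0 _ (L (fun t => t * 1)) (fun z => - L (fun t => t * (t * 1)) z)).
    - by rewrite ler_pM2r ?invr_gt0 ?mulr_gt0// lerXn2r ?nnegrE// ltW.
    - by apply: has_deriv_cont; apply: has_deriv_laplace => //; exact: z_gt0.
    - move=> y /(lt_trans (z_gt0 ltr01)) y0; exact: has_deriv_laplace.
    - move=> y /(lt_trans (z_gt0 ltr01)) y0; rewrite oppr_le0 ltW//.
      by apply: laplace_gt0 => //; [exact: poly_growthM|move=> t t0; rewrite mulr1 mulr_gt0].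
  have -> : s * gauss_weight s x * V1 x = - (cst1 * L (fun t => t * 1) (z_ x) * (gauss_weight s x * x)).
    by rewrite /V1; field; rewrite gt_eqF.
  rewrite normrN gtr0_norm; last first.
    by apply: mulr_gt0; [rewrite mulr_gt0 ?L0x|rewrite mulr_gt0 ?gauss_weight_gt0].
  rewrite -[leRHS]mulrA; apply: ler_pM.
  - by rewrite ltW// mulr_gt0 ?L0x.
  - by apply: mulr_ge0; [exact: expR_ge0|exact: ltW].
  - by rewrite ler_pM2l.
  - have -> : 2 * s / x = 2 * s / x ^+ 2 * x by field; rewrite gt_eqF.
    by rewrite ler_pM2r//; exact: gauss_weight_le_inv.
rewrite -[X in _ `=>` nbhs X](mulr0 (2 * s - 2)); apply: cvgM; first exact: cvg_cst.
rewrite -[X in _ `=>` nbhs X](subrr 1); apply: cvgB; first exact: cvg_cst.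
apply: cvg_primitive_open; [exact: Vphi_cont| |exact: integral_V].
by move=> x; rewrite mulr_ge0// ltW ?V_gt0// gauss_weight_gt0.
Qed.

Lemma density_factor_gt1 : exists V, density_factor s V.
Proof.
exists V; split; [exact: V_cont|exact: V_gt0|exact: V_kappa|exact: integral_V|].
move=> x x0; have sn : s != 0 by rewrite gt_eqF.
have flux0 : flux x = 0.
  apply: (cvg_unique _ (F := flux y @[y --> +oo])) cvg_flux => //.
  apply: (@cvg_pinfty_eq _ (fun=> flux x)); last exact: cvg_cst.
  by move=> y y0; apply: const_has_deriv0 => // z z0; exact: flux_deriv.
apply: (has_deriv_eq (V_deriv x0)).
have pn : gauss_weight s x != 0 by rewrite gt_eqF ?gauss_weight_gt0.
move: flux0; rewrite /flux; set p := primitive _ _ => flux0.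
have E : (2 * s - 2) * (1 - p) = - (s * gauss_weight s x * V1 x) by lra.
transitivity (- ((2 * s - 2) * (1 - p)) / (s * gauss_weight s x)).
  by rewrite E opprK [s * _ * _]mulrC mulfK// mulf_neq0.
by move: (gauss_weight s x) pn => g gn; field; rewrite ?gn ?sn.
Qed.

End density.

Lemma exists_density_factor {R : realType} (s : R) : 1 <= s -> exists V, density_factor s V.
Proof.
rewrite le_eqVlt => /orP[/eqP/esym s1|]; last exact: density_factor_gt1.
by exists (fun=> Num.sqrt (2 / pi)); exact: density_factor1.
Qed.

Lemma kappa_half {R : realType} (x : R) : 0 < x -> kappa 2^-1 x = 2 * x * expR (- x ^+ 2).
Proof.
move=> x0; rewrite /kappa Gamma_half (_ : 2 * 2^-1 = 1 :> R); last by field.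
rewrite !divr1 (_ : 2^-1 - 1 = - 2^-1 :> R); last by lra.
rewrite kummerU_Nhalf ?exprn_gt0// powR12_sqrt ?sqr_ge0// sqrtr_sqr gtr0_norm//.
have -> : 2 / (2^-1 * pi) = 2 ^+ 2 / pi :> R.
  have pn : pi != 0 :> R by rewrite gt_eqF// pi_gt0.
  by move: (pi : R) pn => p pn; field.
have qn : Num.sqrt pi != 0 :> R by rewrite gt_eqF// sqrtr_gt0 pi_gt0.
rewrite sqrtrM ?sqr_ge0// sqrtr_sqr gtr0_norm// sqrtrV ?pi_ge0//.
by move: (Num.sqrt (pi : R)) qn => q qn; field.
Qed.

(** * The s-TDSB identity *)

Section laws_and_densities.
Context {R : realType}.
Notation mu := (@lebesgue_measure R).
Local Open Scope ereal_scope.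

Lemma same_law_integral d1 d2 d (T1 : measurableType d1) (T2 : measurableType d2)
    (T : measurableType d) (P1 : probability T1 R) (P2 : probability T2 R)
    (X : {RV P1 >-> T}) (Y : {RV P2 >-> T}) (f : T -> \bar R) :
  same_law (distribution P1 X) (distribution P2 Y) ->
  measurable_fun setT f -> (forall x, 0 <= f x) ->
  \int[P1]_w f (X w) = \int[P2]_w f (Y w).
Proof.
move=> XY mf f0.
rewrite -[LHS](ge0_integral_distribution X mf f0) -[RHS](ge0_integral_distribution Y mf f0).
by apply: eq_measure_integral => A mA _; exact: XY.
Qed.

(** Open rays generate the Borel sets and are stable under intersection. *)
Lemma probability_eq_rays (P Q : probability (measurableTypeR R) R) :
  (forall x, P `]-oo, x[%classic = Q `]-oo, x[%classic) -> same_law P Q.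
Proof.
move=> PQ A mA; apply: (@measure_unique _ R (measurableTypeR R) (@RGenInftyO.G R)
  (fun n => `]-oo, n%:R%R[%classic : set (measurableTypeR R)) _ _ _ _ P Q _ _ A mA) => //.
- exact: RGenInftyO.measurableE.
- move=> _ _ [x ->] [y ->]; exists (Num.min x y); apply/seteqP; split => z /=; rewrite !in_itv/= lt_min.
    by move=> [-> ->].
  by move=> /andP[].
- by move=> n; eexists.
- rewrite -subTset => x _; exists (Num.truncn `|x|).+1 => //=; rewrite in_itv/=.
  exact: le_lt_trans (ler_norm x) (truncnS_gt _).
- by move=> _ [x ->]; exact: PQ.
- by move=> n; exact: (le_lt_trans (probability_le1 P _) (ltry 1)).
Qed.

Section density.
Variable g : R -> R.
Hypothesis mg : measurable_fun [set: R] g.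
Hypothesis g0 : forall x, (0 <= g x)%R.
Hypothesis g1 : \int[mu]_x (g x)%:E = 1.

(** The proofs are arguments of the definition so that the measure and probability structures can be
    attached to this very term. *)
Definition density_prob of measurable_fun [set: R] g & (forall x, 0 <= g x)%R & \int[mu]_x (g x)%:E = 1
  : set (measurableTypeR R) -> \bar R := fun A => \int[mu]_(x in A) (g x)%:E.

Let nu := density_prob mg g0 g1.

Let nu0 : nu set0 = 0.
Proof. by rewrite /nu /density_prob integral_set0. Qed.

Let nu_ge0 A : 0 <= nu A.
Proof. by apply: integral_ge0 => x _; rewrite lee_fin. Qed.

Let mgE : measurable_fun [set: R] (EFin \o g).
Proof. exact/measurable_EFinP. Qed.

Let nu_sigma_additive : semi_sigma_additive nu.
Proof.
move=> F mF tF mUF; rewrite /nu /density_prob; apply: cvg_toP.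
  apply: ereal_nondecreasing_is_cvgn => m n mn; apply: lee_sum_nneg_natr => // k _ _.
  exact: nu_ge0.
rewrite ge0_integral_bigcup//=; first exact: measurable_funTS.
by move=> x _; rewrite lee_fin.
Qed.

HB.instance Definition _ := isMeasure.Build _ _ _ (density_prob mg g0 g1) nu0 nu_ge0 nu_sigma_additive.

Let nu_setT : nu [set: _] = 1%:E. Proof. exact: g1. Qed.

HB.instance Definition _ := @Measure_isProbability.Build _ _ R (density_prob mg g0 g1) nu_setT.

Let nu_dom : density_prob mg g0 g1 `<< mu.
Proof.
apply/null_content_dominatesP => A mA muA0; rewrite /nu /density_prob.
by rewrite null_set_integral//; exact: measurable_funTS.
Qed.

(** The Radon-Nikodym density of this measure has the same integrals as [g] over all measurable
    sets, hence equals [g] almost everywhere; its change of variables formula is transferred to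
    [g]. *)
Lemma ge0_integral_density_prob (f : R -> \bar R) : measurable_fun setT f -> (forall x, 0 <= f x) ->
  \int[density_prob mg g0 g1]_x f x = \int[mu]_x (f x * (g x)%:E).
Proof.
move=> mf f0.
rewrite -(Radon_Nikodym_SigmaFinite.change_of_variables nu_dom)//.
apply: ae_eq_integral => //.
- apply: emeasurable_funM => //.
  exact: measurable_int (Radon_Nikodym_SigmaFinite.f_integrable nu_dom).
- exact: emeasurable_funM.
- apply: ae_eqe_mul2l; apply: integral_ae_eq => //.
    exact: Radon_Nikodym_SigmaFinite.f_integrable.
  by move=> E _ mE; rewrite -(Radon_Nikodym_SigmaFinite.f_integral nu_dom).
Qed.
End density.

(** Independence determines the joint law on rectangles, so it is the product of the marginals, and
    Tonelli integrates [X] first. *)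
Lemma independent2_integral d d1 d2 (T : measurableType d) (T1 : measurableType d1)
    (T2 : measurableType d2) (P : probability T R)
    (X : {RV P >-> T1}) (Y : {RV P >-> T2}) (f : T1 -> T2 -> R) :
  independent2 P X Y -> measurable_fun setT (fun p : T1 * T2 => f p.1 p.2) ->
  (forall x y, (0 <= f x y)%R) ->
  \int[P]_w (f (X w) (Y w))%:E = \int[P]_w \int[distribution P X]_x (f x (Y w))%:E.
Proof.
move=> XY mf f0.
have mZ : measurable_fun setT (fun w => (X w, Y w) : T1 * T2) by exact: measurable_fun_pair.
pose Z : {RV P >-> (T1 * T2)%type} := mfun_Sub (mem_set mZ).
have mF : measurable_fun setT (fun p : T1 * T2 => (f p.1 p.2)%:E) by exact/measurable_EFinP.
transitivity (\int[distribution P Z]_p (f p.1 p.2)%:E).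
  by rewrite ge0_integral_distribution// => p; rewrite lee_fin.
transitivity (\int[distribution P X \x distribution P Y]_p (f p.1 p.2)%:E).
  apply/esym; apply: eq_measure_integral => A mA _.
  apply: product_measure_unique => // B C mB mC.
rewrite fubini_tonelli2//; last by move=> p; rewrite lee_fin.
rewrite /fubini_G/= ge0_integral_distribution//.
- apply: (@measurable_fun_fubini_tonelli_G _ _ _ _ _ (distribution P X) (fun p => (f p.1 p.2)%:E)) => //.
  by move=> p; rewrite lee_fin.
- by move=> y; apply: integral_ge0 => x _; rewrite lee_fin.
Qed.

Section tdsb_factor.
Variables (s : R) (hs : (2^-1 <= s)%R).
Variables (d : measure_display) (T : measurableType d) (P : probability T R).
Variables (U1 U2 : {RV P >-> R}) (Y : {RV P >-> bool}).
Hypothesis lawU1 : same_law (distribution P U1) (uniform_prob (@ltr01 R)).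
Hypothesis lawU2 : same_law (distribution P U2) (uniform_prob (@ltr01 R)).
Hypothesis lawY : same_law (distribution P Y) (bernoulli_prob (2 * s)^-1).
Hypothesis ind : independent3 P U1 U2 Y.

Lemma measurable_V_of : measurable_fun setT (V_of Y U1 U2).
Proof.
have mY : measurable_fun setT (fun w => (Y w)%:R : R).
  exact: (@measurableT_comp _ _ _ _ _ _ (fun b : bool => b%:R : R)).
apply: measurable_funD; apply: measurable_funM => //.
- exact: measurable_maxr.
- exact: measurable_funB.
- exact: measurable_minr.
Qed.

Definition clamp01 (x : R) : R := Num.min 1%R (Num.max 0%R x).

Lemma integral_ray01 (f g : R -> R) (x : R) : continuous f -> continuous g ->
  (forall v, (0 < v)%R -> has_deriv g v (f v)) ->
  \int[mu]_(v in `]-oo, x[%classic `&` `[0%R, 1%R]) (f v)%:E = (g (clamp01 x) - g 0)%:E.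
Proof.
move=> cf cg gf.
have ftc c : (0 <= c)%R -> \int[mu]_(v in `[0%R, c]) (f v)%:E = (g c - g 0)%:E.
  move=> c0; rewrite -(@FTC_integral _ f g 0%R c)//.
    rewrite /Rintegral fineK//; apply: integrable_fin_num => //; exact: continuous_integrable_itv.
  - by move=> v _; exact: cf.
  - exact: cg.
rewrite /clamp01; have [x0|x0] := leP x 0%R.
  rewrite (_ : _ `&` _ = set0) ?integral_set0 ?min_r ?subrr//.
  apply/seteqP; split => v //=; rewrite !in_itv/= => -[vx /andP[v0 _]].
  by have := lt_le_trans vx x0; rewrite ltNge v0.
have [x1|x1] := leP x 1%R.
  rewrite -ftc ?ltW// -integral_itv_bndo_bndc; last first.
    by apply: measurable_funTS; apply/measurable_EFinP; exact: continuous_measurable_fun.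
  congr (integral _ _ _); apply/seteqP; split => v /=; rewrite !in_itv/=.
    by move=> [-> /andP[-> _]].
  by move=> /andP[v0 vx]; rewrite vx v0/= (le_trans (ltW vx)).
rewrite -ftc//; congr (integral _ _ _); apply/seteqP; split => v /=; rewrite !in_itv/=.
  by move=> [].
by move=> /andP[v0 v1]; rewrite v0 v1 (le_lt_trans v1).
Qed.

Lemma uniform_prob_ray (x : R) : uniform_prob (@ltr01 R) `]-oo, x[%classic = (clamp01 x)%:E.
Proof.
rewrite /uniform_prob integral_uniform_pdf -[X in X%:E]subr0.
rewrite -(@integral_ray01 (fun=> 1%R) (fun v => v)).
- apply: eq_integral => v; rewrite inE/= in_itv/= => -[_ v01].
  by rewrite /uniform_pdf; move: v01; rewrite in_itv/= => ->; rewrite subr0 invr1.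
- by move=> v; exact: cvg_cst.
- by move=> v; exact: cvg_id.
- by move=> v _; exact: has_deriv_id.
Qed.

Definition tdsb_density (v : R) : R := (((1 + (2 * s - 2) * (1 - v)) / s) * \1_(`[0%R, 1%R]%classic) v)%R.

Let q : R := ((2 * s)^-1)%R.
Let s0 : (0 < s)%R. Proof. by apply: lt_le_trans hs; rewrite invr_gt0. Qed.
Let q01 : (0 <= q <= 1)%R.
Proof.
have q0 : (0 < 2 * s)%R by rewrite mulr_gt0.
rewrite /q invr_ge0 (ltW q0)/= invf_le1//.
by move: hs; rewrite -(ler_pM2l (@ltr0Sn R 1)) divff.
Qed.

Lemma probability_Y_true : P (Y @^-1` [set true]) = q%:E.
Proof.
rewrite [LHS]lawY// /bernoulli_prob -/q q01.
by rewrite fsbig_set1.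
Qed.

Lemma probability_Y_false : P (Y @^-1` [set false]) = (1 - q)%:E.
Proof.
rewrite (_ : _ @^-1` _ = ~` (Y @^-1` [set true])).
  rewrite probability_setC ?probability_Y_true//.
  exact: measurable_funPTI.
by apply/seteqP; split => w /=; case: (Y w).
Qed.

Lemma V_of_ray (x : R) : let c := clamp01 x in
  P (V_of Y U1 U2 @^-1` `]-oo, x[%classic) = (q * c ^+ 2 + (1 - q) * (c + (1 - c) * c))%:E.
Proof.
move=> c; pose I : set (measurableTypeR R) := `]-oo, x[%classic.
have mI : measurable I by exact: measurable_itv.
have IE v : I v = (v < x)%R by rewrite /I/= in_itv.
have PU1 : P (U1 @^-1` I) = c%:E by rewrite [LHS]lawU1// uniform_prob_ray.
have PU2 : P (U2 @^-1` I) = c%:E by rewrite [LHS]lawU2// uniform_prob_ray.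
have PU1C : P (U1 @^-1` (~` I)) = (1 - c)%:E.
  rewrite preimage_setC probability_setC ?PU1//.
  exact: (measurable_funPTI U1 mI).
pose A b (J K : set R) := U1 @^-1` J `&` U2 @^-1` K `&` Y @^-1` [set b].
have mA b J K : measurable J -> measurable K -> measurable (A b J K).
  move=> mJ mK; apply: measurableI; first apply: measurableI.
  - exact: measurable_funPTI.
  - exact: measurable_funPTI.
  - exact: measurable_funPTI.
have mIC : measurable (~` I) by exact: measurableC.
(* For [Y = false] the minimum is below [x] either because [U1] is, or because [U2] is while [U1] is
   not; this splitting keeps the events disjoint. *)
rewrite (_ : _ @^-1` _ = A true I I `|` (A false I setT `|` A false (~` I) I)); last first.
  apply/seteqP; split => w; rewrite /A /= /V_of !in_itv/=; case: (Y w) => /=.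
  - by rewrite mul1r subrr mul0r addr0 gt_max => /andP[? ?]; left.
  - rewrite mul0r subr0 mul1r add0r gt_min; case: (ltP (U1 w) x) => [?|xU].
      by move=> _; right; left.
    by move=> /= ?; right; right; split => //; split => //; apply/negP; rewrite -leNgt.
  - by rewrite mul1r subrr mul0r addr0 gt_max !IE => -[[[-> ->]]//|[[_//]|[_//]]].
  - rewrite mul0r subr0 mul1r add0r gt_min !IE => -[[]//|[[[-> _]//]|[[_ ->]]]].
    by rewrite orbT.
rewrite measureU; [|exact: mA|by apply: measurableU; exact: mA|]; last first.
  apply/seteqP; split => w //=; rewrite /A/= => -[[_ Yw]].
  by move=> [[_]|[_]]; rewrite Yw.
rewrite (@measureU _ _ _ _ (A false I setT)); [|exact: mA|exact: mA|]; last first.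
  by apply/seteqP; split => w //=; rewrite /A/= => -[[[UI _] _] [[]]].
have PA b J K : measurable J -> measurable K ->
    P (A b J K) = P (U1 @^-1` J) * P (U2 @^-1` K) * P (Y @^-1` [set b]).
  by move=> mJ mK; exact: ind.
rewrite -[LHS]/(P (A true I I) + (P (A false I setT) + P (A false (~` I) I))) !PA// PU1 PU2 PU1C probability_Y_true probability_Y_false preimage_setT probability_setT.
rewrite mule1 -!EFinM -!EFinD; congr EFin; ring.
Qed.

Lemma tdsb_density_ge0 v : (0 <= tdsb_density v)%R.
Proof.
rewrite /tdsb_density indicE; have [|_] := boolP (v \in _); last by rewrite mulr0.
rewrite inE/= in_itv/= mulr1 => /andP[v0 v1].
by rewrite divr_ge0 ?(ltW s0)//; move: hs; nra.
Qed.

Lemma measurable_tdsb_density : measurable_fun [set: R] tdsb_density.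
Proof.
apply: measurable_funM; last exact: measurable_indic.
by apply: continuous_measurable_fun => v; apply: (_ : cont_at _ v); cont.
Qed.

(** The distribution function of [V] on [[0, 1]]: for [q = 1 / (2 s)] the quadratic polynomial of
    [V_of_ray] simplifies to it. *)
Let G (v : R) := ((v + (2 * s - 2) * (v - v ^+ 2 / 2)) / s)%R.

Lemma integral_tdsb_density_ray (x : R) :
  \int[mu]_(v in `]-oo, x[) (tdsb_density v)%:E = (G (clamp01 x))%:E.
Proof.
rewrite -[G _]subr0 (_ : 0 = G 0)%R; last by rewrite /G; ring.
rewrite -(@integral_ray01 (fun v => (1 + (2 * s - 2) * (1 - v)) / s)%R G).
- rewrite integral_mkcondr; apply: eq_integral => v _.
  rewrite patchE /tdsb_density indicE; case: ifP => _; by rewrite ?mulr1 ?mulr0.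
- by move=> v; apply: (_ : cont_at _ v); cont.
- by move=> v; apply: (_ : cont_at _ v); rewrite /G; cont.
- by move=> v _; rewrite /G; deriv => //=; field; rewrite gt_eqF.
Qed.

Lemma integral_tdsb_density : \int[mu]_v (tdsb_density v)%:E = 1.
Proof.
transitivity (\int[mu]_(v in `]-oo, 2%R[) (tdsb_density v)%:E).
  rewrite [RHS]integral_mkcond; apply: eq_integral => v _; rewrite patchE.
  case: ifPn => //; rewrite notin_setE/= in_itv/= => /negP; rewrite -leNgt => v2.
  rewrite /tdsb_density indicE memNset ?mulr0//= in_itv/= => /andP[_]; rewrite leNgt.
  by rewrite (lt_le_trans _ v2)// ltr1n.
rewrite integral_tdsb_density_ray /clamp01 max_r// min_l ?ler1n// /G.
by congr EFin; field; rewrite gt_eqF.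
Qed.

(* The canonical sigma-algebra of [R] and that of [measurableTypeR R], on which [lebesgue_measure]
   lives, have different displays, so that integrals over the two types are not convertible. *)
Lemma measurableR_V_of : measurable_fun setT (V_of Y U1 U2 : T -> measurableTypeR R).
Proof. exact: measurable_V_of. Qed.

Definition tdsb_factor : {RV P >-> measurableTypeR R} :=
  @mfun_Sub _ _ T (measurableTypeR R) (V_of Y U1 U2) (mem_set measurableR_V_of).

Lemma law_V_of : same_law (distribution P tdsb_factor)
  (density_prob measurable_tdsb_density tdsb_density_ge0 integral_tdsb_density).
Proof.
refine (@probability_eq_rays (distribution P tdsb_factor)
  (density_prob measurable_tdsb_density tdsb_density_ge0 integral_tdsb_density) _) => x.
transitivity ((G (clamp01 x))%:E); last by rewrite -integral_tdsb_density_ray.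
transitivity (P (V_of Y U1 U2 @^-1` `]-oo, x[%classic)) => //.
have sn : s != 0%R by rewrite gt_eqF.
by rewrite V_of_ray /G /q; congr EFin; field; rewrite ?sn.
Qed.

(** The conditional expectation of [M (V W'')] given [W'' = y]. *)
Definition tdsb_average (M : R -> R) (y : R) : R :=
  (\int[mu]_(v in `[0, 1]) (M (v * y) * ((1 + (2 * s - 2) * (1 - v)) / s)))%R.

Lemma integral_tdsb_average (M : R -> R) (y : R) : continuous M ->
  (forall x, (0 <= M x)%R) ->
  \int[distribution P tdsb_factor]_v (M (v * y)%R)%:E = (tdsb_average M y)%:E.
Proof.
move=> cM M0.
transitivity (\int[density_prob measurable_tdsb_density tdsb_density_ge0 integral_tdsb_density]_v (M (v * y)%R)%:E).
  apply: eq_measure_integral => A mA _.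
  exact: law_V_of.
have cMy : continuous (fun v : R => M (v * y)%R).
  move=> v; apply: (@cont_at_comp _ M (fun v => v * y)%R); last exact: cM.
  by apply: (_ : cont_at _ v); cont.
have cI : continuous (fun v : R => M (v * y) * ((1 + (2 * s - 2) * (1 - v)) / s))%R.
  by move=> v; apply: (_ : cont_at _ v); have ct : cont_at _ v := cMy v; cont.
rewrite ge0_integral_density_prob; last 2 first.
- by apply/measurable_EFinP; exact: continuous_measurable_fun.
- by move=> v; rewrite lee_fin.
rewrite /tdsb_average /Rintegral fineK; last first.
  by apply: integrable_fin_num => //; exact: continuous_integrable_itv.
rewrite [RHS]integral_mkcond; apply: eq_integral => v _.
by rewrite patchE /tdsb_density indicE -EFinM; case: ifP => _; rewrite ?mulr1 ?mulr0.
Qed.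

(** The substitution [t = v y], carried out on antiderivatives. The factor [y ^ 2] is the one that
    double size biasing provides. *)
Lemma tdsb_average_primitive (M : R -> R) (y : R) : continuous M -> (0 <= y)%R ->
  (y ^+ 2 * tdsb_average M y = primitive (fun t => (y + (2 * s - 2) * (y - t)) * M t) y / s)%R.
Proof.
move=> cM; rewrite le_eqVlt => /orP[/eqP <-|y0]; first by rewrite expr0n mul0r primitive_le0 ?mul0r.
set N : R -> R := (X in primitive X).
have cN : continuous N by move=> v; apply: (_ : cont_at _ v); rewrite /N; have ct : cont_at M v := cM v; cont.
have cI : continuous (fun v : R => M (v * y) * ((1 + (2 * s - 2) * (1 - v)) / s))%R.
  move=> v; have cMy : cont_at (fun v => M (v * y)%R) v.
    by apply: cont_at_comp; [cont|exact: cM].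
  by apply: (_ : cont_at _ v); cont.
have cp : cont_at (fun v => primitive N (v * y) / s / y ^+ 2)%R 0%R.
  have cp' : cont_at (fun v => primitive N (v * y))%R 0%R.
    by apply: (cont_at_comp (f := fun v => v * y)%R); [cont|exact: cont_primitive].
  by cont.
rewrite /tdsb_average (@FTC_integral _ _ (fun v => primitive N (v * y) / s / y ^+ 2)%R)//.
- by rewrite mul1r mul0r (@primitive_le0 _ _ 0%R)// !mul0r subr0 mulrC divfK// expf_neq0// gt_eqF.
- by move=> v _; exact: cI.
- move=> v v0; have dp : has_deriv (fun v => primitive N (v * y)) v (N (v * y) * y)%R.
    apply: has_deriv_comp; first by apply: has_deriv_primitive => //; rewrite mulr_gt0.
    by deriv => //=; ring.
  by deriv => //=; rewrite /N; field; rewrite !gt_eqF.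
Qed.

End tdsb_factor.

Section tdsb_identity.
Variables (s : R) (hs : (2^-1 <= s)%R).
Variables (d0 d1 : measure_display) (T0 : measurableType d0) (T1 : measurableType d1).
Variables (P : probability T0 R) (P1 : probability T1 R).
Variables (W : {RV P >-> R}) (Wstar : {RV P1 >-> R}).
Hypothesis W0 : forall w, (0 <= W w)%R.
Hypothesis EW2 : 'E_P[fun w => (W w ^+ 2)%R] = 1.
Hypothesis hW : TDSB s W Wstar.

(** Nonnegativity of [M] gives access to Tonelli, and boundedness makes [tdsb_average s M] an
    admissible test function for the double size bias. *)
Lemma TDSB_integral (M : R -> R) (B : R) : continuous M -> (forall x, 0 <= M x <= B)%R ->
  \int[P1]_w (M (Wstar w))%:E =
  \int[P]_w (primitive (fun t => (W w + (2 * s - 2) * (W w - t)) * M t) (W w) / s)%:E.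
Proof.
move=> cM MB; have M0 x : (0 <= M x)%R by have /andP[] := MB x.
have [d' [T' [P' [U1 [U2 [Y [W2 [lU1 [lU2 [lY [ind [dsb [ind2 lW]]]]]]]]]]]]] := hW.
pose V := tdsb_factor U1 U2 Y.
have mVW : measurable_fun setT (fun w => V_of Y U1 U2 w * W2 w)%R.
  by apply: measurable_funM => //; exact: measurable_V_of.
pose VW : {RV P' >-> R} := mfun_Sub (mem_set mVW).
have mM : measurable_fun setT M by exact: continuous_measurable_fun.
rewrite (@same_law_integral _ _ _ _ _ _ _ _ Wstar VW (EFin \o M)); last 3 first.
- exact: lW.
- exact/measurable_EFinP.
- by move=> x; rewrite lee_fin.
have mMp : measurable_fun setT (fun p : measurableTypeR R * R => M (p.1 * p.2)%R).
  by apply: (measurableT_comp mM); exact: measurable_funM.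
transitivity (\int[P']_w (tdsb_average s M (W2 w))%:E).
  rewrite (@independent2_integral _ _ _ _ _ _ P' V W2 (fun v y => M (v * y)%R))//.
  by apply: eq_integral => w _; apply: integral_tdsb_average.
have mA : measurable_fun setT (tdsb_average s M).
  have mF : measurable_fun setT (fun p : measurableTypeR R * R => ((M (p.1 * p.2))%:E)) by exact/measurable_EFinP.
  (* Measurability is inherited from the partial integrals in Tonelli's theorem. *)
  rewrite (_ : tdsb_average s M = fine \o fubini_G (distribution P' V) (fun p : measurableTypeR R * R => ((M (p.1 * p.2))%:E))).
    apply: measurableT_comp => //; apply: measurable_fun_fubini_tonelli_G => //.
    by move=> p; rewrite lee_fin.
  by apply/funext => y; rewrite /fubini_G/= (integral_tdsb_average hs lU1 lU2 lY ind).
have AE y : \int[distribution P' V]_v (M (v * y)%R)%:E = (tdsb_average s M y)%:E.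
  exact: (integral_tdsb_average hs lU1 lU2 lY ind).
have AB y : (0 <= tdsb_average s M y <= B)%R.
  rewrite -!lee_fin -AE integral_ge0/=; last by move=> v _; rewrite lee_fin.
  apply: (@le_trans _ _ (\int[distribution P' V]_v B%:E)).
    apply: ge0_le_integral => //.
    - by move=> v _; rewrite lee_fin.
    - by apply/measurable_EFinP; apply: (measurableT_comp mM); exact: measurable_funM.
    - by move=> v _; rewrite lee_fin; have /andP[] := MB (v * y)%R.
  by rewrite integral_cst// [X in (_ * X)%E](@probability_setT _ _ _ (distribution P' V)) mule1.
have iW2 : P.-integrable setT (fun w => (W w ^+ 2 * tdsb_average s M (W w))%:E).
  apply: (@le_integrable _ _ _ P _ measurableT _ (fun w => (B * W w ^+ 2)%:E)).
  - apply/measurable_EFinP; apply: measurable_funM; first exact: measurable_funX.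
    exact: (measurableT_comp mA).
  - move=> w _; rewrite !abse_EFin lee_fin; have /andP[A0 A1] := AB (W w).
    rewrite !ger0_norm ?mulr_ge0 ?sqr_ge0// ?(le_trans A0)//.
    by rewrite mulrC ler_wpM2r ?sqr_ge0.
  - under eq_fun do rewrite EFinM; apply: integrableZl => //.
    apply/integrableP; split; first by apply/measurable_EFinP; exact: measurable_funX.
    under eq_integral do rewrite abse_EFin ger0_norm ?sqr_ge0//.
    by move: EW2; rewrite unlock => ->; rewrite ltry.
have := dsb _ mA iW2; rewrite EW2 mul1e unlock => <-.
by apply: eq_integral => w _; rewrite tdsb_average_primitive.
Qed.

End tdsb_identity.
End laws_and_densities.

(** * Lipschitz functions and their derivatives *)

Lemma lipschitz_bound_continuous {R : realType} (h : R -> R) (L : R) : 0 < L ->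
  (forall x y, `|h x - h y| <= L * `|x - y|) -> continuous h.
Proof.
move=> L0 hL x; apply/cvgrPdist_le => e e0; near=> y.
apply: (le_trans (hL _ _)); rewrite mulrC -ler_pdivlMr//.
near: y; apply: cvgr_dist_le; first exact: cvg_id.
exact: divr_gt0.
Unshelve. all: by end_near. Qed.

Section lipschitz_derivative.
Context {R : realType}.
Notation mu := (@lebesgue_measure R).
Variables (h : R -> R) (L a b : R).
Hypotheses (L0 : 0 < L) (hL : forall x y, `|h x - h y| <= L * `|x - y|) (ab : a < b).

Let cl (x : R) : R := Num.max a (Num.min b x).
(** Adding [L + 1] times the identity makes [h] strictly increasing; [Z] is the increment of the sum
    over [[a, b]], by which [g] is normalised to a distribution function. *)
Let Z := (L + 1) * (b - a) + (h b - h a).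

Let hL' x y : x <= y -> - (L * (y - x)) <= h y - h x <= L * (y - x).
Proof. by move=> xy; rewrite -ler_norml (le_trans (hL _ _))// ger0_norm// subr_ge0. Qed.

Let Z0 : 0 < Z.
Proof.
have /andP[h1 _] := hL' (ltW ab); have : 0 < b - a by rewrite subr_gt0.
by move: h1; rewrite /Z; lra.
Qed.

Let cl_lt x : x <= a -> cl x = a.
Proof. by move=> xa; rewrite /cl; case: (leP b x) => bx; [move: ab; lra|rewrite max_l]. Qed.
Let cl_gt x : b <= x -> cl x = b.
Proof. by move=> bx; rewrite /cl min_l// max_r// ltW. Qed.
Let cl_id x : a <= x -> x <= b -> cl x = x.
Proof. by move=> ax xb; rewrite /cl min_r// max_r. Qed.

Let cl_le x y : x <= y -> 0 <= cl y - cl x <= y - x.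
Proof.
move=> xy; have [xa|/ltW ax] := leP x a.
  rewrite (cl_lt xa); have [ya|/ltW ay] := leP y a; first by rewrite (cl_lt ya); lra.
  have [yb|/ltW yb] := leP y b; first by rewrite cl_id//; lra.
  by rewrite cl_gt//; move: (ltW ab); lra.
have ay := le_trans ax xy; have [yb|/ltW yb] := leP y b.
  by rewrite !cl_id ?(le_trans xy)//; lra.
have [xb|/ltW xb] := leP x b; first by rewrite cl_gt// cl_id//; lra.
by rewrite !cl_gt//; lra.
Qed.

(* The Stieltjes measure of [g] is absolutely continuous, and its Radon-Nikodym density is almost
   everywhere the derivative of [g]; so [h] is differentiable almost everywhere and is the integral of
   its derivative. *)
Let g (x : R) := ((L + 1) * (cl x - a) + (h (cl x) - h a)) / Z.
Let K := (2 * L + 1) / Z.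
Let K0 : 0 < K. Proof. by rewrite divr_gt0//; move: L0; lra. Qed.

Let g_le x y : x <= y -> 0 <= g y - g x <= K * (y - x).
Proof.
move=> xy; have /andP[c0 c1] := cl_le xy.
have cxy : cl x <= cl y by rewrite -subr_ge0.
have /andP[h1 h2] := hL' cxy.
have -> : g y - g x = ((L + 1) * (cl y - cl x) + (h (cl y) - h (cl x))) / Z.
  by rewrite /g -mulrBl; congr (_ / _); ring.
rewrite /K mulrAC ler_pM2r ?invr_gt0// divr_ge0 ?(ltW Z0)//=; last by move: h1; lra.
have : (2 * L + 1) * (cl y - cl x) <= (2 * L + 1) * (y - x) by rewrite ler_pM2l//; move: L0; lra.
by move: h2; lra.
Qed.

Let g_nd : nondecreasing g.
Proof. by move=> x y xy; have /andP[] := g_le xy; rewrite subr_ge0. Qed.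

Let g_cont : continuous g.
Proof.
apply: (lipschitz_bound_continuous K0) => x y.
have [xy|/ltW yx] := leP x y.
  by have /andP[? ?] := g_le xy; rewrite distrC ger0_norm// distrC ger0_norm// subr_ge0.
by have /andP[? ?] := g_le yx; rewrite !ger0_norm// subr_ge0.
Qed.

Let g_rc : right_continuous g.
Proof. by move=> x; apply: cvg_at_right_filter; exact: g_cont. Qed.

#[local] HB.instance Definition _ := isCumulative.Build R _ R g g_nd g_rc.

Let g_le_a x : x <= a -> g x = 0.
Proof. by move=> xa; rewrite /g cl_lt// !subrr mulr0 addr0 mul0r. Qed.
Let g_ge_b x : b <= x -> g x = 1.
Proof. by move=> bx; rewrite /g cl_gt// divff// gt_eqF. Qed.

Let g_Ny : g @ -oo --> (0 : R).
Proof.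
by apply: cvg_near_cst; near=> x; apply: g_le_a; near: x; apply: nbhs_ninfty_le; rewrite num_real.
Unshelve. all: by end_near. Qed.
Let g_y : g @ +oo --> (1 : R).
Proof.
by apply: cvg_near_cst; near=> x; apply: g_ge_b; near: x; apply: nbhs_pinfty_ge; rewrite num_real.
Unshelve. all: by end_near. Qed.

#[local] HB.instance Definition _ := isCumulativeBounded.Build R 0 1 g g_Ny g_y.

Let nu := lebesgue_stieltjes_measure g.

Let nu_itv x y : x <= y -> nu `]x, y]%classic = (g y - g x)%:E.
Proof.
move=> xy; rewrite /nu /lebesgue_stieltjes_measure /measure_extension measurable_mu_extE/=; last exact: is_ocitv.
by rewrite wlength_itv_bnd.
Qed.

(** A null set has covers by half-open intervals of arbitrarily small total length, and on each
    interval [nu] is at most [K] times the length. *)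
Let nu_dom : nu `<< mu.
Proof.
apply/null_content_dominatesP => A mA muA0.
apply/eqP; rewrite eq_le measure_ge0 andbT; apply/lee_addgt0Pr => e e0; rewrite add0e.
have : (mu A < (e / K)%:E)%E by rewrite [mu A]muA0 lte_fin divr_gt0.
move=> /ereal_inf_lt[_ [F [mF AF] <-]] Fe.
apply: (@le_trans _ _ (\sum_(0 <= i <oo) wlength g (F i)))%E.
  by apply: ereal_inf_lbound; exists F.
apply: (@le_trans _ _ (\sum_(0 <= i <oo) (K%:E * wlength idfun (F i))))%E.
  apply: lee_nneseries => [i _ _|i _].
    exact: (@wlength_ge0 R g).
  have [[x y] _ <-] := mF i; have [xy|yx] := leP x y.
    by rewrite !wlength_itv_bnd// -EFinM lee_fin; have /andP[] := g_le xy.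
  by rewrite /= set_itv_ge ?bnd_simp -?leNgt ?(ltW yx)// !wlength0 mule0.
rewrite nneseriesZl; last by move=> i _; exact: wlength_ge0.
by rewrite -lee_pdivlMl// -EFinM mulrC ltW.
Qed.

Let f := Radon_Nikodym_SigmaFinite.f (lebesgue_stieltjes_measure g) mu.
Let ff x := fine (f x).
Let ffE : EFin \o ff = f.
Proof.
apply/funext => x; rewrite /= /ff fineK//; exact: (Radon_Nikodym_SigmaFinite.f_fin_num nu_dom).
Qed.
Let int_f : mu.-integrable setT (EFin \o ff).
Proof. rewrite ffE; exact: (Radon_Nikodym_SigmaFinite.f_integrable nu_dom). Qed.
Let f_int A : measurable A -> nu A = (\int[mu]_(x in A) f x)%E.
Proof. exact: (Radon_Nikodym_SigmaFinite.f_integral nu_dom). Qed.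
Let F x := \int[mu]_(t in `]-oo, x]) ff t.

Let F_g x : a <= x -> F x = F a + g x.
Proof.
move=> ax; have FE y : (F y)%:E = nu `]-oo, y]%classic.
  rewrite f_int// -ffE /F /Rintegral fineK//.
  by apply: integrable_fin_num => //; exact: integrableS int_f.
apply: EFin_inj; rewrite EFinD !FE.
have -> : `]-oo, x]%classic = `]-oo, a]%classic `|` `]a, x]%classic :> set R.
  by rewrite -itv_bndbnd_setU// bnd_simp.
transitivity (nu `]-oo, a]%classic + nu `]a, x]%classic)%E; last by rewrite nu_itv// (g_le_a (lexx a)) subr0.
apply: measureU => //.
apply/seteqP; split => y //=; rewrite !in_itv/= => -[ya /andP[ay _]].
by have := lt_le_trans ay ya; rewrite ltxx.
Qed.

Hypothesis dh : {ae mu, forall x, derivable h x 1 -> derive1 h x <= 1}.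

(** Lebesgue differentiation gives [F' = ff] almost everywhere. On []a, b[] the function [h] is
    [Z F] plus an affine function, so it is differentiable at the same points and [dh] bounds its
    derivative there. *)
Let ff_le : {ae mu, forall x, `]a, b[%classic x -> (f x <= ((L + 2) / Z)%:E)%E}.
Proof.
have int_ff y : mu.-integrable `]-oo, y] (EFin \o ff) by exact: integrableS int_f.
have loc_ff : locally_integrable [set: R] ff by apply: open_integrable_locally; [exact: openT|exact: int_f].
have FF := ae_filter_ringOfSetsType mu.
have := FTC1Ny int_ff loc_ff.
apply: filterS2 dh => x dhx [dF1 dF2]; rewrite /= in_itv/= => /andP[ax xb].
have dF : has_deriv F x (ff x) by exact: has_derivP.
have dhx' : has_deriv h x (Z * ff x - (L + 1)).
  apply: (@has_deriv_near_eq _ (fun y => Z * (F y - F a) - (L + 1) * (y - a) + h a)).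
    near=> y; have ay : a < y by near: y; exact: lt_nbhsr.
    have yb : y < b by near: y; exact: lt_nbhsl.
    rewrite (F_g (ltW ay)) [F a + _]addrC addrK /g cl_id ?ltW// [Z * _]mulrC divfK ?gt_eqF//; ring.
  deriv; move: (F x) (F a) (ff x) => p p' c; generalize Z => Y /=; ring.
have := dhx (has_deriv_derivable dhx'); rewrite (has_deriv_derive1 dhx').
have <- : (ff x)%:E = f x := congr1 (@^~ x) ffE.
rewrite lee_fin ler_pdivlMr// mulrC; lra.
Unshelve. all: by end_near. Qed.

(** The mass [nu ]a, b] = 1] is at most [(b - a) (L + 2) / Z], and [Z <= (L + 2) (b - a)] is the
    claim once [Z] is unfolded. *)
Lemma lipschitz_derive_le1 : h b - h a <= b - a.
Proof.
have : (1 <= ((L + 2) / Z * (b - a))%:E)%E.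
  have <- : nu `]a, b]%classic = 1%E by rewrite nu_itv ?ltW// (g_le_a (lexx a)) (g_ge_b (lexx b)) subr0.
  rewrite f_int// -integral_itv_bndo_bndc; last first.
    by apply: measurable_funTS; rewrite -ffE; exact: measurable_int int_f.
  apply: (@le_trans _ _ (\int[mu]_(x in `]a, b[) ((L + 2) / Z)%:E)%E).
    apply: ae_ge0_le_integral => //.
    - by move=> x _; exact: (Radon_Nikodym_SigmaFinite.f_ge0 nu_dom).
    - by apply: measurable_funTS; rewrite -ffE; exact: measurable_int int_f.
    - by move=> x _; rewrite lee_fin divr_ge0 ?(ltW Z0)//; move: L0; lra.
  by rewrite integral_cst//= lebesgue_measure_itv/= lte_fin ab -EFinD -EFinM.
by rewrite lee_fin mulrAC ler_pdivlMr// mul1r /Z; lra.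
Qed.

End lipschitz_derivative.

(** The one-sided increment bound is applied to [h] and to [- h]; the value of [derive1] is used at
    points of differentiability alone. *)
Lemma lipschitz_Lnorm_derive {R : realType} (h : R -> R) : lipschitz h ->
  ('N[@lebesgue_measure R]_+oo [EFin \o derive1 h] = 1)%E ->
  forall x y, `|h x - h y| <= `|x - y|.
Proof.
move=> lh Nh.
have [L L0 hL] : exists2 L, 0 < L & forall x y, `|h x - h y| <= L * `|x - y|.
  near (pinfty_nbhs R) => L; exists L => // x y.
  have : L.-lipschitz h by near: L; exact: lh.
  by move=> /(_ (x, y)); apply.
have ae1 : {ae @lebesgue_measure R, forall x, `|derive1 h x| <= 1}.
  (* The norm is an essential supremum on a space of positive measure and 0 otherwise; the value 1
     excludes the second case. *)
  move: Nh; rewrite unlock; case: ifPn => [_ Nh|_ /eqP]; last by rewrite eq_sym onee_eq0.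
  have := ess_sup_ge (@lebesgue_measure R) (abse \o (EFin \o derive1 h)).
  by rewrite Nh; apply: filterS => x; rewrite /= lee_fin.
have main (k : R -> R) x y : (forall x y, `|k x - k y| <= L * `|x - y|) ->
    (forall x, derivable k x 1 -> `|derive1 k x| <= `|derive1 h x|) -> x < y -> k y - k x <= y - x.
  move=> kL kh xy; apply: (lipschitz_derive_le1 L0 kL xy).
  have FF := ae_filter_ringOfSetsType (@lebesgue_measure R).
  by apply: filterS ae1 => z hz dz; apply: le_trans (le_trans (kh _ dz) hz); exact: ler_norm.
have mainN x y : x < y -> `|h y - h x| <= y - x.
  move=> xy; rewrite ler_norml; apply/andP; split; last by apply: main.
  rewrite lerNl opprB -[h x]opprK addrC; apply: (main (fun x => - h x)) => //.
    by move=> u v; rewrite -opprD normrN.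
  move=> z dz; have dh : has_deriv h z (- derive1 (fun x => - h x) z).
    apply: (@has_deriv_near_eq _ (fun x => - - h x)); first by near=> u; rewrite opprK.
    by apply: has_derivN; exact: has_derivP.
  by rewrite (has_deriv_derive1 dh) normrN.
move=> x y; have [xy|yx|->] := ltgtP x y; last by rewrite !subrr.
  by rewrite distrC [leRHS]distrC [leRHS]gtr0_norm ?subr_gt0// mainN.
by rewrite [leRHS]gtr0_norm ?subr_gt0// mainN.
Unshelve. all: by end_near. Qed.

(** * Solutions of the Stein equation *)

Section stein_solution.
Context {R : realType}.
Variables (s : R) (V h : R -> R) (c1 c : R).
Hypotheses (s1 : 1 <= s) (hV : density_factor s V) (ch : continuous h).
Hypotheses (c1_ge0 : 0 <= c1) (c_ge0 : 0 <= c).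
Hypothesis h_le : forall x, 0 <= x -> `|h x| <= c1 * x + c.
Notation phi := (gauss_weight s).
Let n := 2 * s - 2.
Let k := Num.sqrt (2 * s).
(** [h] stands for a test function that is already centred; this is recorded as the decay of [H], so
    that [- H x] is the integral of [h V phi] beyond [x]. *)
Let H := primitive (fun t => h t * (V t * phi t)).
Hypothesis H_cvg0 : H x @[x --> +oo] --> (0 : R).

Let s0 : 0 < s. Proof. exact: lt_le_trans s1. Qed.
Let sn0 : s != 0. Proof. by rewrite gt_eqF. Qed.
Let n0 : 0 <= n. Proof. by rewrite /n; move: s1; lra. Qed.
Let k0 : 0 < k. Proof. by rewrite sqrtr_gt0 mulr_gt0. Qed.
Let kk : k ^+ 2 = 2 * s. Proof. by rewrite sqr_sqrtr// mulr_ge0// ltW. Qed.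
Let phi0 x : 0 < phi x. Proof. exact: gauss_weight_gt0. Qed.
Let phin0 x : phi x != 0. Proof. by rewrite gt_eqF. Qed.
Let V0 x : 0 < V x. Proof. by have [] := hV. Qed.
Let Vn0 x : V x != 0. Proof. by rewrite gt_eqF. Qed.
Let cV x : cont_at V x. Proof. by have [cV _ _ _ _] := hV; exact: cV. Qed.
Let cphi x : cont_at phi x. Proof. exact: continuous_gauss_weight. Qed.
Let ch' x : cont_at h x. Proof. exact: ch. Qed.

Let S x := 1 - primitive (fun t => V t * phi t) x.
Let cVphi : continuous (fun t => V t * phi t).
Proof. by move=> x; apply: (_ : cont_at _ x); cont. Qed.
Let chVphi : continuous (fun t => h t * (V t * phi t)).
Proof. by move=> x; apply: (_ : cont_at _ x); cont. Qed.

Let dphi x : has_deriv phi x (- (x / s) * phi x).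
Proof. exact: has_deriv_gauss_weight. Qed.
Let dV x : 0 < x -> has_deriv V x (- (n / s) * S x / phi x).
Proof. by have [_ _ _ _] := hV; apply. Qed.
Let dS x : 0 < x -> has_deriv S x (- (V x * phi x)).
Proof. by move=> x0; have dp := has_deriv_primitive cVphi x0; rewrite /S; deriv => //=; ring. Qed.
Let dH x : 0 < x -> has_deriv H x (h x * (V x * phi x)).
Proof. exact: (has_deriv_primitive chVphi). Qed.
Let cS x : cont_at S x.
Proof. by have cp := @cont_primitive _ _ x cVphi; rewrite /S; cont. Qed.
Let cH x : cont_at H x.
Proof. exact: (cont_primitive chVphi). Qed.

Let S_cvg0 : S x @[x --> +oo] --> (0 : R).
Proof.
rewrite -[X in _ `=>` nbhs X](subrr 1); apply: cvgB; first exact: cvg_cst.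
have [_ _ _ iV _] := hV; apply: (cvg_primitive_open cVphi _ iV) => x.
by rewrite mulr_ge0// ltW.
Qed.

Let S_ge0 x : 0 <= x -> 0 <= S x.
Proof.
move=> x0; apply: (ge0_decreasing_limit (f := S) (df := fun x => - (V x * phi x)) (r := S)) => //.
- by move=> y xy; apply: dS; exact: le_lt_trans xy.
- by move=> y xy; rewrite oppr_le0 mulr_ge0// ltW.
Qed.

(* A majorant of the Gaussian tail: [T' <= - phi], whence [S <= V T]. *)
Let T x := phi x * (2 * s) / (x + k).
(** The choice [k ^ 2 = 2 s] completes the square: [2 x (x + k) + 2 s = (x + k) ^ 2 + x ^ 2]. *)
Let dT x : 0 < x -> has_deriv T x (- phi x * (1 + x ^+ 2 / (x + k) ^+ 2)).
Proof.
move=> x0; have dp := dphi x.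
have xk : x + k != 0 by rewrite gt_eqF// addr_gt0.
rewrite /T; deriv => //=.
move: (phi x) kk xk (k0) sn0 => g; move: k => K KK; rewrite (_ : s = K ^+ 2 / 2); last by rewrite KK; field.
move=> xk /lt0r_neq0 Kn _; field.
by rewrite xk Kn.
Qed.

Let T_ge0 x : 0 <= x -> 0 <= T x.
Proof. by move=> x0; rewrite /T divr_ge0 ?addr_ge0 ?mulr_ge0 ?(ltW (phi0 x)) ?(ltW k0) ?(ltW s0). Qed.

Let dT_le x : 0 < x -> - phi x * (1 + x ^+ 2 / (x + k) ^+ 2) <= - phi x.
Proof.
move=> x0; rewrite mulNr lerN2 ler_peMr ?ltW// ltrDl divr_gt0 ?exprn_gt0// addr_gt0//.
Qed.

Let cT x : 0 <= x -> cont_at T x.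
Proof. by move=> x0; rewrite /T; cont; rewrite gt_eqF// ltr_wpDl. Qed.

Let V_derive_le0 x : 0 < x -> - (n / s) * S x / phi x <= 0.
Proof.
by move=> x0; rewrite !mulNr oppr_le0 !mulr_ge0 ?invr_ge0 ?S_ge0// ltW.
Qed.

(** As [V] is nonincreasing, [(V T)' <= V T' <= - V phi = S'], and both sides vanish at infinity. *)
Let S_le x : 0 <= x -> S x <= V x * T x.
Proof.
move=> x0; rewrite -subr_ge0.
apply: (@ge0_decreasing_limit _ (fun y => V y * T y - S y)
  (fun y => (- (n / s) * S y / phi y) * T y + V y * (- phi y * (1 + y ^+ 2 / (y + k) ^+ 2)) + V y * phi y)
  (fun y => - S y)).
- by have cTx := cT x0; cont.
- move=> y xy; have y0 := le_lt_trans x0 xy.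
  have dVy := dV y0; have dTy := dT y0; have dSy := dS y0.
  by deriv => //=; ring.
- move=> y xy; have y0 := le_lt_trans x0 xy.
  have a1 := mulr_le0_ge0 (V_derive_le0 y0) (T_ge0 (ltW y0)).
  have a2 : V y * (- phi y * (1 + y ^+ 2 / (y + k) ^+ 2)) <= V y * (- phi y) by rewrite ler_pM2l// dT_le.
  lra.
- move=> y xy; have y0 := le_lt_trans x0 xy.
  by rewrite lerDr mulr_ge0 ?T_ge0 ?ltW.
- by rewrite -[X in _ `=>` nbhs X]oppr0; apply: cvgN.
Qed.

(** A majorant of the integral of [(c1 y + c) phi y] beyond [x]: the first term is exact because
    [(s phi)' = - y phi], the second uses [T]. *)
Let T3 x := c1 * s * phi x + c * T x.

Let sign_le (e y : R) : 0 <= y -> `|e| = 1 -> e * (h y * (V y * phi y)) <= (c1 * y + c) * (V y * phi y).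
Proof.
move=> y0 e1; rewrite mulrA ler_pM2r ?mulr_gt0//; apply: le_trans (h_le y0).
by rewrite (le_trans (ler_norm _))// normrM e1 mul1r.
Qed.

Let H_le_sign (e x : R) : `|e| = 1 -> 0 <= x -> 0 <= V x * T3 x + e * H x.
Proof.
move=> e1 x0; have T3_ge0 y : 0 <= y -> 0 <= T3 y.
  move=> y0; apply: addr_ge0; last by rewrite mulr_ge0 ?T_ge0.
    by rewrite mulr_ge0 ?mulr_ge0 ?(ltW (phi0 y)) ?(ltW s0).
apply: (@ge0_decreasing_limit _ (fun y => V y * T3 y + e * H y)
  (fun y => (- (n / s) * S y / phi y) * T3 y
     + V y * (c1 * s * (- (y / s) * phi y) + c * (- phi y * (1 + y ^+ 2 / (y + k) ^+ 2)))
     + e * (h y * (V y * phi y)))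
  (fun y => e * H y)).
- by have cTx := cT x0; rewrite /T3; cont.
- move=> y xy; have y0 := le_lt_trans x0 xy.
  have dVy := dV y0; have dTy := dT y0; have dHy := dH y0; have dpy := dphi y.
  by rewrite /T3; deriv => //=; ring.
- move=> y xy; have y0 := le_lt_trans x0 xy.
  have a1 := mulr_le0_ge0 (V_derive_le0 y0) (T3_ge0 _ (ltW y0)).
  have a3 : c * (- phi y * (1 + y ^+ 2 / (y + k) ^+ 2)) <= c * - phi y by rewrite ler_wpM2l// dT_le.
  have a2 : c1 * s * (- (y / s) * phi y) = - (c1 * y * phi y) by field.
  have a4 := sign_le (ltW y0) e1.
  have a5 : V y * (c1 * s * (- (y / s) * phi y) + c * (- phi y * (1 + y ^+ 2 / (y + k) ^+ 2)))
     <= V y * (- (c1 * y * phi y) + c * - phi y) by rewrite ler_pM2l// a2 lerD2l.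
  lra.
- move=> y xy; have y0 := le_lt_trans x0 xy.
  by rewrite lerDr mulr_ge0 ?T3_ge0 ?ltW.
- by rewrite -[X in _ `=>` nbhs X](mulr0 e); apply: cvgM; first exact: cvg_cst.
Qed.

(** The affine solution of [n b + x b' - s b'' = n (c1 x + c)], hence the natural majorant of
    [n |f|]. *)
Let b x := c + c1 * n * x / (n + 1).
Let n1 : 0 < n + 1. Proof. by rewrite ltr_wpDl. Qed.
Let b_ge0 x : 0 <= x -> 0 <= b x.
Proof. by move=> x0; rewrite addr_ge0// divr_ge0 ?mulr_ge0// ltW. Qed.

(* [Q' = - n (c1 x + c) V phi], whence [n |H| <= Q]; this makes [b / V +- n u] nondecreasing. *)
Let Q x := s * phi x * (c1 * n / (n + 1)) * V x + n * b x * S x.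

Let Q_ge_sign (e x : R) : `|e| = 1 -> 0 <= x -> 0 <= Q x + e * n * H x.
Proof.
move=> e1 x0; have n1n : n + 1 != 0 by rewrite gt_eqF.
have Q_ge0 y : 0 <= y -> 0 <= Q y.
  move=> y0; apply: addr_ge0; rewrite !mulr_ge0 ?invr_ge0 ?b_ge0 ?S_ge0// ltW//.
apply: (@ge0_decreasing_limit _ (fun y => Q y + e * n * H y)
  (fun y => - n * ((c1 * y + c) * (V y * phi y)) + n * (e * (h y * (V y * phi y))))
  (fun y => e * n * H y)).
- by rewrite /Q /b; cont.
- move=> y xy; have y0 := le_lt_trans x0 xy.
  have dVy := dV y0; have dSy := dS y0; have dHy := dH y0; have dpy := dphi y.
  by rewrite /Q /b; deriv => //=; field; rewrite phin0 n1n sn0.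
- move=> y xy; have y0 := le_lt_trans x0 xy.
  by rewrite mulNr addrC subr_le0 ler_wpM2l// sign_le// ltW.
- by move=> y xy; have y0 := le_lt_trans x0 xy; rewrite lerDr Q_ge0// ltW.
- by rewrite -[X in _ `=>` nbhs X](mulr0 (e * n)); apply: cvgM; first exact: cvg_cst.
Qed.

(** With [f = V u], the equation [s f'' - x f' - n f = h] becomes [(s V ^ 2 phi u')' = h V phi],
    since [V] solves the homogeneous equation and [phi' = - (x / s) phi]. *)
Let u := primitive (fun t => H t / (s * V t ^+ 2 * phi t)).
Let cu' : continuous (fun t => H t / (s * V t ^+ 2 * phi t)).
Proof. by move=> x; apply: (_ : cont_at _ x); cont; rewrite !mulf_neq0 ?expf_neq0. Qed.
Let du x : 0 < x -> has_deriv u x (H x / (s * V x ^+ 2 * phi x)).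
Proof. exact: (has_deriv_primitive cu'). Qed.
Let cu x : cont_at u x.
Proof. exact: (cont_primitive cu'). Qed.

Let f x := V x * u x.
Let f1 x := - (n / s) * S x / phi x * u x + H x / (s * V x * phi x).
Let M x := h x + n * f x + x * f1 x.

Let df x : 0 < x -> has_deriv f x (f1 x).
Proof.
move=> x0; have dVx := dV x0; have dux := du x0.
by rewrite /f /f1; deriv => //=; field; rewrite phin0 Vn0 sn0.
Qed.

Let df1 x : 0 < x -> has_deriv f1 x (M x / s).
Proof.
move=> x0; have dVx := dV x0; have dux := du x0; have dSx := dS x0; have dHx := dH x0; have dpx := dphi x.
by rewrite /f1 /M; deriv => //=; rewrite ?mulf_neq0// /f1 /f; field; rewrite phin0 Vn0 sn0.
Qed.

Let f_le_sign (e x : R) : `|e| = 1 -> 0 <= x -> 0 <= b x / V x + e * n * u x.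
Proof.
move=> e1 x0; have n1n : n + 1 != 0 by rewrite gt_eqF.
apply: (@le_trans _ _ (b 0 / V 0 + e * n * u 0)).
  by rewrite /u primitive_le0// mulr0 addr0 divr_ge0 ?b_ge0 ?(ltW (V0 _)).
apply: (@nondecreasing_derive_ge0 _ (fun y => b y / V y + e * n * u y)
  (fun y => (Q y + e * n * H y) / (s * phi y * V y ^+ 2))).
- exact: x0.
- by rewrite /b; cont.
- move=> y y0; have dVy := dV y0; have duy := du y0.
  by rewrite /b /Q; deriv => //=; rewrite /b; field; rewrite phin0 Vn0 sn0 n1n.
- by move=> y y0; rewrite divr_ge0 ?Q_ge_sign ?mulr_ge0 ?exprn_ge0// ltW.
Qed.

Let abs_sign (a d : R) : (forall e : R, `|e| = 1 -> 0 <= d + e * a) -> `|a| <= d.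
Proof.
move=> P; have := P 1 (normr1 _); have := P (-1) (normrN1 _); rewrite ler_norml; lra.
Qed.

Let H_le x : 0 <= x -> `|H x| <= V x * T3 x.
Proof. by move=> x0; apply: abs_sign => e e1; exact: H_le_sign. Qed.

Let nf_le x : 0 <= x -> n * `|f x| <= b x.
Proof.
move=> x0; have : `|n * u x| <= b x / V x.
  by apply: abs_sign => e e1; rewrite mulrA; exact: f_le_sign.
rewrite ler_pdivlMr// [`|n * _|]normrM (ger0_norm n0) /f [`|V x * _|]normrM (gtr0_norm (V0 x)).
by rewrite -mulrA [`|u x| * _]mulrC.
Qed.

(** Writing [f1 = (H - n f S) / (s V phi)], the bounds on [S] and [H] both carry the factor [V phi],
    which cancels. *)
Let f1_le x : 0 <= x -> `|f1 x| <= 2 * (b x + c) / (x + k) + c1.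
Proof.
move=> x0; have xk : 0 < x + k by rewrite ltr_wpDl.
have E1 : f1 x = - (n * f x) * S x / (s * V x * phi x) + H x / (s * V x * phi x).
  by rewrite /f1 /f; field; rewrite phin0 Vn0 sn0.
have svp : 0 < s * V x * phi x by rewrite !mulr_gt0.
rewrite E1 -mulrDl normrM normfV (gtr0_norm svp) ler_pdivrMr//.
apply: (le_trans (ler_normD _ _)); rewrite normrM normrN normrM (ger0_norm n0) (ger0_norm (S_ge0 x0)).
apply: (@le_trans _ _ (b x * (V x * T x) + V x * T3 x)).
  apply: lerD; last exact: H_le.
  by apply: ler_pM => //; [exact: mulr_ge0|exact: S_ge0|exact: nf_le|exact: S_le].
by rewrite le_eqVlt; apply/orP; left; apply/eqP; rewrite /T3 /T; field; rewrite gt_eqF.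
Qed.

Let cf x : cont_at f x. Proof. by rewrite /f; cont. Qed.
Let cf1 x : cont_at f1 x.
Proof. by rewrite /f1; cont => //; rewrite !mulf_neq0. Qed.
Let cM x : cont_at M x. Proof. by rewrite /M; cont. Qed.

Let f10 : f1 0 = 0.
Proof. by rewrite /f1 /u /H !primitive_le0// mulr0 mul0r addr0. Qed.
Let f0 : f 0 = 0.
Proof. by rewrite /f /u primitive_le0// mulr0. Qed.

(** Integrating [s f''] by parts against the affine kernel leaves [s (w f1 w + n f w)]; the terms at
    0 drop out because [f] and [f1] vanish there. *)
Let volterra (w : R) : 0 <= w ->
  M w - primitive (fun t => (w + n * (w - t)) * M t) w / s = h w.
Proof.
move=> w0; pose g t := (w + n * (w - t)) * (s * f1 t) + n * s * f t.
have -> : primitive (fun t => (w + n * (w - t)) * M t) w = g w - g 0.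
  apply: FTC_integral.
  - exact: w0.
  - by move=> x _; cont.
  - by rewrite /g; cont.
  - move=> x x0; have dfx := df x0; have df1x := df1 x0; rewrite /g.
    deriv; move: (M x) (f1 x) (f x) => a a1 a2; generalize n => n'; field; exact: sn0.
by rewrite /g f10 f0 /M; field; exact: sn0.
Qed.

Let kfun x := n * f x + x * f1 x.

Section lipschitz_data.
(** [sqrt s] bounds the mean of [K_s], and a centred 1-Lipschitz function is at most [x] plus that
    mean. *)
Hypotheses (c1E : c1 = 1) (cE : c = Num.sqrt s).
Hypothesis h_lip : forall x y, `|h x - h y| <= `|x - y|.

Let r0 : 0 < Num.sqrt s. Proof. by rewrite sqrtr_gt0. Qed.
Let kE : k ^+ 2 = 2 * Num.sqrt s ^+ 2. Proof. by rewrite kk sqr_sqrtr// ltW. Qed.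

(** As [b x <= x + sqrt s], it suffices that [2 x + 4 sqrt s <= 3 (x + k)], and
    [3 k = 3 sqrt 2 sqrt s] exceeds [4 sqrt s]. *)
Let f1_le4 x : 0 <= x -> `|f1 x| <= 4.
Proof.
move=> x0; apply: (le_trans (f1_le x0)); have xk : 0 < x + k by rewrite ltr_wpDl.
rewrite -lerBrDr ler_pdivrMr// /b c1E cE.
have E : 1 * n * x / (n + 1) <= x.
  by rewrite ler_pdivrMr// mul1r mulrC ler_wpM2l// lerDl.
have kr : 4 * Num.sqrt s <= 3 * k.
  rewrite -(ler_pXn2r (n := 2)) ?nnegrE ?mulr_ge0// ?(ltW k0)// !exprMn kE; have := sqr_ge0 (Num.sqrt s); lra.
move: E kr; lra.
Qed.

(** The bound [4 (n + 1)] for [(n + 1) f1], plus the Lipschitz constant 1 of [h]. *)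
Let C := 1 + (n + 1) * 4.

Let kfun_deriv x : 0 < x -> has_deriv kfun x ((n + 1) * f1 x + x * M x / s).
Proof.
move=> x0; have dfx := df x0; have df1x := df1 x0.
by rewrite /kfun; deriv => //=; ring.
Qed.

Let kfun_le x : 0 <= x -> `|kfun x| <= 5 * x + c.
Proof.
move=> x0; apply: (le_trans (ler_normD _ _)); rewrite [`|n * _|]normrM (ger0_norm n0) [`|x * _|]normrM (ger0_norm x0).
have := nf_le x0; have : x * `|f1 x| <= x * 4 by rewrite ler_wpM2l// f1_le4.
have E : 1 * n * x / (n + 1) <= x.
  by rewrite ler_pdivrMr// mul1r mulrC ler_wpM2l// lerDl.
rewrite /b c1E; lra.
Qed.

Let M_le_sign (e x : R) : `|e| = 1 -> 0 <= x -> 0 <= C * T x + e * (phi x * M x).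
Proof.
move=> e1 x0.
have C0 : 0 <= C by rewrite /C; move: n0; lra.
(* The term [phi x (x - x)] is zero here but not for [y > x]. With [h] frozen at [x], the derivative
   in [y] contains [(y / s) phi y (h y - h x)], which the derivative of [phi y (y - x)] absorbs by
   the Lipschitz property of [h]. *)
suff : 0 <= C * T x + phi x * (x - x) + e * (phi x * (kfun x + h x)).
  by rewrite subrr mulr0 addr0 /M /kfun (_ : h x + _ + _ = n * f x + x * f1 x + h x)//; ring.
apply: (@ge0_decreasing_limit _ (fun y => C * T y + phi y * (y - x) + e * (phi y * (kfun y + h x)))
  (fun y => C * (- phi y * (1 + y ^+ 2 / (y + k) ^+ 2)) + phi y - y / s * phi y * (y - x)
     + e * (phi y * ((n + 1) * f1 y) + y / s * phi y * (h y - h x)))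
  (fun y => - (phi y * (5 * y + (c + `|h x|))))).
- by have cTx := cT x0; rewrite /kfun; cont.
- move=> y xy; have y0 := le_lt_trans x0 xy.
  have dTy := dT y0; have dpy := dphi y; have dky := kfun_deriv y0.
  deriv => //=; rewrite /kfun /M; field; rewrite sn0 gt_eqF//; exact: addr_gt0.
- move=> y xy; have y0 := le_lt_trans x0 xy.
  have a1 : C * (- phi y * (1 + y ^+ 2 / (y + k) ^+ 2)) <= C * - phi y by rewrite ler_wpM2l// dT_le.
  have a2 : e * (phi y * ((n + 1) * f1 y)) <= phi y * ((n + 1) * 4).
    rewrite (le_trans (ler_norm _))// !normrM e1 mul1r (gtr0_norm (phi0 y)) (gtr0_norm n1).
    by rewrite !ler_pM2l// f1_le4// ltW.
  have a3 : e * (y / s * phi y * (h y - h x)) <= y / s * phi y * (y - x).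
    have p0 : 0 < y / s * phi y by rewrite mulr_gt0 ?divr_gt0.
    rewrite (le_trans (ler_norm _))// normrM e1 mul1r normrM (gtr0_norm p0) ler_pM2l//.
    by rewrite (le_trans (h_lip _ _))// gtr0_norm// subr_gt0.
  rewrite mulrDr; have : phi y * ((n + 1) * 4) = phi y * C - phi y by rewrite /C; ring.
  lra.
- move=> y xy; have y0 := le_lt_trans x0 xy.
  have a1 : 0 <= C * T y + phi y * (y - x).
    by apply: addr_ge0; rewrite mulr_ge0 ?T_ge0 ?subr_ge0 ?(ltW (phi0 y)) ?(ltW xy) ?(ltW y0).
  have a2 : `|e * (phi y * (kfun y + h x))| <= phi y * (5 * y + (c + `|h x|)).
    rewrite normrM e1 mul1r normrM (gtr0_norm (phi0 y)) ler_pM2l// addrA.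
    by apply: (le_trans (ler_normD _ _)); rewrite lerD2r kfun_le// ltW.
  by have := ler_normlW (_ : `|- (e * (phi y * (kfun y + h x)))| <= _); rewrite normrN => /(_ _ a2); lra.
- rewrite -[X in _ `=>` nbhs X]oppr0; apply: cvgN; exact: cvg_gauss_weight_lin.
Qed.

Let M_le x : 0 <= x -> `|M x| <= 2 * s * C / (x + k).
Proof.
move=> x0; have : `|phi x * M x| <= C * T x by apply: abs_sign => e e1; exact: M_le_sign.
rewrite normrM (gtr0_norm (phi0 x)) => Mx; rewrite -(ler_pM2l (phi0 x)).
have -> : phi x * (2 * s * C / (x + k)) = C * T x; last exact: Mx.
by rewrite /T; ring.
Qed.

(** The first term is at most [C - 1]; the second is at most [2 C], by the decay of [M] like
    [1 / (x + k)]. *)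
Let kfun_lip x : 0 < x -> `|(n + 1) * f1 x + x * M x / s| <= 3 * C - 1.
Proof.
move=> x0; apply: (le_trans (ler_normD _ _)).
have a1 : `|(n + 1) * f1 x| <= (n + 1) * 4.
  by rewrite normrM (gtr0_norm n1) ler_pM2l// f1_le4// ltW.
have C0 : 0 <= C by rewrite /C; move: n0; lra.
have xk : 0 < x + k by rewrite addr_gt0.
have a2 : `|x * M x / s| <= 2 * C.
  rewrite normrM normfV (gtr0_norm s0) ler_pdivrMr// normrM (gtr0_norm x0).
  apply: (@le_trans _ _ (x * (2 * s * C / (x + k)))); first by rewrite ler_pM2l// M_le// ltW.
  rewrite mulrA ler_pdivrMr// [leLHS](_ : _ = 2 * s * C * x); last by ring.
  rewrite [leRHS](_ : _ = 2 * s * C * (x + k)); last by ring.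
  by rewrite ler_wpM2l ?mulr_ge0 ?(ltW s0)// lerDl ltW.
have : (n + 1) * 4 = C - 1 by rewrite /C; ring.
by move: a1 a2; lra.
Qed.

Let M_lip x y : 0 <= x -> 0 <= y -> `|M y - M x| <= 3 * C * `|y - x|.
Proof.
move=> x0 y0; have ck : cont_at kfun 0 by rewrite /kfun; cont.
have := lipschitz_derive_le x0 y0 ck kfun_deriv kfun_lip.
have := h_lip y x; have -> : M y - M x = (h y - h x) + (kfun y - kfun x) by rewrite /M /kfun; ring.
by have := ler_normD (h y - h x) (kfun y - kfun x); lra.
Qed.

(** Here [3 C = 24 s - 9]; as [sqrt (pi / 2) >= 1], it remains to see [8 s ^ 2 - 14 s + 9 >= 0],
    where the left side is [8 (s - 1) ^ 2 + 2 s + 1]. *)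
Let lipschitz_const : 3 * C <= 8 * s * (s + 4^-1 + Num.sqrt (pi / 2)).
Proof.
have p1 : 1 <= Num.sqrt (pi / 2 : R).
  by rewrite -{1}(sqrtr1 R) ler_wsqrtr// ler_pdivlMr// mul1r pi_ge2.
rewrite /C /n; have : s * 1 <= s * Num.sqrt (pi / 2) by rewrite ler_pM2l.
have := sqr_ge0 (s - 1); rewrite expr2.
move: (Num.sqrt _) => q; nra.
Qed.

Lemma stein_lipschitz : exists M : R -> R,
  [/\ continuous M, exists B, forall x, 0 <= x -> `|M x| <= B,
   forall w, 0 <= w -> M w - primitive (fun t => (w + (2 * s - 2) * (w - t)) * M t) w / s = h w &
   forall x y, 0 <= x -> 0 <= y ->
     `|M y - M x| <= 8 * s * (s + 4^-1 + Num.sqrt (pi / 2)) * `|y - x|].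
Proof.
exists M; split.
- by move=> x; exact: cM.
- exists (2 * s * C / k) => x x0; apply: (le_trans (M_le x0)).
  have C0 : 0 <= C by rewrite /C; move: n0; lra.
  rewrite ler_wpM2l ?mulr_ge0 ?(ltW s0)// lef_pV2 ?posrE ?lerDr//.
  by rewrite ltr_wpDl.
- exact: volterra.
- move=> x y x0 y0; apply: (le_trans (M_lip x0 y0)).
  by rewrite ler_wpM2r//; exact: lipschitz_const.
Qed.

End lipschitz_data.

Section bounded_data.
Hypotheses (c1E : c1 = 0) (cE : c = 1).

Let k1 : 1 <= k.
Proof. by rewrite /k -{1}(sqrtr1 R) ler_wsqrtr//; move: s1; lra. Qed.

Let f1_le' x : 0 <= x -> `|f1 x| <= 4 / (x + k).
Proof.
move=> x0; apply: (le_trans (f1_le x0)); rewrite /b c1E cE !mul0r !addr0.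
by rewrite le_eqVlt; apply/orP; left; apply/eqP; congr (_ / _); ring.
Qed.

Let f1_le4' x : 0 <= x -> `|f1 x| <= 4.
Proof.
move=> x0; apply: (le_trans (f1_le' x0)); have xk : 0 < x + k by rewrite ltr_wpDl.
by rewrite ler_pdivrMr// ler_peMr//; move: k1; lra.
Qed.

(** [6 = 1 + 1 + 4] bounds [h], [n f] and [x f1] in turn. *)
Let M_le6 x : 0 <= x -> `|M x| <= 6.
Proof.
move=> x0; have xk : 0 < x + k by rewrite ltr_wpDl.
have a1 : x * `|f1 x| <= 4.
  apply: (@le_trans _ _ (x * (4 / (x + k)))); first by rewrite ler_wpM2l// f1_le'.
  by rewrite mulrA ler_pdivrMr//; move: (ltW k0); lra.
have a2 := nf_le x0; have a3 := h_le x0.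
rewrite /b c1E cE !mul0r !addr0 in a2; rewrite c1E cE mul0r add0r in a3.
apply: (le_trans (ler_normD _ _)); rewrite normrM (ger0_norm x0).
apply: (@le_trans _ _ ((1 + 1) + 4)); last by lra.
apply: lerD; last exact: a1.
apply: (le_trans (ler_normD _ _)); apply: lerD; first exact: a3.
by rewrite normrM (ger0_norm n0).
Qed.

(** [8 s - 4 = 4 n + 4] collects the increment of [n f] and the factor [f1], both through
    [|f1| <= 4]; [6 y] comes from [|f1'| = |M| / s <= 6]. The increment of [h] is kept apart: it is
    large for a steep [h] and is controlled only on average. *)
Lemma stein_bounded : exists M : R -> R,
  [/\ continuous M, forall x, 0 <= x -> `|M x| <= 6,
   forall w, 0 <= w -> M w - primitive (fun t => (w + (2 * s - 2) * (w - t)) * M t) w / s = h w &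
   forall x y, 0 <= x -> 0 <= y ->
     `|M y - M x| <= `|h y - h x| + (8 * s - 4 + 6 * y) * `|y - x|].
Proof.
exists M; split.
- by move=> x; exact: cM.
- exact: M_le6.
- exact: volterra.
move=> x y x0 y0.
have a1 : `|f y - f x| <= 4 * `|y - x|.
  have df1b z : 0 < z -> `|f1 z| <= 4 by move=> z0; apply: f1_le4'; exact: ltW.
  exact: (@lipschitz_derive_le _ f f1 4 x y x0 y0 (@cf 0) df df1b).
have a2 : `|f1 y - f1 x| <= 6 * `|y - x|.
  apply: (@lipschitz_derive_le _ f1 _ 6 x y x0 y0 (@cf1 0) df1) => z z0.
  rewrite normrM normfV (gtr0_norm s0) ler_pdivrMr//.
  by apply: (le_trans (M_le6 (ltW z0))); rewrite ler_peMr.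
have -> : M y - M x = (h y - h x) + n * (f y - f x) + (y * (f1 y - f1 x) + (y - x) * f1 x).
  by rewrite /M; ring.
apply: (le_trans (ler_normD _ _)).
have b1 : `|h y - h x + n * (f y - f x)| <= `|h y - h x| + n * (4 * `|y - x|).
  apply: (le_trans (ler_normD _ _)); rewrite lerD2l normrM (ger0_norm n0).
  by rewrite ler_wpM2l.
have b2 : `|y * (f1 y - f1 x) + (y - x) * f1 x| <= y * (6 * `|y - x|) + `|y - x| * 4.
  apply: (le_trans (ler_normD _ _)); apply: lerD; rewrite normrM.
    by rewrite (ger0_norm y0) ler_wpM2l.
  by rewrite ler_wpM2l// f1_le4'.
apply: (le_trans (lerD b1 b2)); rewrite le_eqVlt; apply/orP; left; apply/eqP; rewrite /n; ring.
Qed.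

End bounded_data.
End stein_solution.

(** * The first-order equation, [s = 1/2] *)

Section stein_solution_half.
Context {R : realType}.
Variables (h : R -> R) (m : R).
Hypothesis ch : continuous h.
Notation phi := (gauss_weight (2^-1 : R)).
Let H := primitive (fun t => h t * (2 * t * phi t)).
Hypothesis H_cvg : H x @[x --> +oo] --> m.

Let s0 : 0 < 2^-1 :> R. Proof. by rewrite invr_gt0. Qed.
Let phi0 x : 0 < phi x. Proof. exact: gauss_weight_gt0. Qed.
Let phin0 x : phi x != 0. Proof. by rewrite gt_eqF. Qed.
Let cphi x : cont_at phi x. Proof. exact: continuous_gauss_weight. Qed.
Let ch' x : cont_at h x. Proof. exact: ch. Qed.
Let dphi x : has_deriv phi x (- (2 * x) * phi x).
Proof. by apply: has_deriv_eq (has_deriv_gauss_weight s0 x) _; rewrite invrK [x * 2]mulrC. Qed.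

Let chphi : continuous (fun t => h t * (2 * t * phi t)).
Proof. by move=> x; apply: (_ : cont_at _ x); cont. Qed.
Let dH x : 0 < x -> has_deriv H x (h x * (2 * x * phi x)).
Proof. exact: (has_deriv_primitive chphi). Qed.
Let cH x : cont_at H x. Proof. exact: (cont_primitive chphi). Qed.

Let G x := m - H x.
Let dG x : 0 < x -> has_deriv G x (- (h x * (2 * x * phi x))).
Proof. by move=> x0; have dHx := dH x0; rewrite /G; deriv; ring. Qed.
Let cG x : cont_at G x. Proof. by rewrite /G; cont. Qed.
Let G_cvg0 : G x @[x --> +oo] --> (0 : R).
Proof. by rewrite -[X in _ `=>` nbhs X](subrr m); apply: cvgB; first exact: cvg_cst. Qed.

(** [phi x] is the mass of the target law beyond [x], so [N x] is the conditional mean of the test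
    function there. *)
Let N x := G x / phi x.
Let M x := h x - N x.
Let dN x : 0 < x -> has_deriv N x (- (2 * x * M x)).
Proof.
move=> x0; have dGx := dG x0; have dpx := dphi x; rewrite /N.
by deriv => //; rewrite /M /N; field; exact: phin0.
Qed.
Let cN x : cont_at N x. Proof. by rewrite /N; cont; exact: phin0. Qed.
Let cM x : cont_at M x. Proof. by rewrite /M; cont. Qed.

(** At [s = 1/2] the kernel [w + n (w - t)] collapses to [t], and [t M t] is the derivative of
    [- N t / 2]. *)
Let volterra (w : R) : 0 <= w ->
  M w - primitive (fun t => (w + (2 * 2^-1 - 2) * (w - t)) * M t) w / 2^-1 = h w - m.
Proof.
move=> w0; have -> : (fun t => (w + (2 * 2^-1 - 2) * (w - t)) * M t) = (fun t => t * M t).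
  by apply/funext => t; rewrite divff//; congr (_ * _); ring.
have -> : primitive (fun t => t * M t) w = - N w / 2 - (- N 0 / 2).
  apply: (@FTC_integral _ _ (fun x => - N x / 2)).
  - exact: w0.
  - by move=> x _; cont.
  - by cont.
  - by move=> x x0; have dNx := dN x0; deriv; move: (M x) => a /=; field.
have -> : N 0 = m.
  rewrite /N /G /H primitive_le0// subr0 /gauss_weight expr0n/= oppr0 mul0r expR0 divr1//.
by rewrite /M invrK; field.
Qed.

Section bounded_data.
Hypothesis h01 : forall x, 0 <= x -> 0 <= h x <= 1.

Let G_ge0 x : 0 <= x -> 0 <= G x.
Proof.
move=> x0; apply: (@ge0_decreasing_limit _ G (fun y => - (h y * (2 * y * phi y))) G).
- exact: cG.
- by move=> y xy; apply: dG; exact: le_lt_trans xy.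
- move=> y xy; have y0 := le_lt_trans x0 xy; have /andP[hy _] := h01 (ltW y0).
  by rewrite oppr_le0 mulr_ge0 ?mulr_ge0 ?(ltW y0) ?(ltW (phi0 y)).
- by [].
- exact: G_cvg0.
Qed.

Let G_le x : 0 <= x -> G x <= phi x.
Proof.
move=> x0; rewrite -subr_ge0.
apply: (@ge0_decreasing_limit _ (fun y => phi y - G y) (fun y => - (2 * y * phi y * (1 - h y))) (fun y => - G y)).
- by cont.
- by move=> y xy; have dGy := dG (le_lt_trans x0 xy); have dpy := dphi y; deriv; ring.
- move=> y xy; have y0 := le_lt_trans x0 xy; have /andP[_ hy] := h01 (ltW y0).
  by rewrite oppr_le0 mulr_ge0 ?subr_ge0 ?mulr_ge0 ?(ltW y0) ?(ltW (phi0 y)).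
- by move=> y xy; rewrite lerDr ltW.
- by rewrite -[X in _ `=>` nbhs X]oppr0; apply: cvgN.
Qed.

Let M_le1 x : 0 <= x -> `|M x| <= 1.
Proof.
move=> x0; have /andP[h0 h1] := h01 x0.
have N0 : 0 <= N x by rewrite divr_ge0 ?G_ge0 ?(ltW (phi0 x)).
have N1 : N x <= 1 by rewrite ler_pdivrMr// mul1r G_le.
by rewrite /M ler_norml; move: h0 h1 N0 N1; lra.
Qed.

(** Both [z ^ 2 - N z] and [z ^ 2 + N z] are nondecreasing, because [|N'| = 2 z |M| <= 2 z]. *)
Let N_le x y : 0 <= x -> x <= y -> `|N y - N x| <= (x + y) * (y - x).
Proof.
move=> x0 xy.
have P (e : R) : `|e| = 1 -> e * (N y - N x) <= (x + y) * (y - x).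
  move=> e1; suff : x ^+ 2 - e * N x <= y ^+ 2 - e * N y by rewrite !expr2; lra.
  apply: (@nondecreasing_derive_ge0 _ (fun z => z ^+ 2 - e * N z) (fun z => 2 * z * (1 + e * M z))).
  - exact: xy.
  - by cont.
  - by move=> z xz; have dNz := dN (le_lt_trans x0 xz); deriv; move: (M z) => a /=; ring.
  - move=> z xz; have z0 := le_lt_trans x0 xz; rewrite mulr_ge0 ?mulr_ge0 ?(ltW z0)//.
    have : `|e * M z| <= 1 by rewrite normrM e1 mul1r M_le1// ltW.
    by rewrite ler_norml; lra.
by have := P 1 (normr1 _); have := P (-1) (normrN1 _); rewrite ler_norml; lra.
Qed.

Lemma stein_half_bounded : exists M : R -> R,
  [/\ continuous M, forall x, 0 <= x -> `|M x| <= 1,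
   forall w, 0 <= w -> M w - primitive (fun t => (w + (2 * 2^-1 - 2) * (w - t)) * M t) w / 2^-1 = h w - m &
   forall x y, 0 <= x -> 0 <= y -> `|M y - M x| <= `|h y - h x| + (x + y) * `|y - x|].
Proof.
exists M; split; [by move=> x; exact: cM|exact: M_le1|exact: volterra|].
move=> x y x0 y0; have -> : M y - M x = (h y - h x) - (N y - N x) by rewrite /M; ring.
apply: (le_trans (ler_normB _ _)); rewrite lerD2l.
have [xy|/ltW yx] := leP x y; first by rewrite [`|y - x|]ger0_norm ?subr_ge0// N_le.
have := N_le y0 yx; rewrite [`|N x - _|]distrC [y + x]addrC [`|y - x|]distrC.
by rewrite [`|x - y|]ger0_norm ?subr_ge0.
Qed.

End bounded_data.

Section lipschitz_data.
Hypothesis h_lip : forall x y, `|h x - h y| <= `|x - y|.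

(** A Gaussian tail majorant, as [T' = - phi (1 + 1 / (2 x ^ 2))]. Its singularity at 0 is harmless:
    the goal is a bound on [2 x |M x| = |N' x|]. *)
Let T x := phi x / (2 * x).

Let M_le_sign (e x : R) : `|e| = 1 -> 0 < x -> 0 <= T x + e * (phi x * M x).
Proof.
move=> e1 x0.
(* As for [s >= 1], the vanishing term with [x - x] makes room for [h] frozen at [x]. *)
suff : 0 <= T x + phi x * (x - x) + e * (phi x * h x - G x).
  rewrite subrr mulr0 addr0 /M /N (_ : phi x * h x - G x = phi x * (h x - G x / phi x))//.
  by field; exact: phin0.
apply: (@ge0_decreasing_limit _ (fun y => T y + phi y * (y - x) + e * (phi y * h x - G y))
  (fun y => - phi y * (1 + (2 * y ^+ 2)^-1) + phi y - 2 * y * phi y * (y - x)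
     + e * (2 * y * phi y * (h y - h x)))
  (fun y => e * (phi y * (0 * y + h x) - G y))).
- by rewrite /T; cont; rewrite gt_eqF// mulr_gt0.
- move=> y xy; have y0 := lt_trans x0 xy.
  have dGy := dG y0; have dpy := dphi y; have yn : y != 0 by rewrite gt_eqF.
  by rewrite /T; deriv; [rewrite mulf_neq0|move: (phi y) (h y) (h x) => a b c /=; field].
- move=> y xy; have y0 := lt_trans x0 xy.
  have p0 : 0 < 2 * y * phi y by rewrite !mulr_gt0.
  have a1 : e * (2 * y * phi y * (h y - h x)) <= 2 * y * phi y * (y - x).
    rewrite (le_trans (ler_norm _))// normrM e1 mul1r normrM (gtr0_norm p0) ler_pM2l//.
    by rewrite (le_trans (h_lip _ _))// gtr0_norm// subr_gt0.
  have a2 : 0 <= phi y * (2 * y ^+ 2)^-1 by apply: mulr_ge0; [exact: ltW|rewrite invr_ge0 mulr_ge0 ?sqr_ge0].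
  lra.
- move=> y xy; have y0 := lt_trans x0 xy; rewrite mul0r add0r lerDr.
  by apply: addr_ge0; rewrite ?divr_ge0 ?mulr_ge0 ?subr_ge0 ?(ltW (phi0 y)) ?(ltW y0) ?(ltW xy).
- rewrite -[X in _ `=>` nbhs X](mulr0 e) -[X in _ `=>` nbhs (e * X)](subrr 0).
  apply: cvgM; first exact: cvg_cst.
  by apply: cvgB => //; exact: cvg_gauss_weight_lin.
Qed.

Let M_le x : 0 < x -> 2 * x * `|M x| <= 1.
Proof.
move=> x0; have P e := @M_le_sign e x.
have : `|phi x * M x| <= T x.
  by have := P 1 (normr1 _) x0; have := P (-1) (normrN1 _) x0; rewrite ler_norml; lra.
rewrite normrM (gtr0_norm (phi0 x)) => Mx; rewrite -(ler_pM2l (phi0 x)) mulr1.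
rewrite (_ : phi x = 2 * x * T x); last by rewrite /T; field; rewrite gt_eqF.
by rewrite (_ : 2 * x * T x * _ = 2 * x * (T x * 2 * x * `|M x|)); [|ring];
  rewrite ler_pM2l ?mulr_gt0// (_ : T x * 2 * x = phi x)//; rewrite /T; field; rewrite gt_eqF.
Qed.

Let M_lip x y : 0 <= x -> 0 <= y -> `|M y - M x| <= 2 * `|y - x|.
Proof.
move=> x0 y0; have -> : M y - M x = (h y - h x) - (N y - N x) by rewrite /M; ring.
have dN1 z : 0 < z -> `|- (2 * z * M z)| <= 1.
  by move=> z0; rewrite normrN normrM gtr0_norm ?mulr_gt0// M_le.
have := @lipschitz_derive_le _ N _ 1 x y x0 y0 (@cN 0) dN dN1.
by have := ler_normB (h y - h x) (N y - N x); have := h_lip y x; lra.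
Qed.

Lemma stein_half_lipschitz : exists M : R -> R,
  [/\ continuous M, exists B, forall x, 0 <= x -> `|M x| <= B,
   forall w, 0 <= w -> M w - primitive (fun t => (w + (2 * 2^-1 - 2) * (w - t)) * M t) w / 2^-1 = h w - m &
   forall x y, 0 <= x -> 0 <= y -> `|M y - M x| <= 2 * `|y - x|].
Proof.
exists M; split; [by move=> x; exact: cM| |exact: volterra|exact: M_lip].
have M1 x : 1 <= x -> `|M x| <= 1.
  move=> x1; have x0 : 0 < x by exact: lt_le_trans x1.
  have := M_le x0; have : 0 <= (x - 1) * `|M x| by rewrite mulr_ge0 ?subr_ge0.
  have := normr_ge0 (M x); nra.
(* Below 1 the estimate [M_le] degenerates; there [|M 1| <= 1] and the Lipschitz constant 2 give
   3. *)
exists 3 => x x0; have [x1|x1] := leP 1 x; first by apply: (le_trans (M1 _ x1)); rewrite ler1n.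
have := M_lip ler01 x0; rewrite [`|x - 1|]ler0_norm ?subr_le0 ?(ltW x1)//.
have := M1 1 (lexx _); have := ler_normD (M x - M 1) (M 1); rewrite subrK; lra.
Qed.

End lipschitz_data.
End stein_solution_half.

(** * Comparison of laws *)

Section real_integrals.
Context {R : realType} d (T : measurableType d) (mu : {measure set T -> \bar R}) (D : set T).
Hypothesis mD : measurable D.
Implicit Types f g : T -> R.

Lemma integrable_addr f g : mu.-integrable D (EFin \o f) -> mu.-integrable D (EFin \o g) ->
  mu.-integrable D (EFin \o (fun x => f x + g x)).
Proof.
move=> intf intg; have -> : EFin \o (fun x => f x + g x) = ((EFin \o f) \+ (EFin \o g))%E by [].
exact: integrableD.
Qed.

Lemma integrable_mulr c f : mu.-integrable D (EFin \o f) -> mu.-integrable D (EFin \o (fun x => c * f x)).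
Proof.
by move=> intf; exact: (integrableZl _ c intf).
Qed.

Lemma integrable_subr f g : mu.-integrable D (EFin \o f) -> mu.-integrable D (EFin \o g) ->
  mu.-integrable D (EFin \o (fun x => f x - g x)).
Proof.
move=> intf intg; have -> : EFin \o (fun x => f x - g x) = ((EFin \o f) \- (EFin \o g))%E by [].
exact: integrableB.
Qed.

End real_integrals.

Lemma Rintegral_probability_cst {R : realType} d (T : measurableType d) (P : probability T R) (c : R) :
  \int[P]_w c = c.
Proof. by rewrite Rintegral_cst// -[RHS]mulr1 -[X in _ = _ * X]/(fine 1%E) -(probability_setT P). Qed.

Section tdsb_expectations.
Context {R : realType}.
Variables (s : R) (hs : 2^-1 <= s).
Variables (d : measure_display) (T : measurableType d) (P : probability T R).
Variables (W Wstar : {RV P >-> R}).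
Hypothesis W0 : forall w, 0 <= W w.
Hypothesis EW2 : ('E_P[fun w => (W w ^+ 2)%R] = 1)%E.
Hypothesis hW : TDSB s W Wstar.
Let n := 2 * s - 2.
Let s0 : 0 < s. Proof. by apply: lt_le_trans hs; rewrite invr_gt0. Qed.

Lemma integral_sqr : (\int[P]_w (W w ^+ 2)%:E = 1)%E.
Proof. by move: EW2; rewrite unlock. Qed.

Lemma integrable_growth (k : R -> R) (A : R) : measurable_fun setT k -> 
  (forall x, 0 <= x -> `|k x| <= A * (1 + x ^+ 2)) ->
  P.-integrable setT (EFin \o (fun w => k (W w))).
Proof.
move=> mk kA.
apply: (@le_integrable _ _ _ P _ measurableT _ (EFin \o (fun w => A * (1 + W w ^+ 2)))).
- by apply/measurable_EFinP; exact: (measurableT_comp mk).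
- move=> w _; rewrite /= lee_fin (le_trans (kA _ (W0 w)))// ler_norm//.
- have -> : EFin \o (fun w => A * (1 + W w ^+ 2)) = (fun w => (A%:E * (1%:E + (W w ^+ 2)%:E))%E).
    by apply/funext => w /=; rewrite EFinM EFinD.
  apply: integrableZl => //; apply: integrableD => //; first exact: finite_measure_integrable_cst.
  apply/integrableP; split; first by apply/measurable_EFinP; exact: measurable_funX.
  under eq_integral do rewrite /= ger0_norm ?sqr_ge0//.
  by rewrite integral_sqr ltry.
Qed.

Let int_W : P.-integrable setT (EFin \o (fun w => W w)).
Proof.
apply: (@integrable_growth id 1) => // x x0; rewrite mul1r ger0_norm//.
by have := sqr_ge0 (x - 1); rewrite !expr2; nra.
Qed.

Let int_W2 : P.-integrable setT (EFin \o (fun w => W w ^+ 2)).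
Proof.
apply: (@integrable_growth (fun x => x ^+ 2) 1); first exact: measurable_funX.
by move=> x x0; rewrite mul1r ger0_norm ?sqr_ge0// lerDr.
Qed.

Lemma Rintegral_sqr : \int[P]_w (W w ^+ 2) = 1.
Proof. by rewrite /Rintegral integral_sqr. Qed.

Lemma Rintegral_le1 : \int[P]_w W w <= 1.
Proof.
have -> : 1 = \int[P]_w (2^-1 * (1 + W w ^+ 2)) :> R.
  rewrite RintegralZl//; last by apply: integrable_addr => //; exact: finite_measure_integrable_cst.
  rewrite RintegralD//; last exact: finite_measure_integrable_cst.
  by rewrite Rintegral_sqr Rintegral_probability_cst; field.
apply: le_Rintegral => //.
  apply: (@integrable_growth (fun x => 2^-1 * (1 + x ^+ 2)) 1).
    by apply: measurable_funM => //; apply: measurable_funD => //; exact: measurable_funX.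
  by move=> x x0; rewrite ger0_norm ?mulr_ge0 ?addr_ge0 ?sqr_ge0// ler_pM2r ?invf_le1 ?ler1n// ltr_pwDl// sqr_ge0.
by move=> w _; have := sqr_ge0 (W w - 1); rewrite !expr2; nra.
Qed.

Lemma primitive_nonneg_part (f g : R -> R) (x : R) : (forall t, 0 <= t -> f t = g t) -> primitive f x = primitive g x.
Proof.
by move=> fg; apply: eq_Rintegral => t; rewrite inE/= in_itv/= => /andP[t0 _]; exact: fg.
Qed.

(* The Volterra equation [M w - s^-1 \int_0^w (w + n (w - t)) M t dt = k w] turns the s-TDSB
   identity into [E k(W) = E M(W) - E M(Wstar)]. *)
Lemma TDSB_stein (M k : R -> R) (B : R) : continuous M -> (forall x, 0 <= x -> `|M x| <= B) ->
  (forall w, 0 <= w -> M w - primitive (fun t => (w + (2 * s - 2) * (w - t)) * M t) w / s = k w) ->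
  P.-integrable setT (EFin \o (fun w => k (W w))) ->
  P.-integrable setT (EFin \o (fun w => M (W w) - M (Num.max 0 (Wstar w)))) /\
  \int[P]_w k (W w) = \int[P]_w (M (W w) - M (Num.max 0 (Wstar w))).
Proof.
(* [M] is controlled on the nonnegative half-line and may change sign; clamping the argument and
   adding [B] makes it admissible for the s-TDSB identity. The shift adds [B] to one side and
   [B E W ^ 2 = B] to the other. *)
move=> cM MB Mk intk; pose M' x := M (Num.max 0 x) + B.
have cmax : continuous (fun x : R => Num.max 0 x).
  move=> x; apply: (@continuous_max _ _ (fun=> 0) id); [exact: cvg_cst|exact: cvg_id].
have cM' : continuous M'.
  move=> x; apply: cvgD; last exact: cvg_cst.
  by apply: (@cont_at_comp _ M (fun x => Num.max 0 x)); [exact: cmax|exact: cM].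
have max0 (x : R) : 0 <= Num.max 0 x by rewrite le_max lexx.
have M'0 x : 0 <= M' x <= 2 * B.
  by have := MB _ (max0 x); rewrite ler_norml /M'; lra.
have B0 : 0 <= B by apply: le_trans (MB 0 (lexx _)); exact: normr_ge0.
have mMs : measurable_fun setT (fun w => M (Num.max 0 (Wstar w))).
  apply: (measurableT_comp (continuous_measurable_fun cM)).
  by apply: measurable_maxr.
have intMs : P.-integrable setT (EFin \o (fun w => M (Num.max 0 (Wstar w)))).
  apply: (@le_integrable _ _ _ P _ measurableT _ (EFin \o cst B)).
  - exact/measurable_EFinP.
  - by move=> w _; rewrite /= lee_fin (ger0_norm B0) MB.
  - exact: finite_measure_integrable_cst.
have E1 : \int[P]_w M' (Wstar w) = \int[P]_w M (Num.max 0 (Wstar w)) + B.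
  rewrite RintegralD//; last exact: finite_measure_integrable_cst.
  by rewrite Rintegral_probability_cst.
pose J (w : R) := primitive (fun t => (w + n * (w - t)) * M t) w / s.
have JB w : 0 <= w -> primitive (fun t => (w + n * (w - t)) * M' t) w / s = J w + B * w ^+ 2.
  move=> w0; have -> : B * w ^+ 2 = primitive (fun t => (w + n * (w - t)) * B) w / s.
    rewrite /primitive (@FTC_integral _ _ (fun t => (w * t + n * (w * t - t ^+ 2 / 2)) * B) 0 w)//.
    - by rewrite /n; field; rewrite gt_eqF.
    - by move=> x _; cont.
    - by cont.
    - by move=> x x0; deriv => //=; field.
  rewrite /J -mulrDl; congr (_ / _).
  rewrite -RintegralD//; last 2 first.
  - by apply: continuous_integrable_itv => x; apply: (_ : cont_at _ x); have cMx : cont_at M x := cM x; cont.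
  - by apply: continuous_integrable_itv => x; apply: (_ : cont_at _ x); cont.
  by apply: primitive_nonneg_part => t t0; rewrite /M' max_r//; ring.
have := congr1 fine (TDSB_integral hs W0 EW2 hW cM' M'0).
rewrite -/(Rintegral _ _ _) -/(Rintegral _ _ _) E1.
have -> : \int[P]_w (primitive (fun t => (W w + (2 * s - 2) * (W w - t)) * M' t) (W w) / s) =
  \int[P]_w (J (W w) + B * W w ^+ 2).
  by apply: eq_Rintegral => w _; rewrite -JB.
have intM : P.-integrable setT (EFin \o (fun w => M (W w))).
  apply: (@integrable_growth M B); first exact: continuous_measurable_fun.
  by move=> x x0; rewrite (le_trans (MB _ x0))// ler_peMr// lerDl sqr_ge0.
have intB : P.-integrable setT (EFin \o (fun w => B * W w ^+ 2)) by exact: integrable_mulr.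
have intMk : P.-integrable setT (EFin \o (fun w => M (W w) - k (W w))) by exact: integrable_subr.
have -> : \int[P]_w (J (W w) + B * W w ^+ 2) = \int[P]_w (M (W w) - k (W w) + B * W w ^+ 2).
  by apply: eq_Rintegral => w _; rewrite -(Mk _ (W0 w)) /J /n; congr (_ + _); ring.
rewrite RintegralD// RintegralB// RintegralZl// Rintegral_sqr mulr1 => E.
split; first exact: integrable_subr.
by rewrite RintegralB//; lra.
Qed.

(** For [0 <= t <= w] the kernel [w + n (w - t)] is at most [2 s w], whatever the sign of [n]; the
    s-TDSB identity then gives [2 l E W], and [E W <= 1]. *)
Lemma TDSB_concentration (chi : R -> R) (l : R) : continuous chi -> (forall x, 0 <= chi x <= 1) ->
  (forall x, 0 <= x -> primitive chi x <= l) ->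
  P.-integrable setT (EFin \o (fun w => chi (Wstar w))) /\
  \int[P]_w chi (Wstar w) <= 2 * l.
Proof.
move=> cc chi01 chil.
have l0 : 0 <= l by apply: le_trans (chil 0 (lexx _)); rewrite primitive_le0.
have int1 : P.-integrable setT (EFin \o (fun w => chi (Wstar w))).
  apply: (@le_integrable _ _ _ P _ measurableT _ (EFin \o cst 1)).
  - apply/measurable_EFinP; apply: (measurableT_comp (continuous_measurable_fun cc)).
    exact: measurable_funP.
  - by move=> w _; rewrite /= lee_fin normr1 ger0_norm; have /andP[] := chi01 (Wstar w).
  - exact: finite_measure_integrable_cst.
split => //.
have int2 : P.-integrable setT (EFin \o (fun w => 2 * l * W w)) by exact: integrable_mulr.
apply: (@le_trans _ _ (\int[P]_w (2 * l * W w))); last first.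
  by rewrite RintegralZl// ler_piMr ?mulr_ge0// Rintegral_le1.
rewrite -lee_fin /Rintegral !fineK; try exact: integrable_fin_num.
rewrite (TDSB_integral hs W0 EW2 hW cc chi01).
apply: ge0_le_integral => //.
- move=> w _; rewrite lee_fin divr_ge0 ?(ltW s0)//; apply: Rintegral_ge0 => t /=; rewrite in_itv/= => /andP[t0 tw].
  have /andP[c0 _] := chi01 t; apply: mulr_ge0 => //; move: hs; nra.
- apply/measurable_EFinP.
  (* Splitting the kernel as [w (1 + n) - n t] exhibits a continuous, hence measurable, function of
     [w]. *)
  pose J (w : R) := (w * (1 + n) * primitive chi w - n * primitive (fun t => t * chi t) w) / s.
  have ctc : continuous (fun t : R => t * chi t).
    by move=> x; apply: (_ : cont_at _ x); have c1 : cont_at chi x := cc x; cont.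
  have cJ : continuous J.
    move=> x; apply: (_ : cont_at _ x); rewrite /J.
    have c1 : cont_at _ x := cont_primitive cc; have c2 : cont_at _ x := cont_primitive ctc; cont.
  rewrite (_ : (fun x => _) = (fun x => J (W x))).
    exact: (measurableT_comp (continuous_measurable_fun cJ)).
  apply/funext => w; rewrite /J; congr (_ / _).
  have i1 := continuous_integrable_itv 0 (W w) cc; have i2 := continuous_integrable_itv 0 (W w) ctc.
  rewrite /primitive -!RintegralZl//= -RintegralB//=; try exact: integrable_mulr.
  by apply: eq_Rintegral => t _; rewrite /n; ring.
- by apply/measurable_EFinP; apply: measurable_funM => //; exact: measurable_funP.
- move=> w _; rewrite lee_fin ler_pdivrMr//.
  apply: (@le_trans _ _ (2 * s * W w * primitive chi (W w))); last first.
    rewrite [leRHS](_ : _ = 2 * s * W w * l); last by ring.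
    by rewrite ler_wpM2l ?mulr_ge0 ?(ltW s0) ?W0// chil.
  have i1 := continuous_integrable_itv 0 (W w) cc.
  rewrite /primitive -RintegralZl//; apply: le_Rintegral => //.
  - apply: continuous_integrable_itv => x; apply: (_ : cont_at _ x).
    by have c1 : cont_at chi x := cc x; cont.
  - exact: integrable_mulr.
  - move=> t /=; rewrite in_itv/= => /andP[t0 tw]; have /andP[c0 _] := chi01 t.
    by apply: ler_wpM2r => //; move: hs; nra.
Qed.

End tdsb_expectations.

(** * Piecewise linear test functions *)

Section ramps.
Context {R : realType}.
Implicit Types (z e c r x y : R).

Definition ramp z e x : R := Num.max 0 (Num.min 1 ((z + e - x) / e)).

Lemma cont_max0 (f : R -> R) : continuous f -> continuous (fun x => Num.max 0 (f x)).
Proof. by move=> cf x; apply: (@continuous_max _ _ (fun=> 0) f); [exact: cvg_cst|exact: cf]. Qed.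

Lemma cont_min1 (f : R -> R) : continuous f -> continuous (fun x => Num.min 1 (f x)).
Proof. by move=> cf x; apply: (@continuous_min _ _ (fun=> 1) f); [exact: cvg_cst|exact: cf]. Qed.

Lemma ramp_continuous z e : e != 0 -> continuous (ramp z e).
Proof.
by move=> e0; apply: cont_max0; apply: cont_min1 => x; apply: (_ : cont_at _ x); cont.
Qed.

Lemma ramp01 z e x : 0 <= ramp z e x <= 1.
Proof. by rewrite /ramp le_max lexx/= ge_max ler01/= ge_min lexx. Qed.

Lemma ramp_eq1 z e x : 0 < e -> x <= z -> ramp z e x = 1.
Proof.
move=> e0 xz; rewrite /ramp min_l ?max_r ?ler01//.
by rewrite ler_pdivlMr// mul1r; lra.
Qed.

Lemma ramp_eq0 z e x : 0 < e -> z + e <= x -> ramp z e x = 0.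
Proof.
move=> e0 xz; rewrite /ramp max_l// ge_min; apply/orP; right.
by rewrite ler_pdivrMr// mul0r subr_le0.
Qed.

(** Equal to 1 within distance [r] of [c] and to 0 beyond [r + e]: a continuous stand-in for the
    indicator of an interval, as the s-TDSB identity is used with continuous functions. *)
Definition bump c r e x : R := ramp r e `|x - c|.

Lemma bump_continuous c r e : e != 0 -> continuous (bump c r e).
Proof.
move=> e0 x; apply: (@cont_at_comp _ (ramp r e) (fun x => `|x - c|)); last exact: ramp_continuous.
by cont.
Qed.

Lemma primitive_bump_le c r e x : 0 < e -> 0 <= r -> 0 <= x -> primitive (bump c r e) x <= 2 * (r + e).
Proof.
move=> e0 r0 x0.
rewrite -lee_fin /primitive /Rintegral fineK; last first.
  by apply: integrable_fin_num => //; apply: continuous_integrable_itv; apply: bump_continuous; rewrite gt_eqF.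
have m1 : measurable_fun setT (fun x => (bump c r e x)%:E).
  by apply/measurable_EFinP; apply: continuous_measurable_fun; apply: bump_continuous; rewrite gt_eqF.
apply: (@le_trans _ _ (\int[@lebesgue_measure R]_t (\1_(`[c - (r + e), c + (r + e)]%classic : set R) t)%:E)%E).
  apply: (@le_trans _ _ (\int[@lebesgue_measure R]_t (bump c r e t)%:E)%E).
    apply: ge0_subset_integral => //.
    by move=> t _; rewrite lee_fin; have /andP[] := ramp01 r e `|t - c|.
  apply: ge0_le_integral => //.
  - by move=> t _; rewrite lee_fin; have /andP[] := ramp01 r e `|t - c|.
  - apply/measurable_EFinP; exact: measurable_indic.
  - move=> t _; rewrite lee_fin indicE; have [_|] := boolP (t \in _).
      by have /andP[] := ramp01 r e `|t - c|.
    rewrite notin_setE/= in_itv/= -ler_distl => /negP; rewrite -ltNge => /ltW tc.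
    by rewrite /bump ramp_eq0.
rewrite integral_indic// setIT [leLHS](lebesgue_measure_itv `[c - (r + e), c + (r + e)])/= lte_fin.
case: ifPn => // _; last by rewrite lee_fin mulr_ge0// addr_ge0// ltW.
by rewrite -EFinD lee_fin; lra.
Qed.

(** The ramp varies only on [[z, z + e]], centred at [z + e / 2]. If [x] is farther than [b + e / 2]
    from the centre, then [x] and [y] lie on the same side of that interval. *)
Lemma ramp_bump z e b x y : 0 < e -> 0 <= b -> `|y - x| <= b ->
  `|ramp z e y - ramp z e x| <= bump (z + e / 2) (b + e / 2) e x.
Proof.
move=> e0 b0 yx.
have [/(ramp_eq1 e0) b1|xc] := leP `|x - (z + e / 2)| (b + e / 2).
  rewrite /bump b1 ler_norml; have /andP[? ?] := ramp01 z e y; have /andP[? ?] := ramp01 z e x; lra.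
have -> : ramp z e y = ramp z e x.
  move: xc yx; rewrite ltr_normr => /orP[] xc; rewrite ler_norml => /andP[yx1 yx2].
    by rewrite !ramp_eq0//; lra.
  by rewrite !ramp_eq1//; lra.
by rewrite subrr normr0; have /andP[] := ramp01 (b + e / 2) e `|x - (z + e / 2)|.
Qed.

End ramps.

Section target_law.
Context {R : realType}.
Notation mu := (@lebesgue_measure R).
Let D : set (measurableTypeR R) := `]0, +oo[%classic.
Let inD x : (x \in D) = (0 < x).
Proof. by rewrite /D mem_setE in_itv/= andbT. Qed.

Lemma integral_density_prob (g : R -> R) (mg : measurable_fun [set: R] g)
    (g0 : forall x, 0 <= g x) (g1 : (\int[mu]_x (g x)%:E = 1)%E) (f : R -> R) :
  measurable_fun setT f ->
  (\int[density_prob mg g0 g1]_x (f x)%:E = \int[mu]_x (f x * g x)%:E)%E.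
Proof.
move=> mf; have mfE : measurable_fun [set: R] (EFin \o f) by exact/measurable_EFinP.
rewrite integralE [RHS]integralE; congr (_ - _)%E.
  rewrite ge0_integral_density_prob//; last exact: measurable_funepos.
  apply: eq_integral => x _; rewrite !funeposE EFinM.
  by rewrite maxe_pMl ?lee_fin// mul0e.
rewrite ge0_integral_density_prob//; last exact: measurable_funeneg.
apply: eq_integral => x _; rewrite !funenegE EFinM.
by rewrite maxe_pMl ?lee_fin// mul0e mulNe.
Qed.

Lemma cvg_primitive_Rintegral (f : R -> R) : continuous f -> mu.-integrable D (EFin \o f) ->
  primitive f x @[x --> +oo] --> \int[mu]_(x in D) f x.
Proof.
move=> cf intf; rewrite Rintegral_itv_obnd_cbnd//; apply: cvg_primitive.
apply/integrableP; split.
  by apply: measurable_funTS; apply/measurable_EFinP; exact: continuous_measurable_fun.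
move/integrableP : intf => [mf]; rewrite integral_itv_obnd_cbnd//.
exact: measurableT_comp.
Qed.

Section K_measure.
Variables (s : R) (p : R -> R).
Hypotheses (cp : continuous p) (p0 : forall x, 0 < x -> 0 <= p x)
  (kp : forall x, 0 < x -> kappa s x = p x) (p1 : (\int[mu]_(x in D) (p x)%:E = 1)%E).

Let g (x : R) := p x * \1_D x.
Let mg : measurable_fun [set: R] g.
Proof. by apply: measurable_funM; [exact: continuous_measurable_fun|apply: measurable_indic; exact: measurable_itv]. Qed.
Let g0 x : 0 <= g x.
Proof.
rewrite /g indicE; have [|_] := boolP (x \in D); last by rewrite mulr0.
by rewrite inD mulr1; exact: p0.
Qed.
Let gE (f : R -> R) : (\int[mu]_x (f x * g x)%:E = \int[mu]_(x in D) (f x * p x)%:E)%E.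
Proof.
rewrite [RHS]integral_mkcond; apply: eq_integral => x _.
by rewrite patchE /g indicE; case: ifP => _; rewrite ?mulr1 ?mulr0.
Qed.
Let g1 : (\int[mu]_x (g x)%:E = 1)%E.
Proof.
under eq_integral do rewrite -[g _]mul1r.
by rewrite (gE (fun=> 1)); under eq_integral do rewrite mul1r.
Qed.

(** [kappa] is known on []0, +oo[] alone; the continuous [p] replaces it there, and [p] cut off by
    the indicator of [D] is a density on the whole line. *)
Lemma K_probability : exists Q : probability (measurableTypeR R) R, (K_ s = Q :> (set R -> \bar R)) /\
  forall f : R -> R, measurable_fun setT f ->
    (\int[Q]_x (f x)%:E = \int[mu]_(x in D) (f x * p x)%:E)%E.
Proof.
exists (density_prob mg g0 g1); split; last by move=> f mf; rewrite integral_density_prob// gE.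
apply/funext => A; rewrite /K_ /density_prob integral_mkcondr; apply: eq_integral => x _.
rewrite patchE /g indicE; case: ifPn => [|_]; last by rewrite mulr0.
by rewrite inD mulr1 => x0; rewrite kp.
Qed.

(** Provides the decay of [H] assumed in the construction for [s >= 1]. *)
Lemma centered_primitive_cvg0 (h : R -> R) : continuous h ->
  mu.-integrable D (EFin \o (fun x => h x * p x)) ->
  primitive (fun x => (h x - \int[mu]_(x in D) (h x * p x)) * p x) x @[x --> +oo] --> (0 : R).
Proof.
move=> ch inth; set m := \int[mu]_(x in D) _.
have mD : measurable D by exact: measurable_itv.
have intp : mu.-integrable D (EFin \o p).
  apply/integrableP; split.
    by apply: measurable_funTS; apply/measurable_EFinP; exact: continuous_measurable_fun.
  rewrite (_ : (\int[mu]_(x in D) _)%E = 1%E) ?ltry// -p1; apply: eq_integral => x.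
  by rewrite inD => x0; rewrite /= ger0_norm// p0.
have intmp : mu.-integrable D (EFin \o (fun x => m * p x)) by apply: integrable_mulr => //; exact: measurable_itv.
have -> : (fun x => (h x - m) * p x) = (fun x => h x * p x - m * p x).
  by apply/funext => x; rewrite mulrBl.
have -> : 0 = \int[mu]_(x in D) (h x * p x - m * p x).
  have Em : \int[mu]_(x in D) (m * p x) = m.
    by rewrite (RintegralZl _ mD intp) [X in _ * fine X]p1 mulr1.
  by rewrite (RintegralB mD inth intmp) Em subrr.
apply: cvg_primitive_Rintegral; last exact: (integrable_subr mD).
have c1 (y : R) : cont_at h y by exact: ch.
have c2 (y : R) : cont_at p y by exact: cp.
by move=> x; apply: (_ : cont_at _ x); cont.
Qed.

End K_measure.
End target_law.

Section kolmogorov_distance.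
Context {R : realType}.

Lemma fine_ray_right_continuous (Q : probability (measurableTypeR R) R) (z e : R) : 0 < e ->
  \forall y \near z^'+, fine (Q `]-oo, y]%classic) <= fine (Q `]-oo, z]%classic) + e.
Proof.
move=> e0.
have mi : measurable_fun [set: measurableTypeR R] (fun x : measurableTypeR R => x : R) by exact: measurable_id.
pose X : {RV Q >-> R} := @mfun_Sub _ _ (measurableTypeR R) R _ (mem_set mi).
have H : fine (cdf X y) @[y --> z^'+] --> fine (cdf X z).
  by apply: fine_cvg; rewrite fineK ?fin_num_measure//; exact: cdf_right_continuous.
move/cvgrPdist_le : H => /(_ _ e0); apply: filterS => y; rewrite ler_norml => /andP[yz _].
have := yz; rewrite /cdf /distribution /pushforward /=; lra.
Qed.

Lemma integrable_ramp (Q : probability (measurableTypeR R) R) (z e : R) : 0 < e ->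
  Q.-integrable setT (EFin \o ramp z e).
Proof.
move=> e0; apply: (@le_integrable _ _ _ Q _ measurableT _ (EFin \o cst 1)).
- apply/measurable_EFinP; apply: continuous_measurable_fun; apply: ramp_continuous; exact: lt0r_neq0.
- by move=> x _; rewrite /= lee_fin normr1 ger0_norm; have /andP[] := ramp01 z e x.
- exact: finite_measure_integrable_cst.
Qed.

Lemma ramp_ray (Q : probability (measurableTypeR R) R) (z e : R) : 0 < e ->
  fine (Q `]-oo, z]%classic) <= \int[Q]_x ramp z e x <= fine (Q `]-oo, (z + e)]%classic).
Proof.
move=> e0.
have ind (y : R) : (\int[Q]_x (\1_(`]-oo, y]%classic : set R) x)%:E = Q `]-oo, y]%classic)%E.
  by rewrite integral_indic// setIT.
have mr : measurable_fun [set: measurableTypeR R] (fun x => (ramp z e x)%:E).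
  apply/measurable_EFinP; apply: continuous_measurable_fun; apply: ramp_continuous; exact: lt0r_neq0.
have fr : (\int[Q]_x (ramp z e x)%:E)%E \is a fin_num.
  by apply: integrable_fin_num => //; exact: integrable_ramp.
apply/andP; split; rewrite -lee_fin /Rintegral !fineK ?fin_num_measure// -ind; apply: ge0_le_integral => //.
- by apply/measurable_EFinP; exact: measurable_indic.
- move=> x _; rewrite lee_fin indicE; have [|_] := boolP (x \in _); last by have /andP[] := ramp01 z e x.
  by rewrite inE/= in_itv/= => xz; rewrite ramp_eq1.
- by move=> x _; rewrite lee_fin; have /andP[] := ramp01 z e x.
- by apply/measurable_EFinP; exact: measurable_indic.
- move=> x _; rewrite lee_fin indicE; have [_|] := boolP (x \in _); first by have /andP[] := ramp01 z e x.
  by rewrite notin_setE/= in_itv/= => /negP; rewrite -ltNge => /ltW xz; rewrite ramp_eq0.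
Qed.

(** At each point, the ray of one law lies below its ramp, and the ramp of the other lies below its
    ray at [z + e]; right continuity brings [z + e] back to [z]. Exchanging the laws gives the
    opposite sign. *)
Lemma dK_le (Q1 Q2 : probability (measurableTypeR R) R) (b c : R) : 0 < c ->
  (forall z e, 0 < e -> `|\int[Q1]_x ramp z e x - \int[Q2]_x ramp z e x| <= b + c * e) ->
  (dK Q1 Q2 <= b%:E)%E.
Proof.
move=> c0 Qb.
have half (P1 P2 : probability (measurableTypeR R) R) z :
    (forall z e, 0 < e -> `|\int[P1]_x ramp z e x - \int[P2]_x ramp z e x| <= b + c * e) ->
    fine (P1 `]-oo, z]%classic) - fine (P2 `]-oo, z]%classic) <= b.
  move=> Pb; apply/ler_addgt0Pr => e e0.
  have e2 : 0 < e / 2 by rewrite divr_gt0.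
  near z^'+ => y; have zy : z < y by near: y; exact: nbhs_right_gt.
  have yz0 : 0 < y - z by rewrite subr_gt0.
  have h1 : fine (P2 `]-oo, y]%classic) <= fine (P2 `]-oo, z]%classic) + e / 2.
    by near: y; exact: fine_ray_right_continuous.
  have h2 : c * (y - z) <= e / 2.
    rewrite mulrC -ler_pdivlMr// lerBlDl; near: y; apply: nbhs_right_le.
    by rewrite ltrDl divr_gt0.
  have /andP[r1 _] := ramp_ray P1 z yz0; have /andP[_ r2] := ramp_ray P2 z yz0.
  have := Pb z _ yz0; rewrite ler_norml => /andP[_ r3].
  rewrite subrKC in r2; lra.
apply: ge_ereal_sup => _ [z _ <-].
rewrite -(fineK (fin_num_measure Q1 _ _))// -(fineK (fin_num_measure Q2 _ _))//.
rewrite -EFinB lee_fin ler_norml; apply/andP; split; last exact: half.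
rewrite lerNl opprB; apply: half => z' e e0; rewrite distrC; exact: Qb.
Unshelve. all: by end_near. Qed.

End kolmogorov_distance.

(** * From Stein solutions to distances, for both ranges of [s] *)

Section stein_bounds.
Context {R : realType}.
Notation mu := (@lebesgue_measure R).
Let D : set (measurableTypeR R) := `]0, +oo[%classic.
Let mD : measurable D. Proof. exact: measurable_itv. Qed.
Let inD x : (x \in D) = (0 < x).
Proof. by rewrite /D mem_setE in_itv/= andbT. Qed.
Variables (s : R) (p : R -> R) (hs : 2^-1 <= s).
Hypotheses (cp : continuous p) (p0 : forall x, 0 < x -> 0 <= p x)
  (kp : forall x, 0 < x -> kappa s x = p x) (p1 : (\int[mu]_(x in D) (p x)%:E = 1)%E).
Variables (d : measure_display) (T : measurableType d) (P : probability T R).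
Variables (W Wstar : {RV P >-> R}).
Hypothesis W0 : forall w, 0 <= W w.
Hypothesis EW2 : ('E_P[fun w => (W w ^+ 2)%R] = 1)%E.
Hypothesis hW : TDSB s W Wstar.

Let mean (h : R -> R) := \int[mu]_(x in D) (h x * p x).
Let mW : measurable_fun setT (W : T -> measurableTypeR R).
Proof. by have mWR : measurable_fun [set: T] (W : T -> R) by exact: measurable_funP. Qed.
Let W' : {RV P >-> measurableTypeR R} := @mfun_Sub _ _ T (measurableTypeR R) W (mem_set mW).

Let int_p : mu.-integrable D (EFin \o p).
Proof.
apply/integrableP; split.
  by apply: measurable_funTS; apply/measurable_EFinP; exact: continuous_measurable_fun.
rewrite (_ : (\int[mu]_(x in D) _)%E = 1%E) ?ltry// -p1; apply: eq_integral => x.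
by rewrite inD => x0; rewrite /= ger0_norm// p0.
Qed.

(** Clamping at 0 is a contraction that fixes [W]. *)
Let WWstar_norm w : `|W w - Num.max 0 (Wstar w)| <= `|W w - Wstar w|.
Proof.
have [ws|/ltW ws] := leP 0 (Wstar w); rewrite ?max_r// ?max_l//.
by rewrite subr0 !ger0_norm ?subr_ge0 ?W0 ?(le_trans ws)// lerBrDr gerDl.
Qed.

Let max0 (x : R) : 0 <= Num.max 0 x. Proof. by rewrite le_max lexx. Qed.

Variables (a0 a1 a2 : R).
Hypotheses (a0_ge0 : 0 <= a0) (a1_ge0 : 0 <= a1) (a2_ge0 : 0 <= a2).

(** Where [|W - Wstar| > beta], the crude bound [a2] is used. Elsewhere the increment of the ramp is
    dominated by a bump at [Wstar], whose expectation is small by concentration, and [E W <= 1]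
    turns [a0 + a1 W] into [a0 + a1]. *)
Lemma dK_stein (beta : R) : 0 <= beta ->
  (forall h : R -> R, continuous h -> (forall x, 0 <= h x <= 1) ->
    exists M : R -> R, [/\ continuous M, exists B, forall x, 0 <= x -> `|M x| <= B,
     forall w, 0 <= w -> M w - primitive (fun t => (w + (2 * s - 2) * (w - t)) * M t) w / s = h w - mean h &
     forall x y, 0 <= x -> 0 <= y -> `|M y - M x| <= a2 /\
       (`|y - x| <= beta -> `|M y - M x| <= `|h y - h x| + (a0 + a1 * y) * beta)]) ->
  (dK (distribution P W) (K_ s) <=
    ((4 + a0 + a1) * beta)%:E + a2%:E * P [set w | (beta < `|W w - Wstar w|)%R])%E.
Proof.
move=> beta0 stein.
pose A := [set w | beta < `|W w - Wstar w|].
have mA : measurable A.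
  have mf : measurable_fun [set: T] (fun w => `|W w - Wstar w|).
    by apply: measurableT_comp => //; exact: measurable_funB.
  have := mf measurableT _ (measurable_itv `]beta, +oo[); rewrite setTI.
  by congr (measurable _); apply/seteqP; split => w; rewrite /A /= in_itv/= andbT.
have [Q [QE Qint]] := K_probability cp p0 kp p1.
rewrite -[P _]fineK ?fin_num_measure// -EFinM -EFinD QE.
(* The bump has half-width [beta + e / 2] and slopes of width [e], so concentration gives
   [2 (2 (beta + e / 2 + e)) = 4 beta + 6 e]. *)
apply: (@dK_le _ (distribution P W') Q _ 6) => // z e e0.
have ch : continuous (ramp z e) by apply: ramp_continuous; exact: lt0r_neq0.
have [M [cM [B MB] volt Mlip]] := stein _ ch (ramp01 z e).
have intk : P.-integrable setT (EFin \o (fun w => ramp z e (W w) - mean (ramp z e))).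
  apply: integrable_subr => //; last exact: finite_measure_integrable_cst.
  apply: (integrable_growth W0 EW2 (k := ramp z e) (A := 1)).
    exact: continuous_measurable_fun.
  move=> x x0; have /andP[r0 r1] := ramp01 z e x; rewrite ger0_norm// mul1r (le_trans r1)//.
  by rewrite lerDl sqr_ge0.
have [intM EM] := TDSB_stein hs W0 EW2 hW cM MB volt intk.
have -> : \int[distribution P W']_x ramp z e x = \int[P]_w ramp z e (W w).
  rewrite /Rintegral; congr fine; rewrite ge0_integral_distribution//.
    by apply/measurable_EFinP; exact: continuous_measurable_fun.
  by move=> y; rewrite lee_fin; have /andP[] := ramp01 z e y.
have -> : \int[Q]_x ramp z e x = mean (ramp z e).
  by rewrite /mean /Rintegral Qint//; exact: continuous_measurable_fun.
have intr : P.-integrable setT (EFin \o (fun w => ramp z e (W w))).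
  have := integrable_addr measurableT intk (finite_measure_integrable_cst P (mean (ramp z e)) measurableT).
  by congr (P.-integrable _ _); apply/funext => w /=; rewrite subrK.
have -> : \int[P]_w ramp z e (W w) - mean (ramp z e) = \int[P]_w (M (W w) - M (Num.max 0 (Wstar w))).
  by rewrite -EM RintegralB ?Rintegral_probability_cst//; exact: finite_measure_integrable_cst.
apply: (le_trans (le_normr_Rintegral measurableT intM)).
pose chi x := bump (z + e / 2) (beta + e / 2) e (Num.max 0 x).
have cchi : continuous chi.
  move=> x; apply: (@cont_at_comp _ (bump _ _ _) (fun x => Num.max 0 x)).
    exact: (cont_max0 (f := fun x => x) (fun y => cvg_id)).
  by apply: bump_continuous; exact: lt0r_neq0.
have chi01 x : 0 <= chi x <= 1 by exact: ramp01.
have [intchi chile] : P.-integrable setT (EFin \o (fun w => chi (Wstar w))) /\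
    \int[P]_w chi (Wstar w) <= 2 * (2 * (beta + e / 2 + e)).
  apply: (TDSB_concentration hs W0 EW2 hW cchi chi01) => x x0.
  rewrite (@primitive_nonneg_part _ _ (bump (z + e / 2) (beta + e / 2) e)).
    by apply: primitive_bump_le => //; rewrite addr_ge0// divr_ge0// ltW.
  by move=> t t0; rewrite /chi max_r.
have intW : P.-integrable setT (EFin \o (fun w => W w)).
  apply: (integrable_growth W0 EW2 (k := id) (A := 1)) => // x x0; rewrite mul1r ger0_norm//.
  by have := sqr_ge0 (x - 1); rewrite !expr2; nra.
have int1 : P.-integrable setT (EFin \o (fun w => beta * (a0 + a1 * W w))).
  apply: integrable_mulr => //; apply: integrable_addr => //; first exact: finite_measure_integrable_cst.
  exact: integrable_mulr.
have intA : P.-integrable setT (EFin \o (fun w => a2 * \1_A w)).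
  by apply: integrable_mulr => //; exact: integrable_indic.
have intb : P.-integrable setT (EFin \o (fun w => chi (Wstar w) + beta * (a0 + a1 * W w) + a2 * \1_A w)).
  by apply: integrable_addr => //; exact: integrable_addr.
apply: (@le_trans _ _ (\int[P]_w (chi (Wstar w) + beta * (a0 + a1 * W w) + a2 * \1_A w))).
  apply: le_Rintegral => //; first exact: integrable_norm.
  move=> w _; have [M2 Mb] := Mlip _ _ (max0 (Wstar w)) (W0 w).
  rewrite indicE; have [|] := boolP (w \in A).
    rewrite mulr1 => _; apply: (le_trans M2); rewrite lerDr addr_ge0//.
      by have /andP[] := chi01 (Wstar w).
    by rewrite mulr_ge0// addr_ge0// mulr_ge0.
  rewrite notin_setE /A/= => /negP; rewrite -leNgt mulr0 addr0 => Wb.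
  have Wb' := le_trans (WWstar_norm w) Wb.
  apply: (le_trans (Mb Wb')); rewrite [beta * _]mulrC lerD2r.
  exact: ramp_bump.
rewrite RintegralD//; last exact: integrable_addr.
rewrite RintegralD// RintegralZl//; last first.
  apply: integrable_addr => //; first exact: finite_measure_integrable_cst.
  exact: integrable_mulr.
rewrite RintegralD//; last 2 first.
- exact: finite_measure_integrable_cst.
- exact: integrable_mulr.
rewrite Rintegral_probability_cst RintegralZl// RintegralZl//; last exact: integrable_indic.
have -> : \int[P]_w \1_A w = fine (P A) by rewrite /Rintegral integral_indic// setIT.
have : beta * (a0 + a1 * \int[P]_w W w) <= beta * (a0 + a1).
  by rewrite ler_wpM2l// lerD2l ler_piMr//; exact: Rintegral_le1.
rewrite -/A; lra.
Qed.

Lemma dW_stein (C : R) : 0 <= C -> mu.-integrable D (EFin \o (fun x => x * p x)) ->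
  (forall h : R -> R, (forall x y, `|h x - h y| <= `|x - y|) ->
    mu.-integrable D (EFin \o (fun x => h x * p x)) ->
    exists M : R -> R, [/\ continuous M, exists B, forall x, 0 <= x -> `|M x| <= B,
     forall w, 0 <= w -> M w - primitive (fun t => (w + (2 * s - 2) * (w - t)) * M t) w / s = h w - mean h &
     forall x y, 0 <= x -> 0 <= y -> `|M y - M x| <= C * `|y - x|]) ->
  (dW (distribution P W) (K_ s) <= C%:E * 'E_P[fun w => (`|W w - Wstar w|)%R])%E.
Proof.
move=> C0 intx stein.
have [Q [QE Qint]] := K_probability cp p0 kp p1.
rewrite QE; apply: ge_ereal_sup => _ [h [/= lip Nh] <-].
have h_lip := lipschitz_Lnorm_derive lip Nh.
have ch : continuous h.
  by apply: (@lipschitz_bound_continuous _ h 1) => // x y; rewrite mul1r.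
have mh : measurable_fun [set: R] h by exact: continuous_measurable_fun.
have h_le x : 0 <= x -> `|h x| <= x + `|h 0|.
  move=> x0; have := h_lip x 0; rewrite subr0 [`|x|]ger0_norm// => hx.
  by rewrite -[h x](subrK (h 0)) (le_trans (ler_normD _ _))// lerD2r.
have inth : mu.-integrable D (EFin \o (fun x => h x * p x)).
  apply: (@le_integrable _ _ _ mu _ mD _ (EFin \o (fun x => x * p x + `|h 0| * p x))).
  - apply: measurable_funTS; apply/measurable_EFinP; apply: measurable_funM => //.
    exact: continuous_measurable_fun.
  - move=> x; rewrite -inE inD => x0; rewrite /= lee_fin normrM [`|p x|]ger0_norm ?p0//.
    rewrite -mulrDl normrM [`|p x|]ger0_norm ?p0// ler_wpM2r ?p0//.
    by rewrite (le_trans (h_le x (ltW x0)))// ler_norm.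
  - by apply: (integrable_addr mD) => //; exact: (integrable_mulr mD).
have [M [cM [B MB] volt Mlip]] := stein _ h_lip inth.
have inthW : P.-integrable setT (EFin \o (fun w => h (W w))).
  apply: (integrable_growth W0 EW2 (k := h) (A := 1 + `|h 0|)) => // x x0.
  apply: (le_trans (h_le x x0)); have := normr_ge0 (h 0); have := sqr_ge0 (x - 1); have := sqr_ge0 x.
  rewrite !expr2; nra.
have intk : P.-integrable setT (EFin \o (fun w => h (W w) - mean h)).
  by apply: integrable_subr => //; exact: finite_measure_integrable_cst.
have [intM EM] := TDSB_stein hs W0 EW2 hW cM MB volt intk.
have E1 : (\int[distribution P W']_x (h x)%:E = \int[P]_w (h (W w))%:E)%E.
  have := @integral_distribution _ _ _ _ _ P W' (EFin \o h); apply => //.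
  exact/measurable_EFinP.
rewrite -[X in `|X - _|%E]/(\int[distribution P W']_x (h x)%:E)%E E1.
have -> : (\int[Q]_x (h x)%:E = (mean h)%:E)%E.
  by rewrite Qint// /mean /Rintegral fineK//; exact: integrable_fin_num.
rewrite -[(\int[P]_w (h (W w))%:E)%E]fineK; last exact: integrable_fin_num.
rewrite -EFinB -/(Rintegral _ _ _).
have -> : \int[P]_w h (W w) - mean h = \int[P]_w (M (W w) - M (Num.max 0 (Wstar w))).
  by rewrite -EM RintegralB ?Rintegral_probability_cst//; exact: finite_measure_integrable_cst.
rewrite abse_EFin EFin_normr_Rintegral//.
apply: (le_trans (le_abse_integral _ measurableT _)); first exact: measurable_int intM.
have mf : measurable_fun [set: T] (fun w => `|W w - Wstar w|).
  by apply: measurableT_comp => //; exact: measurable_funB.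
rewrite unlock -ge0_integralZl//; last exact/measurable_EFinP.
apply: ge0_le_integral => //.
- by apply: measurableT_comp => //; exact: measurable_int intM.
- by apply: measurable_funeM; exact/measurable_EFinP.
- move=> w _; rewrite /= -EFinM lee_fin; apply: (le_trans (Mlip _ _ (max0 _) (W0 w))).
  by rewrite ler_wpM2l.
Qed.

End stein_bounds.

(** * Moments of the target law *)

Section target_facts.
Context {R : realType}.
Notation mu := (@lebesgue_measure R).
Let D : set (measurableTypeR R) := `]0, +oo[%classic.
Let mD : measurable D. Proof. exact: measurable_itv. Qed.
Let inD x : (x \in D) = (0 < x).
Proof. by rewrite /D mem_setE in_itv/= andbT. Qed.

Lemma integral_id_gauss_weight (s : R) : 0 < s ->
  (\int[mu]_(x in D) (x * gauss_weight s x)%:E = s%:E)%E.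
Proof.
move=> s0; rewrite (@ge0_FTC_open R _ (fun x => - s * gauss_weight s x) 0 (- s * 1)).
- by rewrite mulr1 sub0r opprK.
- by move=> x x0; rewrite mulr_ge0 ?expR_ge0// ltW.
- move=> x x0; have cg (y : R) : cont_at (gauss_weight s) y by exact: continuous_gauss_weight.
  by cont.
- move=> x x0; have dg := has_deriv_gauss_weight s0 x; deriv => //=.
  by field; rewrite gt_eqF.
- rewrite -[X in _ `=>` nbhs X](mulr0 (- s)); apply: cvgM; first exact: cvg_cst.
  have := @cvg_gauss_weight_lin _ s 0 1 s0.
  by apply: cvg_pinfty_eq => x x0; rewrite mul0r add0r mulr1.
- apply: cvgM; first exact: cvg_cst.
  have := cvg_at_right_filter (@continuous_gauss_weight R s s0 0).
  by rewrite /gauss_weight expr0n/= oppr0 mul0r expR0.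
Qed.

Section density_with_mass1.
Variable p : R -> R.
Hypotheses (cp : continuous p) (p0 : forall x, 0 < x -> 0 <= p x)
  (p1 : (\int[mu]_(x in D) (p x)%:E = 1)%E).

Let int_p : mu.-integrable D (EFin \o p).
Proof.
apply/integrableP; split.
  by apply: measurable_funTS; apply/measurable_EFinP; exact: continuous_measurable_fun.
rewrite (_ : (\int[mu]_(x in D) _)%E = 1%E) ?ltry// -p1; apply: eq_integral => x.
by rewrite inD => x0; rewrite /= ger0_norm// p0.
Qed.

Let Rint_p : \int[mu]_(x in D) p x = 1. Proof. by rewrite /Rintegral p1. Qed.

Lemma integrable_bounded_density (h : R -> R) : continuous h -> (forall x, 0 <= h x <= 1) ->
  mu.-integrable D (EFin \o (fun x => h x * p x)).
Proof.
move=> ch h01; apply: (@le_integrable _ _ _ mu _ mD _ (EFin \o p)) => //.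
  apply: measurable_funTS; apply/measurable_EFinP; apply: measurable_funM; exact: continuous_measurable_fun.
move=> x; rewrite -inE inD => x0; rewrite /= lee_fin; have /andP[h0 h1] := h01 x.
by rewrite normrM [`|h x|]ger0_norm// ler_piMl.
Qed.

Lemma mean_density01 (h : R -> R) : continuous h -> (forall x, 0 <= h x <= 1) ->
  0 <= \int[mu]_(x in D) (h x * p x) <= 1.
Proof.
move=> ch h01; apply/andP; split.
  apply: Rintegral_ge0 => x; rewrite -inE inD => x0; have /andP[h0 h1] := h01 x.
  by rewrite mulr_ge0// p0.
rewrite -Rint_p; apply: le_Rintegral => //; first exact: integrable_bounded_density.
move=> x; rewrite -inE inD => x0; have /andP[h0 h1] := h01 x.
by rewrite ler_piMl// p0.
Qed.

(** [h x] minus the mean is the average of [h x - h y] over [y], and [|x - y| <= x + y]. *)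
Lemma mean_density_lipschitz (h : R -> R) (x : R) : (forall x y, `|h x - h y| <= `|x - y|) ->
  mu.-integrable D (EFin \o (fun x => x * p x)) ->
  mu.-integrable D (EFin \o (fun x => h x * p x)) -> 0 <= x ->
  `|h x - \int[mu]_(x in D) (h x * p x)| <= x + \int[mu]_(x in D) (x * p x).
Proof.
move=> h_lip intx inth x0.
have int1 c : mu.-integrable D (EFin \o (fun y => c * p y)) by exact: (integrable_mulr mD).
have E c : c = \int[mu]_(y in D) (c * p y).
  by rewrite (RintegralZl _ mD int_p) Rint_p mulr1.
rewrite [X in `|X - _| <= _]E [X in _ <= X + _]E -(RintegralB mD (int1 _) inth) -(RintegralD mD (int1 _) intx).
have intd : mu.-integrable D (EFin \o (fun y => h x * p y - h y * p y)) by exact: (integrable_subr mD).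
apply: (le_trans (le_normr_Rintegral mD intd)); apply: le_Rintegral => //.
- exact: integrable_norm.
- exact: (integrable_addr mD).
- move=> y; rewrite -inE inD => y0; rewrite -mulrBl -mulrDl normrM [`|p y|]ger0_norm ?p0//.
  rewrite ler_wpM2r ?p0//; apply: (le_trans (h_lip x y)); apply: (le_trans (ler_normB _ _)).
  by rewrite !ger0_norm// ltW.
Qed.

End density_with_mass1.

Section density_factor_mean.
Variables (s : R) (V : R -> R).
Hypotheses (s1 : 1 <= s) (hV : density_factor s V).
Notation phi := (gauss_weight s).
Let s0 : 0 < s. Proof. exact: lt_le_trans s1. Qed.
Let V0 x : 0 < V x. Proof. by have [] := hV. Qed.
Let phi0 x : 0 < phi x. Proof. exact: gauss_weight_gt0. Qed.
Let cV (x : R) : cont_at V x. Proof. by have [cV _ _ _ _] := hV; exact: cV. Qed.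
Let cphi (x : R) : cont_at phi x. Proof. exact: continuous_gauss_weight. Qed.

Lemma density_factor_continuous : continuous (fun x => V x * phi x).
Proof. by move=> x; apply: (_ : cont_at _ x); cont. Qed.

Lemma density_factor_nonincreasing (x y : R) : 0 < x -> x <= y -> V y <= V x.
Proof.
move=> x0 xy; have cp := density_factor_continuous.
have [_ _ _ iV dV] := hV.
have S0 z : 0 < z -> 0 <= 1 - primitive (fun t => V t * phi t) z.
  move=> z0; apply: (@ge0_decreasing_limit _ (fun z => 1 - primitive (fun t => V t * phi t) z)
    (fun z => - (V z * phi z)) (fun z => 1 - primitive (fun t => V t * phi t) z)) => //.
  - by have c1 := @cont_primitive _ _ z cp; cont.
  - move=> t zt; have dp := has_deriv_primitive cp (lt_trans z0 zt); deriv; ring.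
  - by move=> t zt; rewrite oppr_le0 mulr_ge0 ?(ltW (V0 t)) ?(ltW (phi0 t)).
  - rewrite -[X in _ `=>` nbhs X](subrr 1); apply: cvgB; first exact: cvg_cst.
    by apply: (cvg_primitive_open cp _ iV) => t; rewrite mulr_ge0 ?(ltW (V0 t)) ?(ltW (phi0 t)).
apply: (@nonincreasing_derive_le0 _ V
  (fun x => - ((2 * s - 2) / s) * (1 - primitive (fun t => V t * phi t) x) / phi x)) => //.
- by move=> z xz; apply: dV; exact: lt_trans xz.
- move=> z xz; have z0 := lt_trans x0 xz; have Sz := S0 z z0.
  rewrite !mulNr oppr_le0 divr_ge0 ?(ltW (phi0 z))// mulr_ge0// divr_ge0 ?(ltW s0)//.
  by move: s1; lra.
Qed.

(** As [V] is nonincreasing, [(x - c) (V x - V c) <= 0]. Integrated against [phi], whose moments of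
    order 0 and 1 are [q] and [s], this bounds the mean by [c + V c (s - c q)]; for [c = sqrt s] the
    bracket is nonpositive because [pi >= 2]. *)
Lemma density_factor_mean : mu.-integrable D (EFin \o (fun x => x * (V x * phi x))) /\
  \int[mu]_(x in D) (x * (V x * phi x)) <= Num.sqrt s.
Proof.
pose c := Num.sqrt s; pose q := Num.sqrt (pi * s / 2).
have c0 : 0 < c by rewrite sqrtr_gt0.
have [_ _ _ iV _] := hV.
have cmeas (f : R -> R) : (forall x, cont_at f x) -> measurable_fun D (EFin \o f).
  by move=> cf; apply: measurable_funTS; apply/measurable_EFinP; apply: continuous_measurable_fun => x; exact: cf.
have m1 : measurable_fun D (EFin \o (fun x => x * (V x * phi x))) by apply: cmeas => x; cont.
have m2 : measurable_fun D (EFin \o (fun x => V c * c * phi x)) by apply: cmeas => x; cont.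
have m3 : measurable_fun D (EFin \o (fun x => c * (V x * phi x))) by apply: cmeas => x; cont.
have m4 : measurable_fun D (EFin \o (fun x => V c * (x * phi x))) by apply: cmeas => x; cont.
have m5 : measurable_fun D (EFin \o (fun x => phi x)) by apply: cmeas => x; cont.
have m6 : measurable_fun D (EFin \o (fun x => x * phi x)) by apply: cmeas => x; cont.
have m7 : measurable_fun D (EFin \o (fun x => V x * phi x)) by apply: cmeas => x; cont.
have DP x : D x -> 0 < x by rewrite -inE inD.
have Vphi0 x : 0 <= V x * phi x by rewrite mulr_ge0 ?(ltW (V0 x)) ?(ltW (phi0 x)).
have Vc0 : 0 <= V c by exact: ltW.
have iphi : (\int[mu]_(x in D) (phi x)%:E = q%:E)%E.
  have := @integral_gauss_weight R s 1 s0 ltr01; rewrite sqrtr1 divr1 => <-.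
  by apply: eq_integral => x _; rewrite mulr1.
have cq : s <= c * q.
  have cc : c * c = s by rewrite -expr2 sqr_sqrtr// ltW.
  rewrite -{1}cc ler_pM2l// /c /q ler_wsqrtr// mulrAC ler_peMl ?(ltW s0)//.
  by rewrite ler_pdivlMr// mul1r pi_ge2.
have key : (\int[mu]_(x in D) (x * (V x * phi x))%:E + (V c * c * q)%:E <= (c + V c * s)%:E)%E.
  have -> : ((V c * c * q)%:E = \int[mu]_(x in D) (V c * c * phi x)%:E)%E.
    under eq_integral do rewrite EFinM.
    rewrite ge0_integralZl//; first by rewrite iphi.
    - by move=> x _; rewrite lee_fin ltW.
    - by rewrite lee_fin mulr_ge0// ltW.
  have -> : ((c + V c * s)%:E = \int[mu]_(x in D) ((c * (V x * phi x))%:E + (V c * (x * phi x))%:E))%E.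
    rewrite ge0_integralD//; last 2 first.
    - by move=> x _; rewrite lee_fin mulr_ge0// ltW.
    - by move=> x /DP x0; rewrite lee_fin !mulr_ge0// ltW.
    under eq_integral do rewrite EFinM.
    under [X in (_ = _ + X)%E]eq_integral do rewrite EFinM.
    rewrite !ge0_integralZl//.
    - by rewrite iV integral_id_gauss_weight// mule1.
    - by move=> x /DP x0; rewrite lee_fin mulr_ge0// ltW.
    - by rewrite lee_fin ltW.
    - by move=> x /DP x0; rewrite lee_fin mulr_ge0// ltW.
  rewrite -ge0_integralD//; last 2 first.
  - by move=> x /DP x0; rewrite lee_fin mulr_ge0// ltW.
  - by move=> x _; rewrite lee_fin !mulr_ge0// ltW.
  apply: ge0_le_integral => //.
  - by move=> x /DP x0; rewrite -EFinD lee_fin addr_ge0// !mulr_ge0// ltW.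
  - exact: emeasurable_funD.
  - exact: emeasurable_funD.
  - move=> x /DP x0; rewrite -!EFinD lee_fin.
    have : (x - c) * (V x - V c) <= 0.
      have [xc|/ltW cx] := leP x c.
        by apply: mulr_le0_ge0; rewrite ?subr_le0 ?subr_ge0// density_factor_nonincreasing.
      by apply: mulr_ge0_le0; rewrite ?subr_le0 ?subr_ge0// density_factor_nonincreasing.
    by rewrite -(pmulr_lle0 _ (phi0 x)); lra.
have mean_le : (\int[mu]_(x in D) (x * (V x * phi x))%:E <= c%:E)%E.
  have : (\int[mu]_(x in D) (x * (V x * phi x))%:E <= (c + V c * s - V c * c * q)%:E)%E.
    by rewrite EFinB leeBrDr.
  move=> /le_trans; apply; rewrite lee_fin -mulrA lerBlDr lerD2l ler_wpM2l//.
have intx : mu.-integrable D (EFin \o (fun x => x * (V x * phi x))).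
  apply/integrableP; split => //.
  rewrite (_ : (\int[mu]_(x in D) _)%E = (\int[mu]_(x in D) (x * (V x * phi x))%:E)%E).
    exact: le_lt_trans mean_le (ltry _).
  by apply: eq_integral => x; rewrite inD => x0; rewrite /= ger0_norm// mulr_ge0// ltW.
split => //; rewrite -lee_fin /Rintegral fineK//; exact: integrable_fin_num.
Qed.

End density_factor_mean.
End target_facts.

Section half.
Context {R : realType}.
Notation mu := (@lebesgue_measure R).
Let D : set (measurableTypeR R) := `]0, +oo[%classic.
Notation phi := (gauss_weight (2^-1 : R)).
Let s0 : 0 < 2^-1 :> R. Proof. by rewrite invr_gt0. Qed.
Let phi0 x : 0 < phi x. Proof. exact: gauss_weight_gt0. Qed.
Let cphi (x : R) : cont_at phi x. Proof. exact: continuous_gauss_weight. Qed.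
Let phi00 : phi 0 = 1. Proof. by rewrite /gauss_weight expr0n/= oppr0 mul0r expR0. Qed.
Let dphi x : has_deriv phi x (- (2 * x) * phi x).
Proof. by apply: has_deriv_eq (has_deriv_gauss_weight s0 x) _; rewrite invrK [x * 2]mulrC. Qed.

Definition half_density (x : R) : R := 2 * x * phi x.

Lemma half_density_continuous : continuous half_density.
Proof. by move=> x; apply: (_ : cont_at _ x); rewrite /half_density; cont. Qed.

Lemma half_density_ge0 x : 0 < x -> 0 <= half_density x.
Proof. by move=> x0; rewrite /half_density !mulr_ge0 ?(ltW (phi0 x)) ?(ltW x0). Qed.

Lemma kappa_half_density x : 0 < x -> kappa 2^-1 x = half_density x.
Proof.
move=> x0; rewrite kappa_half// /half_density /gauss_weight divff//.
by rewrite divr1.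
Qed.

Lemma integral_half_density : (\int[mu]_(x in D) (half_density x)%:E = 1)%E.
Proof.
rewrite (@ge0_FTC_open R _ (fun x => - phi x) 0 (- 1)) ?sub0r ?opprK//.
- exact: half_density_ge0.
- by move=> x _; exact: half_density_continuous.
- by move=> x _; have dx := dphi x; deriv; rewrite /half_density; ring.
- rewrite -[X in _ `=>` nbhs X]oppr0; apply: cvgN.
  have := @cvg_gauss_weight_lin _ 2^-1 0 1 s0.
  by apply: cvg_pinfty_eq => x x0; rewrite mul0r add0r mulr1.
- by apply: cvgN; have := cvg_at_right_filter (@cphi 0); rewrite phi00.
Qed.

Lemma integrable_id_half_density : mu.-integrable D (EFin \o (fun x => x * half_density x)).
Proof.
have cph : continuous phi by move=> x; exact: cphi.
(* Integration by parts gives [- x phi] plus the Gaussian primitive; the affine form [1 * x + 0] is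
   the shape of [cvg_gauss_weight_lin]. *)
apply: (@ge0_FTC_open_integrable _ _ (fun x => - (phi x * (1 * x + 0)) + primitive phi x) (- 0 + Num.sqrt pi / 2) 0).
- by move=> x x0; rewrite mulr_ge0 ?half_density_ge0// ltW.
- move=> x _; have c1 (y : R) : cont_at half_density y by exact: half_density_continuous.
  by cont.
- move=> x x0; have dx := dphi x; have dp := has_deriv_primitive cph x0.
  by deriv; rewrite /half_density; ring.
- apply: cvgD; first by apply: cvgN; exact: cvg_gauss_weight_lin.
  have := @cvg_primitive_gauss R; rewrite (_ : primitive (@gauss_fun R) = primitive phi)//.
  by congr primitive; apply/funext => x; rewrite /gauss_fun /gauss_weight divff// divr1.
- have c1 : cont_at (fun x => - (phi x * (1 * x + 0)) + primitive phi x) 0.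
    by have c2 := @cont_primitive _ _ 0 cph; cont.
  have := cvg_at_right_filter c1.
  by rewrite primitive_le0// mulr0 !addr0 mulr0 oppr0; exact.
Qed.

End half.

Theorem theorem1p2 (R : realType) (d : measure_display) (T : measurableType d)
    (P : probability T R) (s : R) (W Wstar : {RV P >-> R})
    (hs : 1 <= s \/ s = 2^-1)
    (W_ge0 : forall w, 0 <= W w)
    (EW2 : ('E_P[fun w => (W w ^+ 2)%R] = 1)%E)
    (hWstar : TDSB s W Wstar) :
  (1 <= s ->
     (dW (distribution P W) (K_ s) <=
        (8 * s * (s + 4^-1 + Num.sqrt (pi / 2)))%:E *
          'E_P[fun w => `|W w - Wstar w|%R])%E /\
     (forall beta : R, 0 <= beta ->
        (dK (distribution P W) (K_ s) <=
          (53 * s * beta)%:E +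
          (34 * s `^ (3 / 2))%:E *
            P [set w | (beta < `|W w - Wstar w|)%R])%E)) /\
  (s = 2^-1 ->
     (dW (distribution P W) (K_ 2^-1) <=
        2%:E * 'E_P[fun w => `|W w - Wstar w|%R])%E /\
     (forall beta : R, 0 <= beta ->
        (dK (distribution P W) (K_ 2^-1) <=
          (26 * beta)%:E + 8%:E *
            P [set w | (beta < `|W w - Wstar w|)%R])%E)).
Proof.
split => [s1|sE].
  have s0 : 0 < s by exact: lt_le_trans s1.
  have hs2 : 2^-1 <= s by move: s1; lra.
  have [V hV] := exists_density_factor s1; have [cV V0 kV iV _] := hV.
  have cp := density_factor_continuous s1 hV.
  have p0 x : 0 < x -> 0 <= V x * gauss_weight s x.
    by move=> _; rewrite mulr_ge0 ?(ltW (V0 x))// ltW// gauss_weight_gt0.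
  split.
    have [intx meanx] := density_factor_mean s1 hV.
    apply: (dW_stein hs2 cp p0 kV iV W_ge0 EW2 hWstar) => //.
      by rewrite !mulr_ge0 ?addr_ge0 ?sqrtr_ge0 ?(ltW s0).
    move=> h h_lip inth.
    have ch : continuous h.
      by apply: (@lipschitz_bound_continuous _ h 1) => // x y; rewrite mul1r.
    set m := Rintegral _ _ _.
    apply: (@stein_lipschitz _ s V (fun x => h x - m) 1 (Num.sqrt s) s1 hV) => //.
    - by move=> x; apply: cvgB; [exact: ch|exact: cvg_cst].
    - move=> x x0; rewrite mul1r.
      apply: (le_trans (mean_density_lipschitz cp p0 iV h_lip intx inth x0)).
      by rewrite lerD2l.
    - exact: (centered_primitive_cvg0 cp p0 iV ch inth).
    - by move=> x y; rewrite opprB addrA subrK.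
  move=> beta beta0.
  (* [a0 = 8 s - 4], [a1 = 6] and [a2 = 6 + 6] come from [stein_bounded]; for [s >= 1] they leave
     room below 53 and 34. *)
  apply: (@le_trans _ _ (((4 + (8 * s - 4) + 6) * beta)%:E + 12%:E * P [set w | (beta < `|W w - Wstar w|)%R])%E).
    apply: (dK_stein hs2 cp p0 kV iV W_ge0 EW2 hWstar) => //; first by move: s1; lra.
    move=> h ch h01; set m := Rintegral _ _ _.
    have /andP[m0 m1] : 0 <= m <= 1 by exact: (mean_density01 cp p0 iV ch h01).
    have inth := integrable_bounded_density cp p0 iV ch h01.
    have kh x : 0 <= x -> `|h x - m| <= 0 * x + 1.
      by move=> _; have /andP[h0 h1] := h01 x; rewrite mul0r add0r ler_norml; lra.
    have chm : continuous (fun x => h x - m).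
      by move=> x; apply: cvgB; [exact: ch|exact: cvg_cst].
    have [M [cM M6 volt Mlip]] := stein_bounded s1 hV chm (lexx 0) ler01 kh
      (centered_primitive_cvg0 cp p0 iV ch inth) erefl erefl.
    exists M; split => //; first by exists 6.
    move=> x y x0 y0; split.
      by rewrite (le_trans (ler_normB _ _))// (le_trans (lerD (M6 _ y0) (M6 _ x0)))//; lra.
    move=> yx; apply: (le_trans (Mlip x y x0 y0)); rewrite opprB addrA subrK lerD2l.
    by rewrite ler_wpM2l//; move: s1; lra.
  apply: leeD.
    by rewrite lee_fin ler_wpM2r//; move: s1; lra.
  rewrite lee_wpmul2r// lee_fin.
  have : 1 <= s `^ (3 / 2) by rewrite -[leLHS](powRr0 s) ler_powR.
  lra.
have hs2 : 2^-1 <= s by rewrite sE.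
have cp := @half_density_continuous R; have p0 := @half_density_ge0 R.
have kp := @kappa_half_density R; have p1 := @integral_half_density R.
rewrite sE in hWstar.
split.
  apply: (dW_stein (lexx _) cp p0 kp p1 W_ge0 EW2 hWstar) => //; first exact: integrable_id_half_density.
  move=> h h_lip inth.
  have ch : continuous h.
    by apply: (@lipschitz_bound_continuous _ h 1) => // x y; rewrite mul1r.
  have chp : continuous (fun x => h x * half_density x).
    by move=> x; apply: cvgM; [exact: ch|exact: cp].
  exact: (stein_half_lipschitz ch (cvg_primitive_Rintegral chp inth) h_lip).
move=> beta beta0.
(* Here [a0 = a1 = 2], and [a2 = 2] is twice the bound 1 on [M]. *)
apply: (@le_trans _ _ (((4 + 2 + 2) * beta)%:E + 2%:E * P [set w | (beta < `|W w - Wstar w|)%R])%E).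
  apply: (dK_stein (lexx _) cp p0 kp p1 W_ge0 EW2 hWstar) => // h ch h01.
  have inth := integrable_bounded_density cp p0 p1 ch h01.
  have chp : continuous (fun x => h x * half_density x).
    by move=> x; apply: cvgM; [exact: ch|exact: cp].
  have [M [cM M1 volt Mlip]] := stein_half_bounded ch (cvg_primitive_Rintegral chp inth) (fun x _ => h01 x).
  exists M; split => //; first by exists 1.
  move=> x y x0 y0; have M2 : `|M y - M x| <= 2.
    by rewrite (le_trans (ler_normB _ _))// (le_trans (lerD (M1 _ y0) (M1 _ x0))).
  (* If [beta <= 1], then [x + y <= 2 y + beta <= 2 + 2 y]; if [beta > 1], the crude bound 2 is
     already below [(2 + 2 y) beta]. *)
  split => // yx; have [b1|/ltW b1] := leP beta 1.
    apply: (le_trans (Mlip x y x0 y0)); rewrite lerD2l.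
    apply: (@le_trans _ _ ((x + y) * beta)); first by rewrite ler_wpM2l// addr_ge0.
    rewrite ler_wpM2r//; move: yx; rewrite ler_norml; lra.
  apply: (le_trans M2); have := normr_ge0 (h y - h x); have := mulr_ge0 y0 beta0; nra.
by apply: leeD; [rewrite lee_fin ler_wpM2r//; lra|rewrite lee_wpmul2r// lee_fin; lra].
Qed.
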